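(* Let $(U_n)_{n\ge 0}$ be the negative but linearly reinforced urn scheme with $k$ colours, parameter $\theta\ge 1$, stochastic replacement matrix $R$ and initial configuration $U_0$, and suppose that $\hat R=\frac{1}{k\theta-1}(\theta J_k-R)$ is irreducible. Let $\mu$ be the unique solution of $(\theta\mathbf 1-\mu)R=(k\theta-1)\mu$. Assume that one of the following holds, and define $\sigma_n$ accordingly: (i) $k\ge 3$, and $$\sigma_n=\begin{cases}\sqrt{n\log n}&\text{if } k=3,\ \theta=1 \text{ and one of the eigenvalues of } R \text{ is } -1,\\ \sqrt n&\text{otherwise;}\end{cases}$$ (ii) $k=2$, $\theta\in[1,\tfrac32]$, the eigenvalues of $R$ are $1$ and $\lambda$ with $\lambda\ge\frac{1-2\theta}{2}$, and $$\sigma_n=\begin{cases}\sqrt{n\log n}&\text{if } \lambda=\frac{1-2\theta}{2},\\ \sqrt n&\text{if } \lambda>\frac{1-2\theta}{2}.\end{cases}$$ Then there exists a $k\times k$ variance-covariance matrix $\Sigma\equiv\Sigma(\theta,k)$ such that $$\frac{U_n-n\mu}{\sigma_n}\Longrightarrow \mathcal N_k(0,\Sigma)\quad\text{as } n\to\infty .$$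
   Context: Model. Let $k\ge 2$ be an integer, $S=\{0,1,\dots,k-1\}$ the set of colours, $\theta\ge 1$ a real parameter, $R=((R_{i,j}))_{0\le i,j\le k-1}$ a stochastic matrix (nonnegative entries, all row sums equal to $1$), and $U_0=(U_{0,j})_{0\le j\le k-1}$ a (deterministic) probability vector on $S$. The negative but linearly reinforced urn scheme with initial configuration $U_0$ and replacement matrix $R$ is the process $(U_n)_{n\ge0}$ of random row vectors in $[0,\infty)^k$ defined recursively as follows. With $\mathcal F_n=\sigma(U_0,\dots,U_n)$, the random colour $Z_n\in S$ (the colour chosen at draw $n+1$) satisfies $$\mathbb P(Z_n=j\mid\mathcal F_n)=\frac{1}{k\theta-1}\left(\theta-\frac{U_{n,j}}{n+1}\right),\quad 0\le j\le k-1,$$ and $U_{n+1}=U_n+\chi_{n+1}R$, where $\chi_{n+1}=(\mathbf 1(Z_n=j))_{0\le j\le k-1}$ is a row vector. (Then $\sum_j U_{n,j}=n+1$ for all $n$.) Notation. $\mathbf 1$ denotes the row vector of length $k$ with all entries $1$, $J_k$ the $k\times k$ matrix with all entries $1$. The matrix $\hat R=\frac{1}{k\theta-1}(\theta J_k-R)$ is stochastic, and irreducibility is meant in the Markov chain sense. $\Longrightarrow$ denotes convergence in distribution; $\mathcal N_k(0,\Sigma)$ is the $k$-variate normal law with mean $0$ and covariance $\Sigma$, where $\Sigma$ is symmetric positive semi-definite and may be singular. The model, in particular $R$, is fixed, and $\Sigma$ may depend on $R$. *)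

(* Defs.v *)
From HB Require Import structures.
From mathcomp Require Import all_boot all_order all_algebra.
From mathcomp Require Import all_classical all_reals all_analysis.
Import Order.TTheory GRing.Theory Num.Theory.
Import numFieldNormedType.Exports.

Set Implicit Arguments.
Unset Strict Implicit.
Unset Printing Implicit Defensive.

Local Open Scope classical_set_scope.
Local Open Scope ring_scope.

Definition prob_vector (R : realType) (k : nat) (v : 'rV[R]_k) : Prop :=
  (forall j, 0 <= v 0 j) /\ \sum_j v 0 j = 1.

Definition stochastic (R : realType) (k : nat) (A : 'M[R]_k) : Prop :=
  forall i, prob_vector (row i A).

(* Irreducibility in the sense of Markov chains: every state is reachable from
   every state.  The exponent may be 0, which for k >= 2 makes no difference. *)
Definition irreducible_mx (R : realType) (k : nat) (A : 'M[R]_k) : Prop :=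
  forall i j : 'I_k, exists n : nat, 0 < (A ^+ n) i j.

(* [g] is a version of the conditional probability P(B | G), where [G] is a
   sub-sigma-algebra of the measurable sets of [T]. *)
Definition is_cond_prob (d : measure_display) (T : measurableType d)
    (R : realType) (P : probability T R) (G : set (set T)) (B : set T)
    (g : T -> R) : Prop :=
  [/\ forall Y : set R, measurable Y -> G (g @^-1` Y),
      P.-integrable setT (EFin \o g) &
      forall A : set T, G A -> (\int[P]_(w in A) (g w)%:E = P (A `&` B))%E].

Definition borel_rV (R : realType) (k : nat) :=
  g_sigma_algebraType (@open 'rV[R]_k).

(* sigma(X 0, ..., X n) *)
Definition natural_filtration (R : realType) (k : nat) (T : Type)
    (X : nat -> T -> 'rV[R]_k) (n : nat) : set (set T) :=
  <<s \bigcup_(m in [set m | (m <= n)%N])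
        preimage_set_system setT (X m) (<<s @open 'rV[R]_k >>) >>.

(* The univariate normal law with mean [m] and variance [v] >= 0.  The case
   v = 0 is treated apart because [normal_prob m 0] is not the point mass. *)
Definition normal_law (R : realType) (m v : R) (A : set R) : \bar R :=
  if v == 0 then \d_m A else normal_prob m (Num.sqrt v) A.

Definition is_covariance_mx (R : realType) (k : nat) (Sigma : 'M[R]_k) : Prop :=
  Sigma^T = Sigma /\ forall u : 'cV[R]_k, 0 <= (u^T *m Sigma *m u) 0 0.

(* [nu] is the k-variate normal law with mean [m] and covariance [Sigma]: every
   linear functional <., u> is normal, with mean <m, u> and variance
   u^T Sigma u. *)
Definition is_mvnormal (R : realType) (k : nat)
    (nu : probability (borel_rV R k) R) (m : 'rV[R]_k) (Sigma : 'M[R]_k)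
    : Prop :=
  is_covariance_mx Sigma /\
  forall (u : 'cV[R]_k) (A : set R), measurable A ->
    nu [set x : 'rV[R]_k | A ((x *m u) 0 0)] =
    normal_law ((m *m u) 0 0) ((u^T *m Sigma *m u) 0 0) A.

Definition cvg_in_law (d : measure_display) (T : measurableType d)
    (R : realType) (P : probability T R) (k : nat)
    (X : nat -> T -> 'rV[R]_k) (nu : probability (borel_rV R k) R) : Prop :=
  forall f : 'rV[R]_k -> R, continuous f -> bounded_fun f ->
    ((\int[P]_w (f (X n w))%:E)%E @[n --> \oo] -->
      (\int[nu]_x (f x)%:E)%E).

Definition Rhat (R : realType) (k : nat) (theta : R) (Rep : 'M[R]_k)
    : 'M[R]_k :=
  (k%:R * theta - 1)^-1 *: (const_mx theta - Rep).

(* [U n] is the configuration after n draws, [Z n] the colour chosen at draw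
   n + 1. *)
Record negative_urn (d : measure_display) (T : measurableType d)
    (R : realType) (P : probability T R) (k : nat) (theta : R)
    (Rep : 'M[R]_k) (U0 : 'rV[R]_k)
    (U : nat -> T -> 'rV[R]_k) (Z : nat -> T -> 'I_k) : Prop := NegativeUrn {
  urn_init : forall w, U 0%N w = U0 ;
  urn_measurable_draw : forall n j, measurable (Z n @^-1` [set j]) ;
  urn_draw : forall n j,
    is_cond_prob P (natural_filtration U n) (Z n @^-1` [set j])
      (fun w => (k%:R * theta - 1)^-1 * (theta - U n w 0 j / n.+1%:R)) ;
  urn_step : forall n w,
    U n.+1 w = U n w + (\row_j (Z n w == j)%:R) *m Rep }.

Definition sigma_many (R : realType) (k : nat) (theta : R) (Rep : 'M[R]_k)
    (n : nat) : R :=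
  if [&& k == 3%N, theta == 1 & eigenvalue Rep (-1)]
  then Num.sqrt (n%:R * ln n%:R) else Num.sqrt n%:R.

Definition sigma_two (R : realType) (theta lambda : R) (n : nat) : R :=
  if lambda == (1 - 2 * theta) / 2
  then Num.sqrt (n%:R * ln n%:R) else Num.sqrt n%:R.

(* Main.v *)
Require Import Defs.
From mathcomp Require Import all_boot all_order all_algebra.
From mathcomp Require Import all_classical all_reals all_analysis.
From mathcomp Require Import measurable_realfun ring lra.
Import Order.TTheory GRing.Theory Num.Theory.
Import numFieldNormedType.Exports.

Set Implicit Arguments.
Unset Strict Implicit.
Unset Printing Implicit Defensive.

Local Open Scope classical_set_scope.
Local Open Scope ring_scope.

(** Write c = k theta - 1 and Y_n = U_n - (n+1) mu, a row whose coordinates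
    sum to zero. The equation defining mu makes the probability of drawing j
    equal to stat_j - Y_(n,j) / (c (n+1)), where stat = (theta 1 - mu) / c, and
    hence
      Y_(n+1) = Y_n (1 + A / (n+1)) + noise,
    where A is any matrix that acts as - Rep / c on rows of sum zero, and the
    noise is centred given the past, bounded, and of conditional covariance
    close to a constant matrix G. The fluctuations are thus decided by the
    growth of the products of the matrices 1 + A / m, which [growth_norm A a N]
    bounds by factors 1 + a / m in some norm N on column vectors.

    If a < 1/2 the variances grow like n, and the limit covariance X solves the
    Lyapunov equation X - A^T X - X A = G ([noncritical_covariance]). If
    a = 1/2 and A is equal to 1/2 on the range of a projection P and grows more
    slowly on the complement, they grow like n log n and the limit covariance
    is P^T G P ([critical_covariance]). The value of a depends on c. For c > 2
    the sup norm gives a = 1/c < 1/2. For c = 2, that is k = 3 and theta = 1,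
    A is one half of the contraction - Rep; [half_contraction_norm] builds a
    norm for which the growth is 1/2 on the fixed vectors of - Rep and smaller
    elsewhere, so that the critical scale appears only if -1 is an eigenvalue
    of Rep. For k = 2 the rows of sum zero form a line, A is the scalar
    - lambda / c, and the bound on lambda says that it is at most 1/2.

    The normal limit comes from the characteristic function. One step of the
    recursion replaces E cos(<Y_(n+1), v> + b) by
      exp(- v^T G v / 2) E cos(<Y_n, (1 + A / (n+1)) v> + b)
    up to an error that is cubic in v, or quadratic in v with a coefficient
    that tends to zero. Iterating over all v at once ([urn_fourier]) and taking
    v = u / sqrt(s_n) gives [urn_clt_fourier]. The urn takes finitely many
    values, so these computations are done with an explicit positive functional
    [urn_mean], which [urn_law] identifies with the law of U_n.

    To conclude, [weak_convergence] passes from the functions cos(<x, u> + b) to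
    all bounded continuous functions, by tightness and a uniform approximation
    on boxes by trigonometric polynomials with the same global bound
    ([trigpoly_approx]). The limit law is obtained by adding independent normal
    variables along finitely many directions ([gaussian_exists]), and
    [trig_determines] shows that its linear images are normal. *)

(** * Recursions with multiplier (1 + a/n)^2 *)

Section ScalarRecursions.
Variable R : realType.
Implicit Types (a b d M : R) (n : nat).

Lemma near_ln_ge M : \forall n \near \oo, M <= ln (n%:R : R).
Proof.
near=> n.
have hn : expR M <= n%:R by near: n; exact: nbhs_infty_ger.
by rewrite -[M]expRK ler_ln// posrE ?expR_gt0// (lt_le_trans (expR_gt0 M)).
Unshelve. all: by end_near. Qed.

Lemma ln_sub_le (x y : R) : 0 < x -> x <= y -> ln y - ln x <= (y - x) / x.
Proof.
move=> x0 xy.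
have y0 : 0 < y by exact: lt_le_trans xy.
rewrite -ln_div ?posrE//.
have -> : y / x = 1 + (y - x) / x by field; rewrite gt_eqF.
apply: le_ln1Dx; apply: (@lt_le_trans _ _ 0); first lra.
by apply: divr_ge0; [rewrite subr_ge0 | exact: ltW].
Qed.

Lemma le_ln_sub (x y : R) : 0 < x -> x <= y -> (y - x) / y <= ln y - ln x.
Proof.
move=> x0 xy.
have y0 : 0 < y by exact: lt_le_trans xy.
have h : ln (x / y) <= x / y - 1.
  have -> : x / y = 1 + (x / y - 1) by ring.
  apply: le_trans (le_ln1Dx _) _; last by lra.
  have := divr_gt0 x0 y0; lra.
rewrite ln_div ?posrE// in h.
have -> : (y - x) / y = 1 - x / y by field; rewrite gt_eqF.
lra.
Qed.

Lemma near_ln_le d : 0 < d -> \forall n \near \oo, ln (n%:R : R) <= d * n%:R.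
Proof.
move=> d0; near=> n.
have hn : (2 / d) ^+ 2 + 1 <= n%:R by near: n; exact: nbhs_infty_ger.
have n0 : 0 < n%:R :> R by have := sqr_ge0 (2/d); lra.
have s0 : 0 < Num.sqrt (n%:R : R) by rewrite sqrtr_gt0.
have nE : n%:R = Num.sqrt (n%:R : R) * Num.sqrt n%:R.
  by rewrite -expr2 sqr_sqrtr// ltW.
have h : ln (Num.sqrt (n%:R : R)) <= Num.sqrt n%:R.
  have := @ln_sub_le 1 (Num.sqrt n%:R + 1) ltr01 _.
  have : ln (Num.sqrt (n%:R : R)) <= ln (Num.sqrt (n%:R : R) + 1).
    by rewrite ler_ln ?posrE//; lra.
  rewrite ln1 divr1; move=> h1 /(_ _); lra.
have h2 : 2 / d <= Num.sqrt n%:R.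
  rewrite -[leLHS](@ger0_norm _ (2 / d)); last by apply: divr_ge0; lra.
  by rewrite -sqrtr_sqr ler_wsqrtr//; lra.
have h3 : 2 <= d * Num.sqrt n%:R by rewrite mulrC -ler_pdivrMr.
have h4 := ler_wpM2r (ltW s0) h3.
rewrite [in leRHS]nE {1}nE lnM ?posrE// mulrA.
lra.
Unshelve. all: by end_near. Qed.

Lemma onePdivn_ge1 a n : 0 <= a -> 1 <= 1 + a / n.+1%:R.
Proof. by move=> a0; rewrite lerDl divr_ge0. Qed.

(** A bound for products of n drift matrices; of order n^a. *)
Fixpoint rising a n : R :=
  if n is n'.+1 then (1 + a / n'.+1%:R) * rising a n' else 1.

Lemma rising_gt0 a n : 0 <= a -> 0 < rising a n.
Proof.
move=> a0; elim: n => //= n ih; apply: mulr_gt0 => //.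
exact: lt_le_trans ltr01 (onePdivn_ge1 n a0).
Qed.

Lemma rising_ge1 a n : 0 <= a -> 1 <= rising a n.
Proof.
move=> a0; elim: n => //= n ih.
by rewrite -[leLHS]mulr1; apply: ler_pM => //; exact: onePdivn_ge1.
Qed.

Lemma rising_le a n : 0 <= a <= 1 -> rising a n <= n.+1%:R.
Proof.
move=> /andP[a0 a1]; elim: n => //= n ih.
have m0 : 0 < n.+1%:R :> R by [].
apply: (@le_trans _ _ ((1 + a / n.+1%:R) * n.+1%:R)).
  by apply: ler_wpM2l => //; apply: le_trans (onePdivn_ge1 n a0).
rewrite mulrDl mul1r divfK ?gt_eqF// -[n.+2]addn1 natrD; lra.
Qed.

(** A crude way to see that [rising a n] is o(n) when a < 1: both sides satisfy
    comparable recursions, as ln (m+2) - ln (m+1) <= 1/(m+1). *)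
Lemma rising_ln a n : 0 <= a <= 1 ->
  rising a n * ((1 - a) * (ln n.+2%:R - 1)) <= n.+1%:R.
Proof.
move=> /andP[a0 a1]; elim: n => [|n ih].
  rewrite /= mul1r.
  have := @ln_sub_le 1 2 ltr01; rewrite ln1; nra.
rewrite /=.
set m : R := n.+1%:R in ih *.
have m0 : 0 < m by rewrite ltr0n.
have m2E : n.+2%:R = m + 1 by rewrite -[n.+2]addn1 natrD.
have m3E : n.+3%:R = m + 2 by rewrite -[n.+3]addn2 natrD.
rewrite m2E m3E in ih *.
have dl : ln (m + 2) <= ln (m + 1) + (m + 1)^-1.
  have := @ln_sub_le (m + 1) (m + 2).
  have -> : (m + 2 - (m + 1)) / (m + 1) = (m + 1)^-1 by field; lra.
  move=> /(_ _ _); lra.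
have f0 : 0 <= 1 + a / m by apply: le_trans (onePdivn_ge1 n a0).
have h1 : (1 + a / m) * (rising a n * ((1 - a) * (ln (m + 1) - 1))) <= m + a.
  by apply: le_trans (ler_wpM2l f0 ih) _; rewrite mulrDl mul1r divfK ?gt_eqF.
have h2 : (1 + a / m) * rising a n / (m + 1) <= 1.
  rewrite ler_pdivrMr ?mul1r; last lra.
  have := @rising_le a n.+1; rewrite a0 a1 m2E => /(_ isT); exact.
have r0 : 0 <= (1 + a / m) * rising a n by rewrite mulr_ge0// ltW// rising_gt0.
have h3 : (1 + a / m) * rising a n * ((1 - a) * (ln (m + 2) - 1)) <=
   (1 + a / m) * rising a n * ((1 - a) * (ln (m + 1) + (m + 1)^-1 - 1)).
  by apply: ler_wpM2l => //; apply: ler_wpM2l; lra.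
apply: le_trans h3 _.
have a1' : 0 <= 1 - a by lra.
have h4 := ler_wpM2l a1' h2; rewrite mulr1 in h4.
have -> : (1 + a / m) * rising a n * ((1 - a) * (ln (m + 1) + (m + 1)^-1 - 1)) =
  (1 + a / m) * (rising a n * ((1 - a) * (ln (m + 1) - 1))) +
  (1 - a) * ((1 + a / m) * rising a n / (m + 1)) by field; lra.
apply: le_trans (lerD h1 h4) _; lra.
Qed.

Lemma rising_small a d : 0 <= a < 1 -> 0 < d ->
  \forall n \near \oo, rising a n <= d * n%:R.
Proof.
move=> /andP[a0 a1] d0; near=> n.
have n1 : 1 <= n%:R :> R by near: n; exact: nbhs_infty_ger.
have hl : 1 + 2 / (d * (1 - a)) <= ln (n%:R : R) by near: n; exact: near_ln_ge.
have := @rising_ln a n; rewrite a0 ltW//= => /(_ isT).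
have hl2 : ln (n%:R : R) <= ln (n.+2%:R).
  by rewrite ler_ln ?posrE ?ler_nat ?ltr0n//; [rewrite -addn2 leq_addr| rewrite -(ltr0n R); lra].
have k0 : 0 < d * (1 - a) by apply: mulr_gt0; lra.
have h : 2 / d <= (1 - a) * (ln (n.+2%:R : R) - 1).
  have k1 : 0 < 1 - a by lra.
  have -> : 2 / d = (1 - a) * (2 / (d * (1 - a))) by field; rewrite !gt_eqF.
  by apply: ler_wpM2l; lra.
have -> : n.+1%:R = n%:R + 1 :> R by rewrite -[n.+1]addn1 natrD.
have p0 := rising_gt0 n a0.
have := ler_wpM2l (ltW p0) h.
move=> h3 h4.
have h5 : rising a n * (2 / d) <= 2 * n%:R by lra.
rewrite mulrA ler_pdivrMr// in h5; lra.
Unshelve. all: by end_near. Qed.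

(** The same K serves for every noise level eta: this linear dependence is what
    makes a noise that tends to zero negligible at scale s
    ([scale_noise_cvg0]). *)
Definition slow_noise_scale a (s : nat -> R) := exists2 K, 0 <= K &
  forall (x : nat -> R) (eta : R), 0 <= eta -> (forall n, 0 <= x n) ->
  (\forall n \near \oo, x n.+1 <= (1 + a / n.+1%:R) ^+ 2 * x n + eta) ->
  forall d, 0 < d -> \forall n \near \oo, x n <= (K * eta + d) * s n.

(** The scales s at which a second moment subject to the multiplier
    (1 + a/n)^2 and to a bounded noise stays bounded. The bound s = o(n^2) gives
    the law of large numbers. *)
Record clt_scale a (s : nat -> R) : Prop := CltScale {
  scale_noise : slow_noise_scale a s ;
  scale_lt_sqr : forall d, 0 < d -> \forall n \near \oo, s n <= d * n%:R ^+ 2 ;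
  scale_ge : \forall n \near \oo, n%:R <= s n }.

(** Eventually (1 + a/n)^2 <= 1 + b/n with b = a + 1/2 < 1. The recursion with
    multiplier 1 + b/n has the linear supersolution eta n / (1 - b), and exceeds
    it by at most a multiple of [rising b n], which is o(n). *)
Lemma clt_scale_linear a : 0 <= a < 2^-1 -> clt_scale a (fun n => n%:R).
Proof.
move=> /andP[a0 a1].
have two0 : (2^-1 : R) = 1 / 2 by rewrite div1r.
rewrite two0 in a1.
split.
- pose b := a + 1 / 2; exists (1 - b)^-1; first by rewrite invr_ge0 /b; lra.
  move=> x eta eta0 x0 hx d d0.
  have b0 : 0 <= b by rewrite /b; lra.
  have b1 : b < 1 by rewrite /b; lra.
  have hx' : \forall n \near \oo, x n.+1 <= (1 + b / n.+1%:R) * x n + eta.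
    near=> n.
    have h1 : x n.+1 <= (1 + a / n.+1%:R) ^+ 2 * x n + eta by near: n.
    apply: le_trans h1 _; rewrite lerD2r ler_wpM2r//.
    have hn : (1 / 2 - a)^-1 <= n%:R by near: n; exact: nbhs_infty_ger.
    have m0 : 0 < n.+1%:R :> R by [].
    have hm : (1 / 2 - a)^-1 <= n.+1%:R by apply: le_trans hn _; rewrite ler_nat.
    have e0 : 0 < 1 / 2 - a by lra.
    have hm2 : n.+1%:R^-1 <= 1 / 2 - a :> R.
      by rewrite -[leRHS]invrK lef_pV2 ?posrE ?invr_gt0.
    rewrite /b; set i := n.+1%:R^-1 in hm2 *.
    have i0 : 0 < i by rewrite invr_gt0.
    have h : a + a ^+ 2 * i <= 1 / 2 .
      have a2 : a ^+ 2 <= 1 by rewrite expr_le1//; lra.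
      have := ler_wpM2r (ltW i0) a2; lra.
    have := ler_wpM2r (ltW i0) h; lra.
  case: hx' => n0 _ hn0.
  pose K := (1 - b)^-1; pose Z := `|x n0|.
  have Kb : K * (1 - b) = 1 by rewrite mulVf//; lra.
  have K0 : 0 < K by rewrite invr_gt0; lra.
  have main : forall n, x (n0 + n)%N - K * eta * (n0 + n)%:R <= Z * rising b (n0 + n)%N.
    elim=> [|n ih].
      rewrite addn0 /Z; have := ler_norm (x n0).
      have h1 := @rising_ge1 b n0 b0.
      have h2 : 0 <= K * eta * n0%:R by rewrite !mulr_ge0// ltW.
      have := normr_ge0 (x n0); nra.
    rewrite addnS /=.
    have /= h := hn0 (n0 + n)%N (leq_addr _ _).
    set N := (n0 + n)%N in h ih *.
    have NE : N.+1%:R = N%:R + 1 :> R by rewrite -[N.+1]addn1 natrD.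
    set i := b / N.+1%:R in h *.
    have i0 : 0 <= i by rewrite divr_ge0.
    have iN : i * (N%:R + 1) = b by rewrite /i NE divfK// -NE pnatr_eq0.
    rewrite NE.
    have h2 : (1 + i) * (x N - K * eta * N%:R) <= (1 + i) * (Z * rising b N).
      by apply: ler_wpM2l => //; lra.
    have h3 : i * N%:R <= b by nra.
    have ke : 0 <= K * eta by rewrite mulr_ge0// ltW.
    have h4 : K * eta * (i * N%:R) <= K * eta * b by apply: ler_wpM2l.
    have h5 : eta = K * eta * (1 - b) by rewrite mulrAC Kb mul1r.
    nra.
  near=> n.
  have hn : (n0 <= n)%N by near: n; exact: nbhs_infty_ge.
  have := main (n - n0)%N; rewrite subnKC// => h.
  have hr : rising b n <= d / (Z + 1) * n%:R.
    near: n; apply: rising_small; first lra.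
    by apply: divr_gt0 => //; rewrite /Z; have := normr_ge0 (x n0); lra.
  have Z0 : 0 <= Z by rewrite /Z.
  have h2 : Z * rising b n <= d * n%:R.
    apply: le_trans (ler_wpM2l Z0 hr) _.
    rewrite mulrA ler_wpM2r// mulrCA ger_pMr// ler_pdivrMr; lra.
  have -> : ((1 - b)^-1 * eta + d) * n%:R = K * eta * n%:R + d * n%:R.
    by rewrite mulrDl.
  lra.
- move=> d d0; near=> n.
  have hn : d^-1 <= n%:R by near: n; exact: nbhs_infty_ger.
  have : 1 <= d * n%:R by rewrite -ler_pdivrMl// mulr1.
  have := ler0n R n; nra.
- by near=> n.
Unshelve. all: by end_near. Qed.

(** By induction, as (2m - 1) (1 + 1/(2m))^2 = (2m + 1) (1 - 1/(2m)^2). *)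
Lemma rising_half_sqr n : rising (2^-1 : R) n ^+ 2 <= n.*2.+1%:R.
Proof.
elim: n => [|n ih]; first by rewrite /= expr1n.
rewrite /= exprMn.
set m : R := n.+1%:R.
have m1 : 1 <= m by rewrite ler1n.
have E1 : n.*2.+1%:R = 2 * m - 1 :> R.
  by rewrite /m -[n.*2.+1]addn1 -[n.+1]addn1 !natrD -mul2n natrM; ring.
have E2 : n.+1.*2.+1%:R = 2 * m + 1 :> R.
  by rewrite -[n.+1.*2.+1]addn1 natrD -mul2n natrM.
rewrite E1 in ih; rewrite E2.
have : (1 + 2^-1 / m) ^+ 2 * rising 2^-1 n ^+ 2 <= (1 + 2^-1 / m) ^+ 2 * (2 * m - 1).
  by apply: ler_wpM2l => //; exact: sqr_ge0.
move/le_trans; apply.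
have -> : (1 + 2^-1 / m) ^+ 2 * (2 * m - 1) = (2 * m + 1) * (1 - (2 * m) ^- 2).
  by field; lra.
rewrite -[leRHS]mulr1; apply: ler_wpM2l; first lra.
by rewrite lerBlDr lerDl invr_ge0 sqr_ge0.
Qed.

(** The variance accumulated by a unit noise at the critical rate a = 1/2. *)
Fixpoint crit_resp n : R :=
  if n is n'.+1 then (1 + 2^-1 / n'.+1%:R) ^+ 2 * crit_resp n' + 1 else 0.

Lemma crit_resp_ge0 n : 0 <= crit_resp n.
Proof. by elim: n => //= n ih; rewrite addr_ge0// mulr_ge0// sqr_ge0. Qed.

Lemma crit_recursion (x : nat -> R) (eta : R) : 0 <= eta -> (forall n, 0 <= x n) ->
  (\forall n \near \oo, x n.+1 <= (1 + 2^-1 / n.+1%:R) ^+ 2 * x n + eta) ->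
  exists2 Z, 0 <= Z & \forall n \near \oo,
    x n <= Z * n.*2.+1%:R + eta * crit_resp n.
Proof.
move=> eta0 x0 [n0 _ hn0]; exists (x n0) => //.
suff main n : x (n0 + n)%N <=
    x n0 * rising 2^-1 (n0 + n)%N ^+ 2 + eta * crit_resp (n0 + n)%N.
  near=> n.
  have hn : (n0 <= n)%N by near: n; exact: nbhs_infty_ge.
  have := main (n - n0)%N; rewrite subnKC// => /le_trans; apply.
  by rewrite lerD2r ler_wpM2l// rising_half_sqr.
elim: n => [|n ih].
  rewrite addn0; apply: (@le_trans _ _ (x n0 * 1 + 0)); first by rewrite mulr1 addr0.
  apply: lerD; last by rewrite mulr_ge0// crit_resp_ge0.
  by rewrite ler_wpM2l// -[leLHS](expr1n _ 2) lerXn2r// ?nnegrE ?rising_ge1//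
    ltW// rising_gt0.
rewrite addnS /=.
have /= h := hn0 (n0 + n)%N (leq_addr _ _).
apply: le_trans h _.
have := ler_wpM2l (sqr_ge0 (1 + 2^-1 / (n0 + n).+1%:R)) ih.
rewrite exprMn; set f := 1 + _; lra.
Unshelve. all: by end_near. Qed.

(** The sequence n ln n satisfies the recursion of [crit_resp] with an error
    that tends to zero, so the difference of the two solves the same recursion
    with arbitrarily small noise; [crit_recursion] bounds it by a small multiple
    of [crit_resp] itself, which is then absorbed. *)
Lemma crit_resp_equiv d : 0 < d ->
  \forall n \near \oo, `|crit_resp n - n%:R * ln n%:R| <= d * (n%:R * ln n%:R).
Proof.
move=> d0.
pose x n : R := `|crit_resp n - n%:R * ln n%:R|.
pose eta : R := Num.min (1/2) (d / 4).
have eta0 : 0 < eta by rewrite lt_min; apply/andP; split; lra.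
have eta1 : eta <= 1/2 by rewrite ge_min lexx.
have eta2 : eta <= d / 4 by rewrite ge_min lexx orbT.
have [Z Z0 hZ] : exists2 Z, 0 <= Z & \forall n \near \oo,
    x n <= Z * n.*2.+1%:R + eta * crit_resp n.
  apply: crit_recursion; [exact: ltW | by move=> n; exact: normr_ge0 | ].
  near=> n; rewrite /x.
  have n1 : 1 <= n%:R :> R by near: n; exact: nbhs_infty_ger.
  have nb : 2 / eta <= n%:R :> R by near: n; exact: nbhs_infty_ger.
  have nl : ln (n%:R : R) <= eta / 2 * n%:R.
    by near: n; apply: near_ln_le; lra.
  rewrite /=.
  have NE : n.+1%:R = n%:R + 1 :> R by rewrite -[n.+1]addn1 natrD.
  rewrite NE; set N : R := n%:R in n1 nb nl *.
  have e1 : N + 1 - N = 1 by ring.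
  have ub : ln (N + 1) - ln N <= 1 / N.
    rewrite -[X in X / N]e1; apply: ln_sub_le; lra.
  have lb : 1 / (N + 1) <= ln (N + 1) - ln N.
    rewrite -[X in X / _]e1; apply: le_ln_sub; lra.
  have l0 : 0 <= ln N by exact: ln_ge0.
  pose e := (1 + 2^-1 / (N + 1)) ^+ 2 * (N * ln N) + 1 - (N + 1) * ln (N + 1).
  have -> : (1 + 2^-1 / (N + 1)) ^+ 2 * crit_resp n + 1 - (N + 1) * ln (N + 1) =
     (1 + 2^-1 / (N + 1)) ^+ 2 * (crit_resp n - N * ln N) + e.
    by rewrite /e; ring.
  apply: le_trans (ler_normD _ _) _.
  rewrite normrM [X in X * _]ger0_norm ?sqr_ge0// lerD2l.
  have eE : e = 1 - (N + 1) * (ln (N + 1) - ln N)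
      - (1 / (N + 1) - N / (4 * (N + 1) ^+ 2)) * ln N.
    rewrite /e; field; lra.
  have h1 : 1 <= (N + 1) * (ln (N + 1) - ln N).
    by rewrite mulrC -ler_pdivrMr//; lra.
  have h2 : (N + 1) * (ln (N + 1) - ln N) <= 1 + 1 / N.
    have : (N + 1) * (ln (N + 1) - ln N) <= (N + 1) * (1 / N).
      by apply: ler_wpM2l => //; lra.
    by rewrite [(N + 1) * (1 / N)](_ : _ = 1 + 1 / N)//; field; lra.
  have h3 : 1 / N <= eta / 2.
    by rewrite ler_pdivrMr; last lra; rewrite ler_pdivrMr in nb; lra.
  pose q := 1 / (N + 1) - N / (4 * (N + 1) ^+ 2).
  have qE : q = (3 * N + 4) / (4 * (N + 1) ^+ 2) by rewrite /q; field; lra.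
  have q0 : 0 <= q by rewrite qE divr_ge0// ?mulr_ge0// ?sqr_ge0//; lra.
  have q1 : q * N <= 1.
    rewrite qE mulrAC ler_pdivrMr; last by rewrite mulr_gt0// exprn_gt0//; lra.
    nra.
  have h4 : q * ln N <= eta / 2.
    apply: le_trans (ler_wpM2l q0 nl) _.
    rewrite mulrCA ger_pMr//; lra.
  have h5 : 0 <= q * ln N by exact: mulr_ge0.
  rewrite eE -/q ler_norml; apply/andP; split; lra.
near=> n.
have hz : x n <= Z * n.*2.+1%:R + eta * crit_resp n by near: n.
have n1 : 1 <= n%:R :> R by near: n; exact: nbhs_infty_ger.
have nl : 12 * Z / d <= ln (n%:R : R) by near: n; exact: near_ln_ge.
have E1 : n.*2.+1%:R = 2 * n%:R + 1 :> R.
  by rewrite -[n.*2.+1]addn1 natrD -mul2n natrM.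
rewrite E1 in hz; rewrite -/(x n).
have hxE : x n = `|crit_resp n - n%:R * ln n%:R| by [].
move: hz hxE; move: (x n) => xn hz hxE.
set L := n%:R * ln n%:R in hxE *.
have hL : 12 * Z * n%:R <= d * L.
  by rewrite ler_pdivrMr// in nl; rewrite /L; nra.
have t0 := crit_resp_ge0 n.
have hx1 : crit_resp n - L <= xn by rewrite hxE ler_norm.
have c1 : crit_resp n <= 2 * L + 6 * Z * n%:R by nra.
have h2 : eta * crit_resp n <= eta * (2 * L + 6 * Z * n%:R).
  by rewrite ler_wpM2l// ltW.
have L0 : 0 <= L by rewrite /L mulr_ge0// ln_ge0.
have h3 : eta * (2 * L) <= d / 4 * (2 * L) by rewrite ler_wpM2r// mulr_ge0.
have h4 : eta * (6 * Z * n%:R) <= 1 / 2 * (6 * Z * n%:R).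
  by rewrite ler_wpM2r// !mulr_ge0.
nra.
Unshelve. all: by end_near. Qed.

Lemma clt_scale_nlogn : clt_scale 2^-1 (fun n => n%:R * ln n%:R).
Proof.
split.
- exists 2 => // x eta eta0 x0 hx d d0.
  have [Z Z0 hZ] := crit_recursion eta0 x0 hx.
  near=> n.
  have hz : x n <= Z * n.*2.+1%:R + eta * crit_resp n by near: n.
  have n1 : 1 <= n%:R :> R by near: n; exact: nbhs_infty_ger.
  have hc : `|crit_resp n - n%:R * ln n%:R| <= 1 * (n%:R * ln n%:R).
    by near: n; exact: crit_resp_equiv.
  have nl : 3 * Z / d <= ln (n%:R : R) by near: n; exact: near_ln_ge.
  have E1 : n.*2.+1%:R = 2 * n%:R + 1 :> R.
    by rewrite -[n.*2.+1]addn1 natrD -mul2n natrM.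
  rewrite E1 in hz.
  set L := n%:R * ln n%:R in hc *.
  have hL : 3 * Z * n%:R <= d * L.
    by rewrite ler_pdivrMr// in nl; rewrite /L; nra.
  have c1 : crit_resp n <= 2 * L by move: hc; rewrite ler_norml; lra.
  have := ler_wpM2l eta0 c1; nra.
- move=> d d0; near=> n.
  rewrite expr2 mulrCA ler_wpM2l//.
  by near: n; exact: near_ln_le.
- near=> n.
  rewrite -[leLHS]mulr1 ler_wpM2l//.
  by near: n; exact: near_ln_ge.
Unshelve. all: by end_near. Qed.

Lemma scale_noise_cvg0 a (s x eps : nat -> R) : clt_scale a s ->
  (forall n, 0 <= x n) ->
  (forall n, x n.+1 <= (1 + a / n.+1%:R) ^+ 2 * x n + eps n) ->
  (forall d, 0 < d -> \forall n \near \oo, eps n <= d) ->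
  forall d, 0 < d -> \forall n \near \oo, x n <= d * s n.
Proof.
move=> [[K K0 hK] _ s_ge] x0 hx heps d d0.
pose eta := d / 2 / (K + 1).
have eta0 : 0 < eta by rewrite !divr_gt0//; lra.
have hKe : K * eta + d / 2 <= d.
  rewrite /eta mulrCA; suff : K / (K + 1) <= 1 by nra.
  by rewrite ler_pdivrMr; lra.
near=> n.
have h1 : x n <= (K * eta + d / 2) * s n.
  near: n; apply: hK => //; [exact: ltW| |lra].
  near=> n; apply: le_trans (hx n) _; rewrite lerD2l.
  by near: n; exact: heps.
have h2 : n%:R <= s n by near: n.
apply: le_trans h1 _; rewrite ler_wpM2r//.
by apply: le_trans h2.
Unshelve. all: by end_near. Qed.
End ScalarRecursions.

(** * Norms that measure the growth of products of matrices 1 + A/n *)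

Section SupNorm.
Variables (R : realType) (k : nat).
Implicit Types (v w : 'cV[R]_k) (A : 'M[R]_k).

Lemma le_entry_norm v i : `|v i 0| <= `|v|.
Proof.
rewrite [leRHS]/Num.norm /= mx_normrE.
exact: (le_bigmax _ (fun ij : 'I_k * 'I_1 => `|v ij.1 ij.2|) (i, 0)).
Qed.

Lemma norm_le_entries v (M : R) : 0 <= M -> (forall i, `|v i 0| <= M) -> `|v| <= M.
Proof.
move=> M0 h; rewrite [leLHS]/Num.norm /= mx_normrE.
by apply: bigmax_le => // -[i j] _ /=; rewrite ord1.
Qed.

Lemma stochastic_ge0 A i j : stochastic A -> 0 <= A i j.
Proof. by move=> /(_ i)[h _]; have := h j; rewrite mxE. Qed.

Lemma stochastic_row_sum A i : stochastic A -> \sum_j A i j = 1.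
Proof. by move=> /(_ i)[_ <-]; apply: eq_bigr => j _; rewrite mxE. Qed.

Lemma stochastic_norm_le A v : stochastic A -> `|A *m v| <= `|v|.
Proof.
move=> hA; apply: norm_le_entries => // i; rewrite mxE.
apply: le_trans (ler_norm_sum _ _ _) _.
rewrite -[leRHS]mul1r -(stochastic_row_sum i hA) mulr_suml.
apply: ler_sum => j _; rewrite normrM ger0_norm ?stochastic_ge0//.
by rewrite ler_wpM2l ?stochastic_ge0// le_entry_norm.
Qed.

Lemma mulmx_norm_bound A : exists2 K : R, 0 <= K & forall v, `|A *m v| <= K * `|v|.
Proof.
exists (\sum_i \sum_j `|A i j|); first by do 2 apply: sumr_ge0 => ? _.
move=> v; apply: norm_le_entries.
  by rewrite mulr_ge0//; do 2 apply: sumr_ge0 => ? _.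
move=> i; rewrite mxE; apply: le_trans (ler_norm_sum _ _ _) _.
rewrite [X in _ <= X * _](bigD1 i)//= mulrDl mulr_suml.
rewrite -[leLHS]addr0; apply: lerD.
  by apply: ler_sum => j _; rewrite normrM ler_wpM2l// le_entry_norm.
by rewrite mulr_ge0//; do 2 apply: sumr_ge0 => ? _.
Qed.

(** The bound is only asked for steps h in [0, 1], since h stands for 1/m. *)
Definition growth_norm A (a : R) (N : 'cV[R]_k -> R) : Prop :=
  [/\ forall v, `|v| <= N v,
      forall t v, N (t *: v) = `|t| * N v &
      forall (h : R) v, 0 <= h <= 1 -> N (v + h *: (A *m v)) <= (1 + a * h) * N v].

Lemma growth_norm_stochastic A (c : R) : stochastic A -> 0 < c ->
  growth_norm (- c^-1 *: A) c^-1 (fun v => `|v|).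
Proof.
move=> hA c0; split=> //; first by move=> t v; rewrite normrZ.
move=> h v /andP[h0 h1].
apply: le_trans (ler_normD _ _) _; rewrite mulrDl mul1r lerD2l.
have ci0 : 0 <= c^-1 by rewrite invr_ge0 ltW.
rewrite -scalemxAl !normrZ normrN [X in X * _]ger0_norm// (ger0_norm ci0).
rewrite mulrCA mulrA; apply: ler_wpM2l; first exact: mulr_ge0.
exact: stochastic_norm_le.
Qed.

Lemma growth_norm_scalar (al : R) : -1 <= al ->
  growth_norm (al *: 1%:M : 'M[R]_k) (Num.max al 0) (fun v => `|v|).
Proof.
move=> al1; split=> //; first by move=> t v; rewrite normrZ.
move=> h v /andP[h0 h1].
rewrite -scalemxAl mul1mx scalerA -{1}[v]scale1r -scalerDl normrZ.
rewrite ler_wpM2r// ger0_norm; last by nra.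
by rewrite lerD2l mulrC ler_wpM2r// le_max lexx.
Qed.

End SupNorm.

(** * A norm adapted to one half of a contraction *)

Section Contraction.
Variables (R : realType) (k : nat) (T : 'M[R]_k).
Hypothesis T_contr : forall v : 'cV[R]_k, `|T *m v| <= `|v|.
Implicit Types v w : 'cV[R]_k.

Let Tn j v := iter j (mulmx T) v.
Let S n v := \sum_(j < n) Tn j v.

Let Tn_le j v : `|Tn j v| <= `|v|.
Proof. by elim: j => //= j ih; apply: le_trans (T_contr _) ih. Qed.

Let TnB j v w : Tn j (v - w) = Tn j v - Tn j w.
Proof. by elim: j => //= j ->; rewrite mulmxBr. Qed.

Let TnS j v : Tn j (T *m v) = Tn j.+1 v.
Proof. by rewrite /Tn -iterSr. Qed.

Let S_le n v : `|S n v| <= n%:R * `|v|.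
Proof.
apply: le_trans (ler_norm_sum _ _ _) _.
apply: (@le_trans _ _ (\sum_(j < n) `|v|)); first by apply: ler_sum.
by rewrite sumr_const card_ord mulr_natl.
Qed.

Let S_tele n v : S n (v - T *m v) = v - Tn n v.
Proof.
elim: n => [|n ih]; first by rewrite /S big_ord0 subrr.
rewrite /S big_ord_recr/= -/(S n _) ih TnB TnS /=.
by rewrite addrA subrK.
Qed.

Let S_recl n v : S n.+1 v = v + T *m S n v.
Proof. by rewrite /S big_ord_recl/= mulmx_sumr. Qed.

(** The vector w = (1 - T) v is fixed by T, so summing T^j w over j < n gives
    n w = v - T^n v, which stays bounded: hence w = 0. *)
Lemma contr_sqr_ker v : (1%:M - T) *m ((1%:M - T) *m v) = 0 -> (1%:M - T) *m v = 0.
Proof.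
set w := (1%:M - T) *m v => hw.
have Tw : T *m w = w.
  by move: hw; rewrite mulmxBl mul1mx => /eqP; rewrite subr_eq0 => /eqP <-.
have Tnw j : Tn j w = w by elim: j => //= j ->.
have bound n : n%:R * `|w| <= 2 * `|v|.
  have -> : n%:R * `|w| = `|S n w|.
    rewrite /S (eq_bigr (fun=> w)) ?sumr_const ?card_ord// normrMn mulr_natl//.
  rewrite {1}/w mulmxBl mul1mx S_tele.
  apply: le_trans (ler_normB _ _) _.
  have := Tn_le n v; lra.
apply/eqP; rewrite -normr_le0 leNgt; apply/negP => w0.
have [n hn] : exists n, (2 * `|v| + 1) / `|w| <= n%:R :> R.
  exact: filter_ex (nbhs_infty_ger _).
rewrite ler_pdivrMr// in hn; have := bound n; lra.
Qed.

Let E := 1%:M - T.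

(** By [contr_sqr_ker] the kernel of E = 1 - T meets its range trivially, so E
    and E E have the same rank and E factors through E E on both sides. Then Q
    is the projection on the range of E along the fixed vectors of T. *)
Lemma contr_group_inverse : exists X : 'M[R]_k, exists Q : 'M[R]_k,
  [/\ Q = E *m X, Q *m E = E, E *m Q = E & Q *m T = T *m Q].
Proof.
have ker_cap : (E^T :&: kermx E^T)%MS = 0.
  apply/eqP; rewrite -submx0; apply/rV_subP => u; rewrite sub_capmx.
  move=> /andP[/submxP[w wE] /sub_kermxP uE].
  suff -> : u = 0 by rewrite sub0mx.
  have := @contr_sqr_ker w^T; rewrite -/E => h.
  apply: trmx_inj; rewrite trmx0 wE trmx_mul trmxK; apply: h.
  by have := congr1 trmx uE; rewrite wE !trmx_mul trmxK trmx0.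
have rkT : \rank (E^T *m E^T) = \rank E^T.
  by have := mxrank_mul_ker E^T E^T; rewrite ker_cap mxrank0 addn0.
have rk : \rank (E *m E) = \rank E.
  by rewrite -(mxrank_tr (E *m E)) trmx_mul rkT mxrank_tr.
have /submxP[Y hY] : (E <= E *m E)%MS.
  by rewrite -(geq_leqif (mxrank_leqif_sup (submxMl E E))) rk.
have /submxP[X' hX'] : (E^T <= E^T *m E^T)%MS.
  by rewrite -(geq_leqif (mxrank_leqif_sup (submxMl E^T E^T))) rkT.
pose X := X'^T.
have hX : E = E *m E *m X.
  by apply: trmx_inj; rewrite !trmx_mul trmxK.
have YE : Y *m E = E *m X by rewrite {1}hX !mulmxA -[Y *m E *m E]mulmxA -hY.
have QE : E *m X *m E = E by rewrite -YE -mulmxA -hY.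
have EQ : E *m (E *m X) = E by rewrite mulmxA -hX.
exists X, (E *m X); split => //.
have -> : T = 1%:M - E by rewrite /E opprB addrC subrK.
by rewrite [LHS]mulmxBr [RHS]mulmxBl mul1mx mulmx1 QE EQ.
Qed.

Let L v := v + T *m v.

(* (1 + T)^m is a sum of 2^m powers of T, in which each T^j with j <= m occurs
   at least once; these m + 1 occurrences are set apart. *)
Let lazy_S m v : `|iter m L v - S m.+1 v| <= (2 ^+ m - m.+1%:R) * `|v|.
Proof.
elim: m => [|m ih].
  by rewrite /S big_ord1 /= expr0 !subrr normr0 mul0r.
have -> : iter m.+1 L v - S m.+2 v = L (iter m L v - S m.+1 v) + T *m S m v.
  rewrite iterS (S_recl m.+1) /L (mulmxBr T).
  move: (T *m S m.+1 v) => c; rewrite (S_recl m).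
  move: (T *m S m v) (iter m _ v) => a I.
  by rewrite (addrAC (I - _)) !opprD (addrA I) subrK addrACA.
apply: le_trans (ler_normD _ _) _.
have h1 : `|T *m S m v| <= m%:R * `|v| by apply: le_trans (T_contr _) (S_le _ _).
have h2 : `|L (iter m L v - S m.+1 v)| <= 2 * ((2 ^+ m - m.+1%:R) * `|v|).
  apply: le_trans (ler_normD _ _) _.
  have := T_contr (iter m L v - S m.+1 v); lra.
apply: le_trans (lerD h2 h1) _.
rewrite exprS -[m.+2]addn2 -[m.+1]addn1 !natrD; lra.
Qed.

Let M v := 2^-1 *: (v + T *m v).

Let MnE m v : iter m M v = 2 ^- m *: iter m L v.
Proof.
elim: m v => [|m ih] v; first by rewrite /= expr0 invr1 scale1r.
rewrite /= ih /M /L -scalemxAr -scalerDr scalerA.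
by rewrite -[m.+1]addn1 exprD expr1 invfM mulrC.
Qed.

(** On the range of E the sum of T^j v over j <= m telescopes and stays bounded,
    far below its trivial bound (m+1) |v|. The m-th iterate of M = (1 + T)/2
    contains this sum with weight 2^-m ([lazy_S]), and is therefore a strict
    contraction there. *)
Lemma lazy_contraction (X : 'M[R]_k) : exists m : nat,
  exists2 kappa : R, 0 < kappa <= 1 &
  (0 < m)%N /\
  forall v, E *m (X *m v) = v -> `|iter m M v| <= (1 - kappa) * `|v|.
Proof.
have [K K0 hK] := mulmx_norm_bound X.
have [m hm] : exists m, 4 * K + 1 <= m%:R :> R.
  exact: filter_ex (nbhs_infty_ger _).
have m0 : (0 < m)%N by rewrite -(ltr0n R); lra.
have mE : m.+1%:R = m%:R + 1 :> R by rewrite -[m.+1]addn1 natrD.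
have p0 : 0 < 2 ^+ m :> R by rewrite exprn_gt0.
exists m; exists (m.+1%:R / 2 ^+ m.+1).
  rewrite divr_gt0 ?exprn_gt0//= ler_pdivrMr ?exprn_gt0// mul1r.
  by rewrite -natrX ler_nat ltnW// ltn_expl.
split=> // v hv.
have hS : `|S m.+1 v| <= m.+1%:R / 2 * `|v|.
  rewrite -{1}hv mulmxBl mul1mx S_tele; apply: le_trans (ler_normB _ _) _.
  have h1 := Tn_le m.+1 (X *m v); have h2 := hK v; rewrite mE.
  have := normr_ge0 v; nra.
have hL : `|iter m L v| <= (2 ^+ m - m.+1%:R / 2) * `|v|.
  rewrite -[iter m L v](subrK (S m.+1 v)).
  apply: le_trans (ler_normD _ _) _.
  have := lazy_S m v; move: hS; set n : R := m.+1%:R; lra.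
rewrite MnE normrZ ger0_norm ?invr_ge0 ?(ltW p0)// ler_pdivrMl//.
apply: le_trans hL _; rewrite mulrA ler_wpM2r// mulrBr mulr1 exprS.
by rewrite le_eqVlt; apply/orP; left; apply/eqP; field; rewrite gt_eqF.
Qed.

(* The weights increase slowly along the orbit, so that a strict contraction of
   the m-th iterate of M becomes a strict contraction of M itself. *)
Let wnorm m (eta : R) v := \sum_(j < m) (1 + j%:R * eta) * `|iter j M v|.

Let MD v w : M (v + w) = M v + M w.
Proof. by rewrite /M mulmxDr -scalerDr addrACA. Qed.

Let MZ t v : M (t *: v) = t *: M v.
Proof. by rewrite /M -scalemxAr -scalerDr !scalerA mulrC. Qed.

Let wnormD m eta v w : 0 <= eta -> wnorm m eta (v + w) <= wnorm m eta v + wnorm m eta w.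
Proof.
move=> eta0; rewrite /wnorm -big_split/=; apply: ler_sum => j _.
have -> : iter j M (v + w) = iter j M v + iter j M w.
  by elim: (nat_of_ord j) => //= i ->; exact: MD.
by rewrite -mulrDr; apply: ler_wpM2l (ler_normD _ _); rewrite addr_ge0// mulr_ge0.
Qed.

Let wnormZ m eta t v : wnorm m eta (t *: v) = `|t| * wnorm m eta v.
Proof.
rewrite /wnorm mulr_sumr; apply: eq_bigr => j _.
have -> : iter j M (t *: v) = t *: iter j M v.
  by elim: (nat_of_ord j) => //= i ->; exact: MZ.
by rewrite normrZ mulrCA.
Qed.

Let le_wnorm m eta v : (0 < m)%N -> 0 <= eta -> `|v| <= wnorm m eta v.
Proof.
case: m => // m _ eta0; rewrite /wnorm big_ord_recl/= mul0r addr0 mul1r.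
by rewrite lerDl; apply: sumr_ge0 => j _; rewrite !mulr_ge0// addr_ge0// mulr_ge0.
Qed.

Let wnorm_shift (eta : R) (x : nat -> R) m :
  \sum_(j < m) (1 + j%:R * eta) * x j.+1 =
  \sum_(j < m) (1 + j%:R * eta) * x j - eta * (\sum_(j < m) x j)
  + (1 + m%:R * eta - eta) * x m - (1 - eta) * x 0%N.
Proof.
elim: m => [|m ih]; first by rewrite !big_ord0; ring.
rewrite !big_ord_recr/= ih.
have -> : m.+1%:R = m%:R + 1 :> R by rewrite -[m.+1]addn1 natrD.
ring.
Qed.

Let wnorm_contract m kappa eta v : 0 < kappa <= 1 -> eta = kappa / m.+1%:R ->
  `|iter m M v| <= (1 - kappa) * `|v| ->
  wnorm m eta (M v) <= (1 - eta / 2) * wnorm m eta v.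
Proof.
move=> /andP[k0 k1] etaE hv.
have m1 : 0 < m.+1%:R :> R by [].
have eta0 : 0 < eta by rewrite etaE; exact: divr_gt0.
have eta1 : eta * m.+1%:R = kappa by rewrite etaE divfK ?gt_eqF.
have mE : m.+1%:R = m%:R + 1 :> R by rewrite -[m.+1]addn1 natrD.
have m0 : 0 <= m%:R :> R by [].
rewrite mE in eta1.
have -> : wnorm m eta (M v) = \sum_(j < m) (1 + j%:R * eta) * `|iter j.+1 M v|.
  by apply: eq_bigr => j _; rewrite -iterSr.
rewrite (wnorm_shift eta (fun j => `|iter j M v|) m) -/(wnorm m eta v) /=.
set s := \sum_(j < m) `|iter j M v|.
have hs : wnorm m eta v <= 2 * s.
  rewrite /s mulr_sumr; apply: ler_sum => j _; apply: ler_wpM2r => //.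
  have : j%:R <= m%:R :> R by rewrite ler_nat ltnW.
  nra.
have hm : (1 + m%:R * eta - eta) * `|iter m M v| <= (1 - eta) * `|v|.
  have c0 : 0 <= 1 + m%:R * eta - eta by nra.
  apply: le_trans (ler_wpM2l c0 hv) _; rewrite mulrA ler_wpM2r//.
  nra.
nra.
Qed.

(** Since 1 + h T/2 = (1 - h/2) + h M, a factor 1 - eta/2 for M on the range of Q
    gives there the growth rate a = 1/2 - eta/2 < 1/2, while T/2 is multiplication
    by 1/2 on the fixed vectors of T, the range of 1 - Q. *)
Lemma half_contraction_norm : exists (Q : 'M[R]_k) (N : 'cV[R]_k -> R) (a : R),
  [/\ 0 <= a < 2^-1,
      growth_norm (2^-1 *: T) 2^-1 N,
      Q *m T = T *m Q /\ T *m (1%:M - Q) = 1%:M - Q,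
      forall (h : R) v, 0 <= h <= 1 ->
        N (Q *m v + h *: (2^-1 *: T *m (Q *m v))) <= (1 + a * h) * N (Q *m v) &
      (1%:M - T) \in unitmx -> Q = 1%:M].
Proof.
have [X [Q [QX QE EQ QT]]] := contr_group_inverse.
have [m [kappa k01 [m0 hm]]] := lazy_contraction X.
have m1 : 0 < m.+1%:R :> R by [].
pose eta : R := kappa / m.+1%:R.
have eta0 : 0 < eta by apply: divr_gt0 => //; case/andP: k01.
have eta1 : eta <= 1.
  by rewrite ler_pdivrMr// mul1r; case/andP: k01 => _ /le_trans; apply; rewrite ler1n.
pose P : 'M[R]_k := 1%:M - Q.
have QQ : Q *m Q = Q by rewrite {2}QX mulmxA QE -QX.
have TP : T *m P = P.
  apply/eqP; rewrite eq_sym -subr_eq0 -{1}[P]mul1mx -mulmxBl -/E.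
  by rewrite /P mulmxBr mulmx1 EQ subrr.
have PT : P *m T = P.
  rewrite -[in RHS]TP /P mulmxBl mulmxBr mul1mx mulmx1 QT; exact: erefl.
have PQ : P *m Q = 0 by rewrite mulmxBl mul1mx QQ subrr.
pose N v := `|P *m v| + wnorm m eta (Q *m v).
pose a : R := 2^-1 - eta / 2.
have half : (2^-1 : R) = 1 / 2 by rewrite div1r.
have growQ (h : R) v : 0 <= h <= 1 -> Q *m v = v ->
   wnorm m eta (v + h *: (2^-1 *: T *m v)) <= (1 + a * h) * wnorm m eta v.
  move=> /andP[h0 h1] Qv.
  have -> : v + h *: (2^-1 *: T *m v) = (1 - h / 2) *: v + h *: M v.
    rewrite /M scalerBl scale1r -scalemxAl !scalerDr !scalerA.
    by rewrite addrA subrK.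
  apply: le_trans (wnormD _ _ _ (ltW eta0)) _.
  rewrite (wnormZ m eta h (M v)) (wnormZ m eta (1 - h / 2) v).
  rewrite (ger0_norm h0) (@ger0_norm _ (1 - h/2)); last lra.
  have hc := @wnorm_contract m kappa eta v k01 erefl.
  have {hc} : wnorm m eta (M v) <= (1 - eta / 2) * wnorm m eta v.
    by apply: hc; apply: hm; rewrite mulmxA -QX.
  move/(ler_wpM2l h0); rewrite /a half; lra.
exists Q, N, a; split.
- by rewrite /a half; apply/andP; split; lra.
- split.
  + move=> v; rewrite -{1}[v]mul1mx -(subrK Q 1%:M) mulmxDl.
    apply: le_trans (ler_normD _ _) _; rewrite lerD2l.
    by apply: le_wnorm => //; exact: ltW.
  + by move=> t v; rewrite /N -!scalemxAr normrZ wnormZ mulrDr.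
  + move=> h v h01; have /andP[h0 h1] := h01.
    rewrite /N !mulmxDr -!scalemxAr -!scalemxAl -!scalemxAr !mulmxA PT QT.
    rewrite mulrDr; apply: lerD.
      rewrite -{1}[P *m v]scale1r scalerA -scalerDl normrZ.
      rewrite ger0_norm ?(mulrC h)//; rewrite half; nra.
    have := growQ h (Q *m v) h01; rewrite mulmxA QQ -scalemxAl mulmxA => /(_ erefl).
    move/le_trans; apply; rewrite ler_wpM2r//.
      by apply: le_trans (le_wnorm _ m0 (ltW eta0)).
    by rewrite /a half; nra.
- by [].
- move=> h v h01; rewrite /N.
  have -> : P *m (Q *m v + h *: (2^-1 *: T *m (Q *m v))) = 0.
    rewrite mulmxDr -!scalemxAl -!scalemxAr !mulmxA PT PQ.
    by rewrite mul0mx !scaler0 addr0.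
  rewrite mulmxA PQ mul0mx normr0 !add0r.
  have -> : Q *m (Q *m v + h *: (2^-1 *: T *m (Q *m v))) =
      Q *m v + h *: (2^-1 *: T *m (Q *m v)).
    rewrite mulmxDr -!scalemxAl -!scalemxAr !mulmxA QQ QT.
    by rewrite -(mulmxA T) QQ.
  rewrite mulmxA QQ; apply: growQ => //; by rewrite mulmxA QQ.
- move=> Eu; have := QE => /(congr1 (fun B => B *m invmx E)).
  by rewrite -mulmxA mulmxV// mulmx1.
Qed.

End Contraction.

(** * Taylor estimates and a single draw *)

Section CosTaylor.
Variable R : realType.
Implicit Types a z : R.

Lemma sin_norm_le z : `|sin z| <= `|z|.
Proof.
wlog z0 : z / 0 <= z.
  move=> h; have [/h//|/ltW z0] := leP 0 z.
  by have := h (- z); rewrite sinN !normrN; apply; rewrite oppr_ge0.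
have [c _] := @MVT_segment R sin cos 0 z z0
  (fun x _ => is_derive_sin x) (continuous_subspaceT (@continuous_sin R)).
rewrite sin0 !subr0 => ->; rewrite normrM ler_piMl//.
by rewrite ler_norml cos_geN1 cos_le1.
Qed.

Lemma cos_half z : cos z = 1 - 2 * sin (z / 2) ^+ 2.
Proof.
have -> : cos z = cos (z / 2 + z / 2) by congr cos; field.
by rewrite cosD -!expr2 cos2sin2; ring.
Qed.

Lemma one_sub_cos_bound z : 0 <= 1 - cos z <= z ^+ 2 / 2.
Proof.
rewrite cos_half; have := sqr_ge0 (sin (z / 2)).
have : sin (z / 2) ^+ 2 <= (z / 2) ^+ 2.
  by rewrite -[leLHS]real_normK ?num_real// -[leRHS]real_normK ?num_real//
    lerXn2r ?nnegrE// sin_norm_le.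
rewrite [(z / 2) ^+ 2]exprMn exprVn => h1 h2.
apply/andP; split; first lra.
have e : (2 : R) ^- 2 = 1 / 4 by field.
rewrite e in h1; lra.
Qed.

Lemma sin_taylor z : `|sin z - z| <= `|z| ^+ 3 / 2.
Proof.
wlog z0 : z / 0 <= z.
  move=> h; have [/h//|/ltW z0] := leP 0 z.
  have := h (- z); rewrite sinN opprK addrC -normrN opprB normrN => h'.
  by apply: h'; rewrite oppr_ge0.
have df (x : R) : is_derive x 1 (fun y => sin y - y) (cos x - 1).
  by apply: is_deriveB.
have cf : continuous (fun y : R => sin y - y).
  by move=> x; apply/differentiable_continuous/derivable1_diffP; exact: ex_derive.
have [c] := @MVT_segment R _ _ 0 z z0 (fun x _ => df x) (continuous_subspaceT cf).
rewrite in_itv/= => /andP[c0 cz]; rewrite sin0 !subr0 => ->.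
have /andP[h1 h2] := one_sub_cos_bound c.
rewrite normrM -normrN opprB (ger0_norm h1) (ger0_norm z0).
rewrite [in leRHS]exprSr mulrAC ler_wpM2r//.
apply: le_trans h2 _; rewrite ler_wpM2r ?invr_ge0// lerXn2r ?nnegrE//.
Qed.

Lemma cos_taylor z : `|cos z - 1 + z ^+ 2 / 2| <= `|z| ^+ 3.
Proof.
have /andP[h1 h2] := one_sub_cos_bound z.
have z2 : z ^+ 2 = `|z| ^+ 2 by rewrite real_normK// num_real.
have low : `|cos z - 1 + z ^+ 2 / 2| = z ^+ 2 / 2 - (1 - cos z).
  by rewrite ger0_norm; lra.
have [z1|z1] := leP 1 `|z|.
  rewrite low; apply: (@le_trans _ _ (`|z| ^+ 2)); first by rewrite -z2; have := sqr_ge0 z; lra.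
  by rewrite [leRHS]exprS ler_peMl// exprn_ge0.
rewrite low cos_half.
set y := z / 2.
have -> : z ^+ 2 / 2 - (1 - (1 - 2 * sin y ^+ 2)) = 2 * ((y - sin y) * (y + sin y)).
  by rewrite /y; field.
apply: le_trans (ler_norm _) _; rewrite !normrM (@ger0_norm _ 2)//.
have t1 := sin_taylor y; rewrite distrC in t1.
have t2 : `|y + sin y| <= 2 * `|y|.
  by apply: le_trans (ler_normD _ _) _; have := sin_norm_le y; lra.
have yE : `|y| = `|z| / 2 by rewrite /y normrM (@ger0_norm _ 2^-1)// invr_ge0.
have := ler_pM (normr_ge0 _) (normr_ge0 _) t1 t2.
rewrite yE; set w := `|z| in z1 *; move=> h.
have w0 : 0 <= w by rewrite /w.
have e : (w / 2) ^+ 3 / 2 * (2 * (w / 2)) = w ^+ 4 / 16 by field.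
rewrite e in h.
have : w ^+ 4 <= w ^+ 3 by rewrite [leLHS]exprS ler_piMl ?exprn_ge0// ltW.
have : 0 <= w ^+ 3 by rewrite exprn_ge0.
lra.
Qed.

Lemma cos_add_taylor a z :
  `|cos (a + z) - (cos a - z * sin a - z ^+ 2 / 2 * cos a)| <= 2 * `|z| ^+ 3.
Proof.
have -> : cos (a + z) - (cos a - z * sin a - z ^+ 2 / 2 * cos a) =
   cos a * (cos z - 1 + z ^+ 2 / 2) - sin a * (sin z - z).
  by rewrite cosD; ring.
apply: le_trans (ler_normB _ _) _; rewrite !normrM.
have ca : `|cos a| <= 1 by rewrite ler_norml cos_geN1 cos_le1.
have sa : `|sin a| <= 1 by rewrite ler_norml sin_geN1 sin_le1.
have h1 := ler_pM (normr_ge0 _) (normr_ge0 _) ca (cos_taylor z).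
have h2 := ler_pM (normr_ge0 _) (normr_ge0 _) sa (sin_taylor z).
have : 0 <= `|z| ^+ 3 by rewrite exprn_ge0.
lra.
Qed.

Lemma expR_taylor1 s z : 0 <= s -> s <= z ^+ 2 -> 0 <= z ->
  `|expR (- s) - (1 - s)| <= z ^+ 3.
Proof.
move=> s0 sz z0.
have h1 : 1 - s <= expR (- s) by have := expR_ge1Dx (- s); lra.
have h2 : expR (- s) <= 1 by rewrite -[leRHS]expR0 ler_expR oppr_le0.
have h3 : expR (- s) * (1 + s) <= 1.
  have := expR_ge1Dx s; rewrite -(ler_pM2l (expR_gt0 (- s))) -expRD addNr expR0; lra.
rewrite ger0_norm; last lra.
have [z1|z1] := leP 1 z.
  have : z ^+ 2 <= z ^+ 3 by rewrite [leRHS]exprS ler_peMl// exprn_ge0.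
  lra.
have h4 : expR (- s) - (1 - s) <= s ^+ 2 by nra.
apply: le_trans h4 _; apply: (@le_trans _ _ ((z ^+ 2) ^+ 2)).
  by rewrite lerXn2r ?nnegrE// exprn_ge0.
by rewrite -exprM [leLHS]exprS ler_piMl ?exprn_ge0// ltW.
Qed.

End CosTaylor.

Section OneDraw.
Variables (R : realType) (k : nat) (p w : 'I_k -> R) (M : R).
Hypotheses (p_ge0 : forall j, 0 <= p j) (p_sum : \sum_j p j = 1).
Hypothesis w_le : forall j, `|w j| <= M.

Let wbar := \sum_j p j * w j.

Lemma draw_mean_le : `|wbar| <= M.
Proof.
apply: le_trans (ler_norm_sum _ _ _) _; rewrite -[leRHS]mul1r -p_sum mulr_suml.
by apply: ler_sum => j _; rewrite normrM ger0_norm// ler_wpM2l.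
Qed.

Lemma draw_centered : \sum_j p j * (w j - wbar) = 0.
Proof.
under eq_bigr do rewrite mulrBr.
by rewrite sumrB -mulr_suml p_sum mul1r subrr.
Qed.

Lemma draw_variance : \sum_j p j * (w j - wbar) ^+ 2 =
  \sum_j p j * w j ^+ 2 - wbar ^+ 2.
Proof.
under eq_bigr => j _.
  have -> : p j * (w j - wbar) ^+ 2 =
    p j * w j ^+ 2 - 2 * wbar * (p j * w j) + wbar ^+ 2 * p j by ring.
  over.
rewrite big_split sumrB/= -!mulr_sumr p_sum -/wbar; ring.
Qed.

Lemma draw_second_moment_le : \sum_j p j * w j ^+ 2 <= M ^+ 2.
Proof.
rewrite -[leRHS]mul1r -p_sum mulr_suml; apply: ler_sum => j _.
rewrite ler_wpM2l// -real_normK ?num_real// lerXn2r ?nnegrE//.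
by apply: le_trans (w_le j).
Qed.

Lemma draw_variance_ge0 : 0 <= \sum_j p j * w j ^+ 2 - wbar ^+ 2.
Proof.
by rewrite -draw_variance; apply: sumr_ge0 => j _; rewrite mulr_ge0// sqr_ge0.
Qed.

Lemma draw_sqr_le a : \sum_j p j * (a + (w j - wbar)) ^+ 2 <= a ^+ 2 + M ^+ 2.
Proof.
have -> : \sum_j p j * (a + (w j - wbar)) ^+ 2 =
   a ^+ 2 + \sum_j p j * (w j - wbar) ^+ 2.
  under eq_bigr => j _.
    have -> : p j * (a + (w j - wbar)) ^+ 2 =
      a ^+ 2 * p j + 2 * a * (p j * (w j - wbar)) + p j * (w j - wbar) ^+ 2 by ring.
    over.
  by rewrite !big_split/= -!mulr_sumr p_sum draw_centered; ring.
rewrite lerD2l draw_variance lerBlDr; apply: le_trans draw_second_moment_le _.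
by rewrite lerDl sqr_ge0.
Qed.

(** A second order expansion: the first order term vanishes because w - wbar is
    centred under p. The variance is then evaluated under another law q, here
    the limit of the draw probabilities, at the cost of the distance between p
    and q. *)
Lemma draw_cos a (q : 'I_k -> R) : (forall j, 0 <= q j) -> \sum_j q j = 1 ->
  forall v, v = \sum_j q j * w j ^+ 2 - (\sum_j q j * w j) ^+ 2 ->
  `|\sum_j p j * cos (a + (w j - wbar)) - (1 - v / 2) * cos a| <=
  16 * M ^+ 3 + 2 * M ^+ 2 * \sum_j `|p j - q j|.
Proof.
move=> q0 q1 v vE.
pose t j := cos (a + (w j - wbar)) -
  (cos a - (w j - wbar) * sin a - (w j - wbar) ^+ 2 / 2 * cos a).
have M0 : 0 <= M by apply: le_trans draw_mean_le.
have tE : \sum_j p j * cos (a + (w j - wbar)) - (1 - v / 2) * cos a =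
   \sum_j p j * t j -
   (\sum_j p j * w j ^+ 2 - wbar ^+ 2 - v) / 2 * cos a.
  have -> : \sum_j p j * t j = \sum_j p j * cos (a + (w j - wbar)) -
     cos a + sin a * 0 + cos a / 2 * (\sum_j p j * (w j - wbar) ^+ 2).
    have -> : \sum_j p j * cos (a + (w j - wbar)) - cos a =
      \sum_j (p j * cos (a + (w j - wbar)) - cos a * p j).
      by rewrite sumrB -mulr_sumr p_sum mulr1.
    rewrite -[in X in sin a * X]draw_centered.
    under eq_bigr => j _.
      have -> : p j * t j = (p j * cos (a + (w j - wbar)) - cos a * p j) +
        sin a * (p j * (w j - wbar)) + cos a / 2 * (p j * (w j - wbar) ^+ 2).
        by rewrite /t; field.
      over.
    by rewrite !big_split/= -!mulr_sumr.
  by rewrite draw_variance; field.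
rewrite tE; apply: le_trans (ler_normB _ _) _; apply: lerD.
  apply: le_trans (ler_norm_sum _ _ _) _.
  have -> : 16 * M ^+ 3 = \sum_j p j * (16 * M ^+ 3) by rewrite -mulr_suml p_sum mul1r.
  apply: ler_sum => j _; rewrite normrM ger0_norm// ler_wpM2l//.
  apply: le_trans (cos_add_taylor _ _) _.
  have z2 : `|w j - wbar| <= 2 * M.
    by apply: le_trans (ler_normB _ _) _; have := w_le j; have := draw_mean_le; lra.
  have : `|w j - wbar| ^+ 3 <= (2 * M) ^+ 3 by rewrite lerXn2r ?nnegrE// mulr_ge0.
  rewrite exprMn (_ : 2 ^+ 3 = 8 :> R); last by ring.
  lra.
rewrite normrM.
have ca : `|cos a| <= 1 by rewrite ler_norml cos_geN1 cos_le1.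
apply: le_trans (ler_piMr (normr_ge0 _) ca) _.
pose S := \sum_j `|p j - q j|.
have qm : `|\sum_j q j * w j| <= M.
  apply: le_trans (ler_norm_sum _ _ _) _; rewrite -[leRHS]mul1r -q1 mulr_suml.
  by apply: ler_sum => j _; rewrite normrM ger0_norm// ler_wpM2l.
have d1 : `|\sum_j p j * w j ^+ 2 - \sum_j q j * w j ^+ 2| <= S * M ^+ 2.
  rewrite -sumrB; apply: le_trans (ler_norm_sum _ _ _) _.
  rewrite mulr_suml; apply: ler_sum => j _.
  rewrite -mulrBl normrM ler_wpM2l// normrX lerXn2r ?nnegrE//.
have d2 : `|wbar - \sum_j q j * w j| <= S * M.
  rewrite -sumrB; apply: le_trans (ler_norm_sum _ _ _) _.
  by rewrite mulr_suml; apply: ler_sum => j _; rewrite -mulrBl normrM ler_wpM2l.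
have d3 : `|wbar + \sum_j q j * w j| <= 2 * M.
  by apply: le_trans (ler_normD _ _) _; have := draw_mean_le; lra.
have d4 := ler_pM (normr_ge0 _) (normr_ge0 _) d2 d3.
rewrite -normrM in d4.
have -> : (\sum_j p j * w j ^+ 2 - wbar ^+ 2 - v) / 2 =
  ((\sum_j p j * w j ^+ 2 - \sum_j q j * w j ^+ 2)
   - (wbar - \sum_j q j * w j) * (wbar + \sum_j q j * w j)) / 2.
  by rewrite vE; ring.
rewrite normrM (@ger0_norm _ 2^-1) ?invr_ge0//.
have := ler_normB (\sum_j p j * w j ^+ 2 - \sum_j q j * w j ^+ 2)
   ((wbar - \sum_j q j * w j) * (wbar + \sum_j q j * w j)).
rewrite -/S; have S0 : 0 <= S by exact: sumr_ge0.
have : 0 <= S * M ^+ 2 by rewrite mulr_ge0// sqr_ge0.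
lra.
Qed.

End OneDraw.

(** * The law of the urn as a positive functional *)

Definition dot (R : realType) (k : nat) (y : 'rV[R]_k) (v : 'cV[R]_k) : R :=
  (y *m v) 0 0.

Section Dot.
Variables (R : realType) (k : nat).
Implicit Types (y x : 'rV[R]_k) (v w : 'cV[R]_k) (A : 'M[R]_k).

Lemma dotE y v : dot y v = \sum_j y 0 j * v j 0.
Proof. by rewrite /dot mxE. Qed.

Lemma dotDl x y v : dot (x + y) v = dot x v + dot y v.
Proof. by rewrite /dot mulmxDl mxE. Qed.

Lemma dotBl x y v : dot (x - y) v = dot x v - dot y v.
Proof. by rewrite /dot mulmxBl !mxE. Qed.

Lemma dotZl t y v : dot (t *: y) v = t * dot y v.
Proof. by rewrite /dot -scalemxAl mxE. Qed.

Lemma dotDr y v w : dot y (v + w) = dot y v + dot y w.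
Proof. by rewrite /dot mulmxDr mxE. Qed.

Lemma dotZr t y v : dot y (t *: v) = t * dot y v.
Proof. by rewrite /dot -scalemxAr mxE. Qed.

Lemma dot_mulmx y A v : dot (y *m A) v = dot y (A *m v).
Proof. by rewrite /dot mulmxA. Qed.

Lemma dot_row A j v : dot (row j A) v = (A *m v) j 0.
Proof. by rewrite /dot -row_mul mxE. Qed.

Lemma dot_delta y j : dot y (delta_mx j 0) = y 0 j.
Proof.
rewrite dotE (bigD1 j)//= mxE !eqxx mulr1 big1 ?addr0// => i ij.
by rewrite mxE (negbTE ij) mulr0.
Qed.

Lemma dot_norm_le y v : `|dot y v| <= (\sum_j `|y 0 j|) * `|v|.
Proof.
rewrite dotE; apply: le_trans (ler_norm_sum _ _ _) _.
rewrite mulr_suml; apply: ler_sum => j _.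
by rewrite normrM ler_wpM2l// le_entry_norm.
Qed.

End Dot.

Definition draw_norm (R : realType) (k : nat) (theta : R) : R := k%:R * theta - 1.

(** The urn takes finitely many values, so the law after n draws can be defined
    on all functions by iterating the transition, without measurability. *)
Section UrnMean.
Variables (R : realType) (k : nat) (theta : R) (Rep : 'M[R]_k).
Hypotheses (hk : (2 <= k)%N) (htheta : 1 <= theta) (hRep : stochastic Rep).

Local Notation c := (draw_norm k theta).

Lemma urn_const_ge1 : 1 <= c.
Proof.
rewrite /draw_norm; have : 2 <= k%:R :> R by rewrite (ler_nat _ 2).
have := htheta; nra.
Qed.

Definition draw_prob n (x : 'rV[R]_k) (j : 'I_k) : R :=
  c^-1 * (theta - x 0 j / n.+1%:R).

Fixpoint urn_mean (U0 : 'rV[R]_k) n (f : 'rV[R]_k -> R) : R :=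
  if n is n'.+1
  then urn_mean U0 n' (fun x => \sum_j draw_prob n' x j * f (x + row j Rep))
  else f U0.

Definition urn_simplex n (x : 'rV[R]_k) : Prop :=
  (forall j, 0 <= x 0 j) /\ \sum_j x 0 j = n.+1%:R.

Lemma draw_prob_ge0 n x j : urn_simplex n x -> 0 <= draw_prob n x j.
Proof.
move=> [x0 x1]; have c1 := urn_const_ge1; have t1 := htheta.
apply: mulr_ge0; first by rewrite invr_ge0; lra.
rewrite subr_ge0 ler_pdivrMr//; apply: (@le_trans _ _ n.+1%:R).
  by rewrite -x1 (bigD1 j)//= lerDl sumr_ge0.
by rewrite ler_peMl.
Qed.

Lemma draw_prob_sum n x : urn_simplex n x -> \sum_j draw_prob n x j = 1.
Proof.
move=> [x0 x1]; have c1 := urn_const_ge1.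
rewrite -mulr_sumr sumrB sumr_const card_ord -mulr_suml x1 divff// -mulr_natl.
by rewrite -/(draw_norm k theta) mulVf//; lra.
Qed.

Lemma urn_simplexS n x j : urn_simplex n x -> urn_simplex n.+1 (x + row j Rep).
Proof.
move=> [x0 x1]; split=> [i|].
  by rewrite !mxE addr_ge0// stochastic_ge0.
under eq_bigr do rewrite !mxE.
by rewrite big_split/= x1 stochastic_row_sum// -[n.+2]addn1 natrD.
Qed.

Section Functional.
Variable U0 : 'rV[R]_k.
Hypothesis hU0 : prob_vector U0.
Local Notation mean := (urn_mean U0).

Lemma urn_mean_le n f g : (forall x, urn_simplex n x -> f x <= g x) ->
  mean n f <= mean n g.
Proof.
elim: n f g => [|n ih] f g h /=; first by apply: h; case: hU0.
apply: ih => x hx; apply: ler_sum => j _.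
by rewrite ler_wpM2l ?draw_prob_ge0//; apply/h/urn_simplexS.
Qed.

Lemma eq_urn_mean n f g : (forall x, urn_simplex n x -> f x = g x) ->
  mean n f = mean n g.
Proof.
by move=> h; apply/eqP; rewrite eq_le; apply/andP; split;
  apply: urn_mean_le => x hx; rewrite h.
Qed.

Lemma urn_meanD n f g : mean n (fun x => f x + g x) = mean n f + mean n g.
Proof.
elim: n f g => [//|n ih] f g /=.
rewrite -ih; apply: eq_urn_mean => x _; rewrite -big_split/=.
by apply: eq_bigr => j _; rewrite mulrDr.
Qed.

Lemma urn_meanZ n t f : mean n (fun x => t * f x) = t * mean n f.
Proof.
elim: n f => [//|n ih] f /=.
rewrite -ih; apply: eq_urn_mean => x _; rewrite mulr_sumr.
by apply: eq_bigr => j _; rewrite mulrCA.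
Qed.

Lemma urn_mean_cst n t : mean n (fun=> t) = t.
Proof.
elim: n t => [//|n ih] t /=.
rewrite -[RHS]ih; apply: eq_urn_mean => x hx.
by rewrite -mulr_suml draw_prob_sum// mul1r.
Qed.

Lemma urn_meanB n f g : mean n (fun x => f x - g x) = mean n f - mean n g.
Proof.
rewrite urn_meanD -mulN1r -urn_meanZ; congr (_ + _).
by apply: eq_urn_mean => x _; rewrite mulN1r.
Qed.

Lemma urn_mean_sum n (I : finType) (F : I -> 'rV[R]_k -> R) :
  mean n (fun x => \sum_i F i x) = \sum_i mean n (F i).
Proof.
rewrite /index_enum; elim: (Finite.enum I) => [|i s ih].
  rewrite big_nil -[RHS](urn_mean_cst n); apply: eq_urn_mean => x _.
  by rewrite big_nil.
rewrite big_cons -ih -urn_meanD; apply: eq_urn_mean => x _.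
by rewrite big_cons.
Qed.

Lemma urn_mean_norm n f : `|mean n f| <= mean n (fun x => `|f x|).
Proof.
rewrite ler_norml; apply/andP; split; last first.
  by apply: urn_mean_le => x _; exact: ler_norm.
rewrite lerNl -mulN1r -urn_meanZ; apply: urn_mean_le => x _.
by rewrite mulN1r -normrN ler_norm.
Qed.

Lemma urn_mean_norm_sqr_le n f (s : R) : 0 < s ->
  mean n (fun x => f x ^+ 2) <= s ^+ 2 -> mean n (fun x => `|f x|) <= s.
Proof.
move=> s0 h.
have : mean n (fun x => `|f x|) <= mean n (fun x => s / 2 + (2 * s)^-1 * f x ^+ 2).
  apply: urn_mean_le => x _.
  have -> : s / 2 + (2 * s)^-1 * f x ^+ 2 =
     `|f x| + (2 * s)^-1 * (`|f x| - s) ^+ 2.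
    rewrite -[f x ^+ 2]real_normK ?num_real//; field; lra.
  by rewrite lerDl mulr_ge0 ?sqr_ge0// invr_ge0 mulr_ge0// ltW.
move/le_trans; apply; rewrite urn_meanD urn_mean_cst urn_meanZ.
have i0 : 0 <= (2 * s)^-1 by rewrite invr_ge0 mulr_ge0// ltW.
apply: (@le_trans _ _ (s / 2 + (2 * s)^-1 * s ^+ 2)).
  by rewrite lerD2l ler_wpM2l.
by rewrite le_eqVlt; apply/orP; left; apply/eqP; field; lra.
Qed.

End Functional.
End UrnMean.

(** * The characteristic function of the deviation *)

Section Response.
Variables (R : realType) (a : R) (s : nat -> R).
Hypotheses (a0 : 0 <= a) (hs : clt_scale a s).

(** The extremal solution of the second moment recursion started at x0 with noise
    eps. *)
Fixpoint response (x0 : R) (eps : nat -> R) n : R :=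
  if n is n'.+1 then (1 + a / n'.+1%:R) ^+ 2 * response x0 eps n' + eps n' else x0.

Lemma response_ge0 x0 eps n : 0 <= x0 -> (forall i, 0 <= eps i) ->
  0 <= response x0 eps n.
Proof.
by move=> x00 e0; elim: n => //= n ih; rewrite addr_ge0// mulr_ge0// sqr_ge0.
Qed.

Lemma response_bounded x0 eta : 0 <= x0 -> 0 <= eta ->
  exists2 C, 0 <= C & \forall n \near \oo, response x0 (fun=> eta) n <= C * s n.
Proof.
move=> x00 e0; have [[K K0 hK] _ _] := hs.
exists (K * eta + 1); first by rewrite addr_ge0// mulr_ge0.
by apply: hK => // [n|]; [exact: response_ge0 | near=> n].
Unshelve. all: by end_near. Qed.

Lemma response_small x0 eps : 0 <= x0 -> (forall i, 0 <= eps i) ->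
  (forall d, 0 < d -> \forall n \near \oo, eps n <= d) ->
  forall d, 0 < d -> \forall n \near \oo, response x0 eps n <= d * s n.
Proof.
move=> x00 e0 he; apply: (scale_noise_cvg0 hs _ _ he) => n //=.
exact: response_ge0.
Qed.

Lemma rising_sqr_small d : 0 < d -> \forall n \near \oo, rising a n ^+ 2 <= d * s n.
Proof.
move=> d0; apply: (scale_noise_cvg0 hs (eps := fun=> 0)) => // [n|n|e e0].
- exact: sqr_ge0.
- by rewrite /= exprMn addr0.
- by near=> n; exact: ltW.
Unshelve. all: by end_near. Qed.

Lemma near_scale_gt0 : \forall n \near \oo, 0 < s n.
Proof.
have [_ _ h] := hs; near=> n.
have n0 : 0 < n%:R :> R by rewrite ltr0n; near: n; exact: nbhs_infty_gt.
by apply: lt_le_trans n0 _; near: n.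
Unshelve. all: by end_near. Qed.

End Response.

Definition quad (R : realType) (k : nat) (X : 'M[R]_k) (v : 'cV[R]_k) : R :=
  (v^T *m X *m v) 0 0.

Lemma quadZ (R : realType) (k : nat) (X : 'M[R]_k) t (v : 'cV[R]_k) :
  quad X (t *: v) = t ^+ 2 * quad X v.
Proof.
rewrite /quad; have -> : (t *: v)^T = t *: v^T by rewrite linearZ.
by rewrite -!scalemxAl -scalemxAr scalerA -expr2 mxE.
Qed.

Lemma expR_sub_le (R : realType) (x y : R) : 0 <= x -> 0 <= y ->
  `|expR (- x) - expR (- y)| <= `|x - y|.
Proof.
wlog xy : x y / x <= y.
  move=> h x0 y0; have [/h->//|/ltW /h] := leP x y.
  by move=> h'; rewrite distrC (distrC x); exact: h'.
move=> x0 y0.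
have e1 : expR (- y) <= expR (- x) by rewrite ler_expR lerN2.
have e2 : expR (- x) <= 1 by rewrite -[leRHS]expR0 ler_expR oppr_le0.
rewrite ger0_norm ?subr_ge0// distrC ger0_norm ?subr_ge0//.
have -> : - y = - x + - (y - x) by ring.
rewrite expRD.
have := expR_ge1Dx (- (y - x)); have := expR_gt0 (- x); nra.
Qed.

Lemma cos_lipschitz (R : realType) (x z : R) : `|cos (x + z) - cos x| <= `|z|.
Proof.
pose h := z / 2; pose m := x + h.
have -> : x + z = m + h by rewrite /m /h; field.
have -> : x = m - h by rewrite /m addrK.
have -> : cos (m + h) - cos (m - h) = - (2 * sin m * sin h).
  by rewrite cosB cosD; ring.
have sm : `|sin m| <= 1 by rewrite ler_norml sin_geN1 sin_le1.
have zE : `|z| = 2 * `|h|.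
  by rewrite /h normrM (@ger0_norm _ 2^-1) ?invr_ge0//; field.
rewrite normrN !normrM (@ger0_norm _ 2)// zE -mulrA ler_wpM2l//.
apply: le_trans (ler_piMl _ sm) _ => //; exact: sin_norm_le.
Qed.

Section UrnFourier.
Variables (R : realType) (k : nat) (theta : R) (Rep : 'M[R]_k) (mu : 'rV[R]_k).
Hypotheses (hk : (2 <= k)%N) (htheta : 1 <= theta) (hRep : stochastic Rep).
Local Notation c := (draw_norm k theta).
Hypothesis hmu : (const_mx theta - mu) *m Rep = c *: mu.

Variables (A : 'M[R]_k) (a : R) (N : 'cV[R]_k -> R) (s : nat -> R).
Hypothesis hA : forall y : 'rV[R]_k, \sum_j y 0 j = 0 ->
  y *m A = - c^-1 *: (y *m Rep).
Hypotheses (a0 : 0 <= a) (hN : growth_norm A a N) (hs : clt_scale a s).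

Local Notation mean := (urn_mean theta Rep).
Local Notation prob := (draw_prob theta).

(** The limit of the draw probabilities, for which stat Rep = mu. *)
Definition stat : 'rV[R]_k := c^-1 *: (const_mx theta - mu).
Definition deviation n (x : 'rV[R]_k) := x - n.+1%:R *: mu.
(** Drift of the deviation, transposed to the test vectors: linear functionals of
    the deviation are propagated by moving v backwards in time. *)
Definition back n (v : 'cV[R]_k) := v + n.+1%:R^-1 *: (A *m v).

Let c1 : 1 <= c. Proof. exact: urn_const_ge1. Qed.
Let c_neq0 : c != 0. Proof. by rewrite gt_eqF// (lt_le_trans ltr01 c1). Qed.

Let N_ge v : `|v| <= N v. Proof. by case: hN. Qed.
Let N_ge0 v : 0 <= N v. Proof. by apply: le_trans (N_ge v). Qed.
Let NZ t v : N (t *: v) = `|t| * N v. Proof. by case: hN. Qed.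

Let N_back n v : N (back n v) <= (1 + a / n.+1%:R) * N v.
Proof.
case: hN => _ _; apply; rewrite invr_ge0 ler0n/= invf_le1 ?ler1n//.
Qed.

Lemma urn_mu_sum : \sum_j mu 0 j = 1.
Proof.
have e := congr1 (fun y : 'rV[R]_k => \sum_j y 0 j) hmu.
have e2 : \sum_j ((const_mx theta - mu) *m Rep) 0 j = k%:R * theta - \sum_j mu 0 j.
  under eq_bigr do rewrite mxE.
  rewrite exchange_big/=.
  under eq_bigr => i _.
    rewrite -mulr_sumr stochastic_row_sum// mulr1 !mxE.
    over.
  by rewrite /= sumrB sumr_const card_ord mulr_natl.
have e3 : \sum_j (c *: mu) 0 j = c * \sum_j mu 0 j.
  by rewrite mulr_sumr; apply: eq_bigr => j _; rewrite mxE.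
move: e; rewrite /= e2 e3 => e.
have : c * (\sum_j mu 0 j - 1) + (\sum_j mu 0 j - 1) = 0.
  by rewrite -[k%:R * theta](subrK 1) -/(draw_norm k theta) in e; lra.
have := c1; nra.
Qed.

Let deviation_sum n x : urn_simplex n x -> \sum_j deviation n x 0 j = 0.
Proof.
move=> [_ x1].
under eq_bigr do rewrite !mxE.
by rewrite sumrB -mulr_sumr urn_mu_sum x1 mulr1 subrr.
Qed.

Lemma stat_sum : \sum_j stat 0 j = 1.
Proof.
under eq_bigr do rewrite !mxE.
by rewrite -mulr_sumr sumrB urn_mu_sum sumr_const card_ord -mulr_natl -/(draw_norm k theta) mulVf.
Qed.

Let stat_Rep : stat *m Rep = mu.
Proof. by rewrite -scalemxAl hmu scalerA mulVf// scale1r. Qed.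

Let prob_dev n x j : prob n x j = stat 0 j - (c * n.+1%:R)^-1 * deviation n x 0 j.
Proof.
rewrite /draw_prob !mxE; have : n.+1%:R != 0 :> R by rewrite pnatr_eq0.
by move: n.+1%:R => m m0; field; rewrite m0 c_neq0.
Qed.

Let prob_dot n x (w : 'cV[R]_k) : urn_simplex n x ->
  \sum_i prob n x i * w i 0 = dot stat w - (c * n.+1%:R)^-1 * dot (deviation n x) w.
Proof.
move=> hx; rewrite !dotE mulr_sumr -sumrB; apply: eq_bigr => i _.
by rewrite prob_dev mulrBl mulrA.
Qed.

Lemma deviation_step n x j v : urn_simplex n x ->
  dot (deviation n.+1 (x + row j Rep)) v = dot (deviation n x) (back n v) +
    ((Rep *m v) j 0 - \sum_i prob n x i * (Rep *m v) i 0).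
Proof.
move=> hx.
have -> : deviation n.+1 (x + row j Rep) = deviation n x + row j Rep - mu.
  rewrite /deviation -[n.+2]addn1 natrD scalerDl scale1r opprD addrA.
  by rewrite (addrAC x).
rewrite dotBl dotDl dot_row prob_dot// -!dot_mulmx stat_Rep.
rewrite dotDr dotZr -dot_mulmx hA ?deviation_sum// dotZl.
have : n.+1%:R != 0 :> R by rewrite pnatr_eq0.
by move: n.+1%:R => m m0; field; rewrite m0 c_neq0.
Qed.

Let Rep_le v j : `|(Rep *m v) j 0| <= N v.
Proof.
apply: le_trans (le_entry_norm _ _) _.
by apply: le_trans (stochastic_norm_le _ hRep) _.
Qed.

Section FixedStart.
Variable U0 : 'rV[R]_k.
Hypothesis hU0 : prob_vector U0.

Let D0 : R := \sum_j `|deviation 0 U0 0 j|.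
Let D0_ge0 : 0 <= D0. Proof. exact: sumr_ge0. Qed.

(** The noise of a draw is uncorrelated with the past, so second moments add up;
    the drift is accounted for by evaluating the induction hypothesis at
    [back n v]. *)
Lemma urn_second_moment n v :
  mean U0 n (fun x => dot (deviation n x) v ^+ 2) <=
  response a (D0 ^+ 2) (fun=> 1) n * N v ^+ 2.
Proof.
elim: n v => [|n ih] v /=.
  rewrite -exprMn -[leLHS]real_normK ?num_real//.
  rewrite lerXn2r ?nnegrE ?mulr_ge0//.
  by apply: le_trans (dot_norm_le _ _) _; rewrite ler_wpM2l.
have le1 : mean U0 n (fun x => \sum_j prob n x j *
      dot (deviation n.+1 (x + row j Rep)) v ^+ 2) <=
   mean U0 n (fun x => dot (deviation n x) (back n v) ^+ 2 + N v ^+ 2).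
  apply: urn_mean_le => // x hx.
  under eq_bigr do rewrite (deviation_step _ _ hx).
  apply: (draw_sqr_le (w := fun j => (Rep *m v) j 0)) => // [j|].
    exact: draw_prob_ge0.
  exact: draw_prob_sum.
apply: le_trans le1 _; rewrite urn_meanD// urn_mean_cst// mulrDl mul1r lerD2r.
apply: le_trans (ih _) _; rewrite [leRHS]mulrAC -exprMn mulrC ler_wpM2r//.
  by apply: response_ge0 => //; exact: sqr_ge0.
by rewrite lerXn2r ?nnegrE// mulr_ge0//; apply: le_trans (onePdivn_ge1 n a0).
Qed.

Lemma urn_deviation_small v d : 0 < d ->
  \forall n \near \oo, mean U0 n (fun x => `|dot (deviation n x) v|) <= d * n%:R.
Proof.
move=> d0.
have [C C0 hC] := response_bounded hs (sqr_ge0 D0) ler01.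
have K0 : 0 < C * N v ^+ 2 + 1 by have := mulr_ge0 C0 (sqr_ge0 (N v)); lra.
near=> n.
have n0 : 0 < n%:R :> R by rewrite ltr0n; near: n; exact: nbhs_infty_gt.
apply: urn_mean_norm_sqr_le => //; first exact: mulr_gt0.
apply: le_trans (urn_second_moment _ _) _.
have h1 : response a (D0 ^+ 2) (fun=> 1) n <= C * s n by near: n.
have h2 : s n <= d ^+ 2 / (C * N v ^+ 2 + 1) * n%:R ^+ 2.
  near: n; apply: (scale_lt_sqr hs); rewrite divr_gt0// exprn_gt0//.
apply: le_trans (ler_wpM2r (sqr_ge0 _) h1) _.
rewrite mulrAC; apply: le_trans (ler_wpM2l _ h2) _.
  by rewrite mulr_ge0// sqr_ge0.
rewrite exprMn mulrA ler_wpM2r ?sqr_ge0// mulrCA ger_pMr ?exprn_gt0//.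
by rewrite ler_pdivrMr//; lra.
Unshelve. all: by end_near. Qed.

Let eps n : R := mean U0 n (fun x => \sum_j `|prob n x j - stat 0 j|).

Let eps_ge0 n : 0 <= eps n.
Proof.
rewrite -(urn_mean_cst hk htheta hRep hU0 n 0); apply: urn_mean_le => // x _.
exact: sumr_ge0.
Qed.

(** The draw probabilities differ from their limit by the deviation divided by
    c (n+1), and the deviation is o(n) in mean. *)
Lemma urn_draw_prob_cvg (d : R) : 0 < d -> \forall n \near \oo,
  mean U0 n (fun x => \sum_j `|prob n x j - stat 0 j|) <= d.
Proof.
move=> d0.
have k0 : 0 < k%:R :> R by rewrite ltr0n; apply: leq_trans hk.
have h j : \forall n \near \oo,
    mean U0 n (fun x => `|dot (deviation n x) (delta_mx j 0)|) <= d / k%:R * n%:R.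
  by apply: urn_deviation_small; exact: divr_gt0.
have {}h : \forall n \near \oo, forall j,
    mean U0 n (fun x => `|dot (deviation n x) (delta_mx j 0)|) <= d / k%:R * n%:R.
  exact: filter_forall.
near=> n.
rewrite urn_mean_sum//.
apply: (@le_trans _ _ (\sum_(j < k) (d / k%:R))); last first.
  by rewrite sumr_const card_ord -[leLHS]mulr_natr divfK// gt_eqF.
apply: ler_sum => j _.
have -> : mean U0 n (fun x => `|prob n x j - stat 0 j|) =
   (c * n.+1%:R)^-1 * mean U0 n (fun x => `|dot (deviation n x) (delta_mx j 0)|).
  rewrite -urn_meanZ//; apply: eq_urn_mean => // x _.
  rewrite prob_dev addrAC subrr add0r normrN normrM dot_delta.
  by rewrite ger0_norm// invr_ge0 mulr_ge0//; have := c1; lra.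
have hj : mean U0 n (fun x => `|dot (deviation n x) (delta_mx j 0)|) <= d / k%:R * n%:R.
  by move: j; near: n.
have cm : 0 < c * n.+1%:R by rewrite mulr_gt0//; have := c1; lra.
rewrite ler_pdivrMl//; apply: le_trans hj _.
rewrite mulrC ler_wpM2r//; first by rewrite divr_ge0// ltW.
apply: (@le_trans _ _ n.+1%:R); first by rewrite ler_nat.
by rewrite ler_peMl.
Unshelve. all: by end_near. Qed.

(* [stat] is a limit in mean of probability vectors. *)
Let stat_ge0_aux j : 0 <= stat 0 j.
Proof.
rewrite leNgt; apply/negP => sj.
have sj2 : 0 < - stat 0 j / 2 by lra.
have [n hn] := filter_ex (urn_draw_prob_cvg sj2).
have : mean U0 n (fun=> - stat 0 j) <= - stat 0 j / 2.
  apply: le_trans hn; apply: urn_mean_le => // x hx.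
  rewrite (bigD1 j)//=; have := @draw_prob_ge0 _ _ theta hk htheta n x j hx.
  have := ler_norm (prob n x j - stat 0 j).
  have : 0 <= \sum_(i < k | i != j) `|prob n x i - stat 0 i| by exact: sumr_ge0.
  lra.
by rewrite urn_mean_cst//; lra.
Qed.

(** The variance of the noise along v when the colour has law [stat]. *)
Definition noise_var (v : 'cV[R]_k) : R := \sum_j stat 0 j * (Rep *m v) j 0 ^+ 2
  - (\sum_j stat 0 j * (Rep *m v) j 0) ^+ 2.

Fixpoint acc_var n (v : 'cV[R]_k) : R :=
  if n is n'.+1 then acc_var n' (back n' v) + noise_var v else 0.

Let noise_var_ge0 v : 0 <= noise_var v.
Proof. by apply: draw_variance_ge0 => //; exact: stat_sum. Qed.

Let noise_var_le v : noise_var v <= N v ^+ 2.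
Proof.
rewrite /noise_var lerBlDr; apply: le_trans (draw_second_moment_le _ _ (Rep_le v)) _ => //.
  exact: stat_sum.
by rewrite lerDl sqr_ge0.
Qed.

Lemma acc_var_ge0 n v : 0 <= acc_var n v.
Proof. by elim: n v => //= n ih v; rewrite addr_ge0. Qed.

(** The three error terms are the initial deviation, the cubic Taylor remainders
    and the replacement of the draw probabilities by their limit, each carried
    along by the drift. The constant 17 is 16 from [draw_cos] plus 1 for
    replacing 1 - q/2 by exp(-q/2). *)
Lemma urn_fourier n v b :
  `|mean U0 n (fun x => cos (dot (deviation n x) v + b))
    - expR (- (acc_var n v / 2)) * cos b| <=
  D0 * (rising a n * N v)
  + rising a n * response a 0 (fun=> 17) n * N v ^+ 3
  + response a 0 (fun i => 2 * eps i) n * N v ^+ 2.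
Proof.
elim: n v => [|n ih] v.
  rewrite /= mul0r oppr0 expR0 !mul1r !mul0r !addr0.
  apply: le_trans (_ : `|dot (deviation 0 U0) v| <= _).
    by rewrite (addrC _ b) cos_lipschitz.
  apply: le_trans (dot_norm_le _ _) _; exact: ler_wpM2l.
set v' := back n v; set f := 1 + a / n.+1%:R.
set M := N v; set q := noise_var v.
have f1 : 1 <= f by exact: onePdivn_ge1.
have M0 : 0 <= M by exact: N_ge0.
pose m1 := mean U0 n (fun x => cos (dot (deviation n x) v' + b)).
have st1 : `|mean U0 n.+1 (fun x => cos (dot (deviation n.+1 x) v + b))
     - (1 - q / 2) * m1| <= 16 * M ^+ 3 + 2 * eps n * M ^+ 2.
  rewrite -urn_meanZ//= -urn_meanB//.
  apply: le_trans (urn_mean_norm hk htheta hRep hU0 _ _) _.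
  have -> : 16 * M ^+ 3 + 2 * eps n * M ^+ 2 =
     mean U0 n (fun x => 16 * M ^+ 3 + 2 * M ^+ 2 * \sum_j `|prob n x j - stat 0 j|).
    by rewrite urn_meanD// urn_mean_cst// urn_meanZ// -/(eps n); ring.
  apply: urn_mean_le => // x hx.
  under eq_bigr do rewrite (deviation_step _ _ hx) addrAC.
  apply: (draw_cos (w := fun j => (Rep *m v) j 0)) => // [j||].
  - exact: draw_prob_ge0.
  - exact: draw_prob_sum.
  - exact: stat_sum.
have m1_le : `|m1| <= 1.
  apply: le_trans (urn_mean_norm hk htheta hRep hU0 _ _) _.
  rewrite -(urn_mean_cst hk htheta hRep hU0 n 1); apply: urn_mean_le => // x _.
  by rewrite ler_norml cos_geN1 cos_le1.
have q0 : 0 <= q by exact: noise_var_ge0.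
have st2 : `|expR (- (q / 2)) - (1 - q / 2)| <= M ^+ 3.
  apply: expR_taylor1 => //; first lra.
  by have := noise_var_le v; rewrite -/q -/M; lra.
have st3 := ih v'.
set r := rising a n in st3 *; set t := response a 0 _ n in st3 *.
set e := response a 0 _ n in st3 *.
have r1 : 1 <= r by exact: rising_ge1.
have t0 : 0 <= t by apply: response_ge0.
have e0 : 0 <= e by apply: response_ge0 => // i; rewrite mulr_ge0.
have Nv' : N v' <= f * M by exact: N_back.
have Nv'0 : 0 <= N v' by exact: N_ge0.
have Nv2 : N v' ^+ 2 <= (f * M) ^+ 2 by rewrite lerXn2r ?nnegrE// mulr_ge0//; lra.
have Nv3 : N v' ^+ 3 <= (f * M) ^+ 3 by rewrite lerXn2r ?nnegrE// mulr_ge0//; lra.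
rewrite -/m1 in st3.
have E1 : expR (- (acc_var n.+1 v / 2)) =
    expR (- (q / 2)) * expR (- (acc_var n v' / 2)).
  by rewrite /= -/v' -/q -expRD; congr expR; ring.
have qe : 0 <= expR (- (q / 2)) <= 1.
  by rewrite expR_ge0/= -[leRHS]expR0 ler_expR oppr_le0; lra.
rewrite E1.
set X := mean U0 n.+1 _ in st1 *.
set Y := expR (- (acc_var n v' / 2)) in st3 *; set Z := expR (- (q / 2)) in qe st2 *.
have -> : X - Z * Y * cos b = (X - (1 - q / 2) * m1)
   - (Z - (1 - q / 2)) * m1 + Z * (m1 - Y * cos b) by ring.
have b2 : `|(Z - (1 - q / 2)) * m1| <= M ^+ 3.
  by rewrite normrM; apply: le_trans (ler_piMr _ m1_le) _.
have b3 : `|Z * (m1 - Y * cos b)| <= D0 * (r * (f * M)) + r * t * (f * M) ^+ 3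
    + e * (f * M) ^+ 2.
  rewrite normrM; case/andP: qe => Z0 Z1; rewrite (ger0_norm Z0).
  apply: le_trans (ler_piMl _ Z1) _ => //; apply: le_trans st3 _.
  apply: lerD; last exact: ler_wpM2l.
  apply: lerD; last by apply: ler_wpM2l => //; rewrite mulr_ge0//; lra.
  by rewrite ler_wpM2l// ler_wpM2l//; lra.
apply: le_trans (ler_normD _ _) _.
apply: le_trans (lerD (ler_normB _ _) b3) _.
rewrite /= -/r -/t -/e -/f.
have fr : 1 <= f * r by rewrite -[leLHS]mulr1; apply: ler_pM.
have M3 : 0 <= M ^+ 3 by rewrite exprn_ge0.
have last_ineq : 17 * M ^+ 3 <= f * r * (17 * M ^+ 3) by rewrite ler_peMl// mulr_ge0.
have -> : D0 * (f * r * M) + f * r * (f ^+ 2 * t + 17) * M ^+ 3 +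
   (f ^+ 2 * e + 2 * eps n) * M ^+ 2 =
   D0 * (r * (f * M)) + r * t * (f * M) ^+ 3 + e * (f * M) ^+ 2
   + f * r * (17 * M ^+ 3) + 2 * eps n * M ^+ 2 by ring.
lra.
Qed.

Let backZ n t v : back n (t *: v) = t *: back n v.
Proof. by rewrite /back -scalemxAr scalerDr !scalerA mulrC. Qed.

Let acc_varZ n t v : acc_var n (t *: v) = t ^+ 2 * acc_var n v.
Proof.
elim: n t v => [|n ih] t v /=; first by rewrite mulr0.
rewrite backZ ih mulrDr; congr (_ + _); rewrite /noise_var -!scalemxAr.
rewrite mulrBr -exprMn !mulr_sumr.
have tE (w : 'cV[R]_k) j : (t *: w) j 0 = t * w j 0 by rewrite mxE.
congr (_ - _ ^+ 2); apply: eq_bigr => j _; rewrite tE; ring.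
Qed.

(** At v = u / sqrt(s_n) the errors of [urn_fourier] vanish: [rising a n] is
    o(sqrt(s_n)), the cubic term is of order rising s_n / s_n^(3/2), and the last
    one is a response to vanishing noise. *)
Lemma urn_clt_fourier (Sigma : 'M[R]_k) u b d :
  (forall v e, 0 < e -> \forall n \near \oo,
     `|acc_var n v - s n * quad Sigma v| <= e * s n) ->
  0 <= quad Sigma u -> 0 < d -> \forall n \near \oo,
  `|mean U0 n (fun x => cos ((Num.sqrt (s n))^-1 * dot (deviation n x) u + b))
    - expR (- (quad Sigma u / 2)) * cos b| <= d.
Proof.
move=> hV hu d0.
have [C C0 hC] := response_bounded hs (lexx 0) (ler0n R 17).
pose W := D0 * N u + C * N u ^+ 3 + N u ^+ 2 + 1.
have W0 : 0 < W.
  have := mulr_ge0 D0_ge0 (N_ge0 u); have := mulr_ge0 C0 (exprn_ge0 3 (N_ge0 u)).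
  have := sqr_ge0 (N u); rewrite /W; lra.
pose e := d / W; have e0 : 0 < e by exact: divr_gt0.
near=> n.
have s0 : 0 < s n by near: n; exact: near_scale_gt0 hs.
set sg := Num.sqrt (s n).
have sg0 : 0 < sg by rewrite sqrtr_gt0.
have sgE : sg ^+ 2 = s n by rewrite sqr_sqrtr// ltW.
have h1 : rising a n <= e * sg.
  have : rising a n ^+ 2 <= (e * sg) ^+ 2.
    by rewrite exprMn sgE; near: n; apply: (rising_sqr_small hs); rewrite exprn_gt0.
  rewrite ler_pXn2r// nnegrE ltW//; [exact: rising_gt0 | exact: mulr_gt0].
have h2 : response a 0 (fun=> 17) n <= C * s n by near: n.
have h3 : response a 0 (fun i => 2 * eps i) n <= e * s n.
  near: n; apply: (response_small hs) => // [i|d' d'0]; first by rewrite mulr_ge0.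
  have d'2 : 0 < d' / 2 by lra.
  have h := urn_draw_prob_cvg d'2.
  near=> n; have : eps n <= d' / 2 by near: n.
  lra.
have h4 : `|acc_var n u - s n * quad Sigma u| <= e * s n by near: n; exact: hV.
have := urn_fourier n (sg^-1 *: u) b.
rewrite NZ acc_varZ exprVn sgE (ger0_norm (_ : 0 <= sg^-1)) ?invr_ge0 ?(ltW sg0)//.
have -> : (fun x => cos (dot (deviation n x) (sg^-1 *: u) + b)) =
    (fun x => cos (sg^-1 * dot (deviation n x) u + b)).
  by apply/funext => x; rewrite dotZr.
move=> hF.
have r0 : 0 < rising a n by exact: rising_gt0.
have rs : rising a n / sg <= e by rewrite ler_pdivrMr.
have ts : response a 0 (fun=> 17) n / s n <= C by rewrite ler_pdivrMr.
have es : response a 0 (fun i => 2 * eps i) n / s n <= e by rewrite ler_pdivrMr.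
have t0 : 0 <= response a 0 (fun=> 17) n by apply: response_ge0.
have b1 : D0 * (rising a n * (sg^-1 * N u)) <= D0 * (e * N u).
  by rewrite ler_wpM2l// mulrA ler_wpM2r.
have b2 : rising a n * response a 0 (fun=> 17) n * (sg^-1 * N u) ^+ 3 <= e * C * N u ^+ 3.
  have -> : rising a n * response a 0 (fun=> 17) n * (sg^-1 * N u) ^+ 3 =
     (rising a n / sg) * (response a 0 (fun=> 17) n / s n) * N u ^+ 3.
    by rewrite -sgE; field; rewrite gt_eqF.
  rewrite ler_wpM2r ?exprn_ge0//; apply: ler_pM => //.
    by rewrite divr_ge0// ltW.
  by rewrite divr_ge0// ltW.
have b3 : response a 0 (fun i => 2 * eps i) n * (sg^-1 * N u) ^+ 2 <= e * N u ^+ 2.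
  have -> : response a 0 (fun i => 2 * eps i) n * (sg^-1 * N u) ^+ 2 =
     response a 0 (fun i => 2 * eps i) n / s n * N u ^+ 2.
    by rewrite -sgE; field; rewrite gt_eqF.
  by rewrite ler_wpM2r ?sqr_ge0.
have b4 : `|expR (- ((s n)^-1 * acc_var n u / 2)) - expR (- (quad Sigma u / 2))| <= e.
  apply: le_trans (expR_sub_le _ _) _.
  - by rewrite !mulr_ge0 ?acc_var_ge0 ?invr_ge0// ltW.
  - by rewrite mulr_ge0.
  have -> : (s n)^-1 * acc_var n u / 2 - quad Sigma u / 2 =
    (acc_var n u - s n * quad Sigma u) / (2 * s n) by field; rewrite gt_eqF.
  rewrite normrM [X in _ * X]ger0_norm ?invr_ge0 ?mulr_ge0 ?(ltW s0)//.
  rewrite ler_pdivrMr ?mulr_gt0//; apply: le_trans h4 _; nra.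
have eW : d = e * W by rewrite /e divfK// gt_eqF.
set X := mean U0 n _ in hF *.
set E := expR (- ((s n)^-1 * acc_var n u / 2)) in hF b4.
set F := expR (- (quad Sigma u / 2)) in b4 *.
have -> : X - F * cos b = (X - E * cos b) + (E - F) * cos b by ring.
have b5 : `|(E - F) * cos b| <= e.
  rewrite normrM; apply: le_trans b4; rewrite ler_piMr//.
  by rewrite ler_norml cos_geN1 cos_le1.
apply: le_trans (ler_normD _ _) _; rewrite eW /W; lra.
Unshelve. all: by end_near. Qed.

End FixedStart.
End UrnFourier.

(** * Asymptotics of the accumulated covariance *)

Definition bil (R : realType) (k : nat) (X : 'M[R]_k) (u v : 'cV[R]_k) : R :=
  (u^T *m X *m v) 0 0.

Section Bilinear.
Variables (R : realType) (k : nat).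
Implicit Types (X Y A : 'M[R]_k) (u v w : 'cV[R]_k).

Lemma bilDl X u v w : bil X (u + w) v = bil X u v + bil X w v.
Proof. by rewrite /bil linearD/= !mulmxDl mxE. Qed.

Lemma bilDr X u v w : bil X u (v + w) = bil X u v + bil X u w.
Proof. by rewrite /bil mulmxDr mxE. Qed.

Lemma bilZl X t u v : bil X (t *: u) v = t * bil X u v.
Proof. by rewrite /bil linearZ/= -!scalemxAl mxE. Qed.

Lemma bilZr X t u v : bil X u (t *: v) = t * bil X u v.
Proof. by rewrite /bil -scalemxAr mxE. Qed.

Lemma bilD X Y u v : bil (X + Y) u v = bil X u v + bil Y u v.
Proof. by rewrite /bil mulmxDr mulmxDl mxE. Qed.

Lemma bilB X Y u v : bil (X - Y) u v = bil X u v - bil Y u v.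
Proof. by rewrite /bil mulmxBr mulmxBl !mxE. Qed.

Lemma bilZ t X u v : bil (t *: X) u v = t * bil X u v.
Proof. by rewrite /bil -scalemxAr -scalemxAl mxE. Qed.

Lemma bil0 u v : bil 0 u v = 0.
Proof. by rewrite /bil mulmx0 mul0mx mxE. Qed.

Lemma bil_conj A X u v : bil (A^T *m X *m A) u v = bil X (A *m u) (A *m v).
Proof. by rewrite /bil trmx_mul !mulmxA. Qed.

Lemma bil_outer (r : 'rV[R]_k) u : bil (r^T *m r) u u = dot r u ^+ 2.
Proof. by rewrite /bil /dot -!mulmxA mulmxA -trmx_mul mxE big_ord1 mxE expr2. Qed.

Lemma bil_mulr X A u v : bil (X *m A) u v = bil X u (A *m v).
Proof. by rewrite /bil !mulmxA. Qed.

Lemma bil_mull X A u v : bil (A^T *m X) u v = bil X (A *m u) v.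
Proof. by rewrite /bil trmx_mul !mulmxA. Qed.

Lemma bil_tr X u v : bil X^T u v = bil X v u.
Proof.
by rewrite /bil -[LHS](mxE trmx_key (fun i j => (u^T *m X^T *m v) j i) 0 0) -/(trmx _)
  !trmx_mul !trmxK mulmxA.
Qed.

Lemma bil_delta X i j : bil X (delta_mx i 0) (delta_mx j 0) = X i j.
Proof.
by rewrite /bil trmx_delta -mulmxA -colE -rowE !mxE.
Qed.

Lemma bil_bound X : exists2 C, 0 <= C & forall u v, `|bil X u v| <= C * (`|u| * `|v|).
Proof.
have [C C0 hC] := mulmx_norm_bound X.
exists (k%:R * C); first by rewrite mulr_ge0.
move=> u v; rewrite /bil -mulmxA mxE.
apply: le_trans (ler_norm_sum _ _ _) _.
have -> : k%:R * C * (`|u| * `|v|) = \sum_(i < k) `|u| * (C * `|v|).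
  by rewrite sumr_const card_ord -mulr_natl; ring.
apply: ler_sum => i _; rewrite normrM mxE; apply: ler_pM => //.
  exact: le_entry_norm.
by apply: le_trans (le_entry_norm _ _) (hC v).
Qed.

End Bilinear.

Section CovarianceRecursion.
Variables (R : realType) (k : nat) (A : 'M[R]_k).
Implicit Types (G X : 'M[R]_k) (u v : 'cV[R]_k).

Definition back_mx n : 'M[R]_k := 1%:M + n.+1%:R^-1 *: A.

Lemma back_mxE n v : back_mx n *m v = v + n.+1%:R^-1 *: (A *m v).
Proof. by rewrite mulmxDl mul1mx scalemxAl. Qed.

Fixpoint acc_cov G n : 'M[R]_k :=
  if n is n'.+1 then (back_mx n')^T *m acc_cov G n' *m back_mx n' + G else 0.

Lemma acc_cov_tr G n : G^T = G -> (acc_cov G n)^T = acc_cov G n.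
Proof.
move=> hG; elim: n => [|n ih] /=; first by rewrite trmx0.
by rewrite linearD/= !trmx_mul trmxK ih hG mulmxA.
Qed.

Section Noncritical.
Variables (a : R) (N : 'cV[R]_k -> R).
Hypotheses (a_half : 0 <= a < 2^-1) (hN : growth_norm A a N).

Let a0 : 0 <= a. Proof. by case/andP: a_half. Qed.
Let N_ge v : `|v| <= N v. Proof. by case: hN. Qed.
Let N_ge0 v : 0 <= N v. Proof. by apply: le_trans (N_ge v). Qed.
Let N_back n v : N (back_mx n *m v) <= (1 + a / n.+1%:R) * N v.
Proof.
rewrite back_mxE; case: hN => _ _; apply; rewrite invr_ge0 ler0n/= invf_le1 ?ler1n//.
Qed.

(** Forcing of order 1/n, unlike a constant one, contributes only o(n). *)
Lemma conj_recursion_small (D E : nat -> 'M[R]_k) (C : R) : 0 <= C ->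
  (forall n, D n.+1 = (back_mx n)^T *m D n *m back_mx n + E n) ->
  (forall n u v, `|bil (E n) u v| <= C / n.+1%:R * (`|u| * `|v|)) ->
  forall u v e, 0 < e -> \forall n \near \oo, `|bil (D n) u v| <= e * n%:R.
Proof.
move=> C0 hD hE u v e e0.
have hs := clt_scale_linear a_half.
have [K K0 hK] := bil_bound (D 0%N).
have main n u' v' :
    `|bil (D n) u' v'| <= response a K (fun i => C / i.+1%:R) n * (N u' * N v').
  elim: n u' v' => [|n ih] u' v'.
    apply: le_trans (hK _ _) _; rewrite ler_wpM2l//; exact: ler_pM.
  rewrite hD bilD bil_conj; apply: le_trans (ler_normD _ _) _.
  rewrite [response _ _ _ _]/= mulrDl; apply: lerD.
    apply: le_trans (ih _ _) _; rewrite [leRHS]mulrAC mulrC ler_wpM2r//.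
      by apply: response_ge0 => // i; exact: divr_ge0.
    by rewrite expr2 mulrACA; apply: ler_pM.
  apply: le_trans (hE _ _ _) _; rewrite ler_wpM2l ?divr_ge0//; exact: ler_pM.
have W0 : 0 < N u * N v + 1 by have := mulr_ge0 (N_ge0 u) (N_ge0 v); lra.
near=> n.
apply: le_trans (main _ _ _) _.
have : response a K (fun i => C / i.+1%:R) n <= e / (N u * N v + 1) * n%:R.
  near: n; apply: (response_small hs) => // [i|d d0|]; [exact: divr_ge0| |exact: divr_gt0].
  near=> n; rewrite ler_pdivrMr// -ler_pdivrMl//.
  apply: (@le_trans _ _ n%:R); last by rewrite ler_nat.
  by near: n; exact: nbhs_infty_ger.
move=> /(ler_wpM2r (mulr_ge0 (N_ge0 u) (N_ge0 v))) /le_trans; apply.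
have -> : e / (N u * N v + 1) * n%:R * (N u * N v) =
   e * n%:R * (N u * N v / (N u * N v + 1)) by field; rewrite gt_eqF.
rewrite ler_piMr//; first by rewrite mulr_ge0// ltW.
by rewrite ler_pdivrMr// mul1r lerDl.
Unshelve. all: by end_near. Qed.

(** If X solves the Lyapunov equation, then n X satisfies the recursion of
    [acc_cov] up to terms of order 1/n, which contribute o(n) by
    [conj_recursion_small]. *)
Lemma lyapunov_limit G X : X - A^T *m X - X *m A = G ->
  forall u v e, 0 < e ->
  \forall n \near \oo, `|bil (acc_cov G n) u v - n%:R * bil X u v| <= e * n%:R.
Proof.
move=> hX u v e e0.
have [C1 C10 hC1] := bil_bound (A^T *m X + X *m A).
have [C2 C20 hC2] := bil_bound (A^T *m X *m A).
pose E n : 'M[R]_k := (n%:R / n.+1%:R ^+ 2) *: (A^T *m X *m A)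
   - n.+1%:R^-1 *: (A^T *m X + X *m A).
have hD n : acc_cov G n.+1 - n.+1%:R *: X =
    (back_mx n)^T *m (acc_cov G n - n%:R *: X) *m back_mx n + E n.
  have -> : (back_mx n)^T *m (acc_cov G n - n%:R *: X) *m back_mx n =
     (back_mx n)^T *m acc_cov G n *m back_mx n - n%:R *: ((back_mx n)^T *m X *m back_mx n).
    by rewrite mulmxBr mulmxBl -scalemxAr -scalemxAl.
  rewrite /= -hX -addrA -[RHS]addrA; congr (_ + _).
  apply/matrixP => i j; rewrite -!bil_delta.
  have bilN Y x y : bil (- Y) x y = - bil Y x y.
    by rewrite -[- Y]sub0r bilB bil0 sub0r.
  rewrite /E !(bilB, bilD, bilN, bilZ, bil_conj, bil_mull, bil_mulr).
  rewrite !back_mxE !(bilDl, bilDr, bilZl, bilZr).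
  have m0 : n.+1%:R != 0 :> R by rewrite pnatr_eq0.
  have nE : n%:R = n.+1%:R - 1 :> R by rewrite -[n.+1]addn1 natrD addrK.
  by move: m0; rewrite nE; move: n.+1%:R => m m0; field.
have := @conj_recursion_small (fun n => acc_cov G n - n%:R *: X) E (C1 + C2) _ hD.
have -> : 0 <= C1 + C2 by exact: addr_ge0.
move=> /(_ isT) /(_ _ u v e e0).
have hE n u' v' : `|bil (E n) u' v'| <= (C1 + C2) / n.+1%:R * (`|u'| * `|v'|).
  rewrite /E bilB !bilZ; apply: le_trans (ler_normB _ _) _.
  rewrite !normrM.
  have i0 : 0 < n.+1%:R^-1 :> R by rewrite invr_gt0.
  rewrite (@ger0_norm _ (n.+1%:R^-1)) ?(ltW i0)//.
  rewrite (@ger0_norm _ (n%:R)) ?ler0n// (@ger0_norm _ (n.+1%:R ^+ 2)^-1) ?invr_ge0 ?sqr_ge0//.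
  have h1 := ler_wpM2l (ltW i0) (hC1 u' v').
  have h2 : n%:R / n.+1%:R ^+ 2 <= n.+1%:R^-1 :> R.
    rewrite ler_pdivrMr ?exprn_gt0// expr2 mulKf ?pnatr_eq0//.
    by rewrite ler_nat.
  have h3 := ler_pM _ (normr_ge0 _) h2 (hC2 u' v').
  have {}h3 := h3 (divr_ge0 (ler0n _ _) (sqr_ge0 _)).
  apply: le_trans (lerD h3 h1) _.
  by rewrite le_eqVlt; apply/orP; left; apply/eqP; ring.
move=> /(_ hE); apply: filterS => n.
by rewrite bilB bilZ.
Unshelve. all: by end_near. Qed.

(** For G = 0 the accumulated covariance is 0, and X is the limit of its quotient
    by n. *)
Lemma lyapunov_inj X : X - A^T *m X - X *m A = 0 -> X = 0.
Proof.
move=> hX; apply/matrixP => i j; rewrite mxE -bil_delta.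
have acc0 n : acc_cov 0 n = 0.
  by elim: n => //= n ->; rewrite mulmx0 mul0mx addr0.
apply/eqP; rewrite -normr_le0 leNgt; apply/negP => x0.
set b := bil X _ _ in x0 *.
have b2 : 0 < `|b| / 2 by lra.
have := lyapunov_limit hX (delta_mx i 0) (delta_mx j 0) b2.
move=> /(filterI (nbhs_infty_gt 0)) /filter_ex[n [n0]].
rewrite acc0 bil0 sub0r normrN normrM -/b ger0_norm//.
have : 0 < n%:R :> R by rewrite ltr0n.
nra.
Qed.

(** In finite dimension the injectivity of the Lyapunov operator
    ([lyapunov_inj]) makes it surjective. *)
Lemma lyapunov_solve G : exists X, X - A^T *m X - X *m A = G.
Proof.
pose Lm : 'M[R]_(k * k) := 1%:M - lin_mulmx A^T - lin_mulmxr A.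
have LmE (X : 'M[R]_k) : mxvec X *m Lm = mxvec (X - A^T *m X - X *m A).
  rewrite /Lm !mulmxBr mulmx1 !mul_vec_lin/=.
  by rewrite !linearB.
have Lu : Lm \in unitmx.
  rewrite -row_free_unit -kermx_eq0; apply/eqP/row_matrixP => i; rewrite row0.
  have : row i (kermx Lm) *m Lm = 0 by rewrite -row_mul mulmx_ker row0.
  rewrite -[row i _]vec_mxK LmE => h.
  have {}h := congr1 vec_mx h; rewrite mxvecK linear0 in h.
  by rewrite (lyapunov_inj h) linear0.
exists (vec_mx (mxvec G *m invmx Lm)).
by apply: (can_inj mxvecK); rewrite -LmE vec_mxK mulmxKV.
Qed.

Lemma noncritical_covariance G : G^T = G -> exists2 X, X^T = X &
  forall v e, 0 < e ->
  \forall n \near \oo, `|bil (acc_cov G n) v v - n%:R * bil X v v| <= e * n%:R.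
Proof.
move=> hG; have [X hX] := lyapunov_solve G.
exists X; last by move=> v e; exact: lyapunov_limit.
apply/eqP; rewrite -subr_eq0; apply/eqP; apply: lyapunov_inj.
have e : X^T - X^T *m A - A^T *m X^T = X - A^T *m X - X *m A.
  by rewrite hX -hG -hX !linearB/= !trmx_mul trmxK.
rewrite mulmxBr mulmxBl.
have -> : X^T - X - (A^T *m X^T - A^T *m X) - (X^T *m A - X *m A) =
   (X^T - X^T *m A - A^T *m X^T) - (X - A^T *m X - X *m A).
  move: (A^T *m X^T) (X^T *m A) (A^T *m X) (X *m A) => p q r t.
  by apply/matrixP => i j; rewrite !mxE; ring.
by rewrite e subrr.
Qed.

End Noncritical.

Section Critical.
Variables (Q : 'M[R]_k) (N : 'cV[R]_k -> R) (a : R).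
Let P : 'M[R]_k := 1%:M - Q.
Hypotheses (a_half : 0 <= a < 2^-1) (hN : growth_norm A 2^-1 N).
Hypotheses (QA : Q *m A = A *m Q) (AP : A *m P = 2^-1 *: P).
Hypothesis N_Q : forall (h : R) v, 0 <= h <= 1 ->
  N (Q *m v + h *: (A *m (Q *m v))) <= (1 + a * h) * N (Q *m v).

Let N_ge v : `|v| <= N v. Proof. by case: hN. Qed.
Let N_ge0 v : 0 <= N v. Proof. by apply: le_trans (N_ge v). Qed.
Let half : (2^-1 : R) = 1 / 2. Proof. by rewrite div1r. Qed.

Let acc_P G n u v :
  bil (acc_cov G n) (P *m u) (P *m v) = crit_resp R n * bil G (P *m u) (P *m v).
Proof.
elim: n => [|n ih] /=; first by rewrite bil0 mul0r.
have BP (w : 'cV[R]_k) : back_mx n *m (P *m w) = (1 + 2^-1 / n.+1%:R) *: (P *m w).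
  rewrite back_mxE mulmxA AP -scalemxAl scalerA.
  by rewrite -{1}[P *m w]scale1r -scalerDl mulrC.
by rewrite bilD bil_conj !BP bilZl bilZr ih; ring.
Qed.

(* On one side the growth rate is 1/2, on the other a < 1/2: their mean is below
   1/2, which leaves the entries of order n. *)
Let acc_Q G : exists2 C, 0 <= C & forall u v,
  \forall n \near \oo, `|bil (acc_cov G n) u (Q *m v)| <= C * n%:R * (N u * N (Q *m v)).
Proof.
have [K K0 hK] := bil_bound G.
pose a' := (a + 1 / 2) / 2.
have /andP[a0 a1] := a_half; rewrite half in a1.
have ha' : 0 <= a' < 2^-1 by rewrite half /a'; apply/andP; split; lra.
have hs := clt_scale_linear ha'.
have main n u v : `|bil (acc_cov G n) u (Q *m v)| <=
    response a' 0 (fun=> K) n * (N u * N (Q *m v)).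
  elim: n u v => [|n ih] u v; first by rewrite /= bil0 normr0 mul0r.
  rewrite /= bilD bil_conj; apply: le_trans (ler_normD _ _) _.
  rewrite mulrDl; apply: lerD; last first.
    apply: le_trans (hK _ _) _; rewrite ler_wpM2l//; exact: ler_pM.
  have BQ : back_mx n *m (Q *m v) = Q *m (back_mx n *m v).
    by rewrite /back_mx !mulmxA mulmxDl mulmxDr mul1mx mulmx1 -scalemxAl -scalemxAr QA.
  rewrite BQ; apply: le_trans (ih _ _) _; rewrite -BQ.
  rewrite [leRHS]mulrAC mulrC ler_wpM2r//; first exact: response_ge0.
  have i01 : 0 <= (n.+1%:R^-1 : R) <= 1 by rewrite invr_ge0 ler0n/= invf_le1 ?ler1n.
  have h1 : N (back_mx n *m u) <= (1 + 2^-1 / n.+1%:R) * N u.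
    by rewrite back_mxE; case: hN => _ _; exact.
  have h2 : N (back_mx n *m (Q *m v)) <= (1 + a / n.+1%:R) * N (Q *m v).
    by rewrite back_mxE; exact: N_Q.
  apply: le_trans (ler_pM _ _ h1 h2) _ => //.
  rewrite mulrACA ler_wpM2r ?mulr_ge0// half /a'.
  have := sqr_ge0 (a - 1 / 2); move: i01; set i := n.+1%:R^-1 => /andP[i0 _] h.
  have := mulr_ge0 h (sqr_ge0 i); lra.
have [C C0 hC] := response_bounded hs (lexx 0) K0.
exists C => // u v; near=> n.
apply: le_trans (main _ _ _) _; rewrite ler_wpM2r ?mulr_ge0//.
by near: n.
Unshelve. all: by end_near. Qed.

(** On the range of P the matrix A is the scalar 1/2 and the recursion is that of
    [crit_resp], equivalent to n ln n; the terms that involve Q are of order n. *)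
Lemma critical_covariance G : G^T = G -> exists2 X, X^T = X &
  forall v e, 0 < e -> \forall n \near \oo,
  `|bil (acc_cov G n) v v - n%:R * ln n%:R * bil X v v| <= e * (n%:R * ln n%:R).
Proof.
move=> hG; exists (P^T *m G *m P); first by rewrite !trmx_mul trmxK hG mulmxA.
move=> v e e0.
have [C C0 hC] := acc_Q G.
pose g := bil G (P *m v) (P *m v).
pose W := C * (2 * (N (P *m v) * N (Q *m v)) + N (Q *m v) * N (Q *m v)).
have W0 : 0 <= W by rewrite mulr_ge0// addr_ge0// !mulr_ge0.
have g0 : 0 < 2 * (`|g| + 1) by have := normr_ge0 g; lra.
near=> n.
have h1 : `|crit_resp R n - n%:R * ln n%:R| <= e / (2 * (`|g| + 1)) * (n%:R * ln n%:R).
  by near: n; apply: crit_resp_equiv; exact: divr_gt0.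
have h2 : `|bil (acc_cov G n) (P *m v) (Q *m v)| <= C * n%:R * (N (P *m v) * N (Q *m v)).
  by near: n; exact: hC.
have h3 : `|bil (acc_cov G n) (Q *m v) (Q *m v)| <= C * n%:R * (N (Q *m v) * N (Q *m v)).
  by near: n; exact: hC.
have hl : 2 * W / e <= ln (n%:R : R) by near: n; exact: near_ln_ge.
have vE : v = P *m v + Q *m v by rewrite -mulmxDl subrK mul1mx.
have -> : bil (acc_cov G n) v v = crit_resp R n * g +
    2 * bil (acc_cov G n) (P *m v) (Q *m v) + bil (acc_cov G n) (Q *m v) (Q *m v).
  rewrite {1 2}vE bilDl !bilDr acc_P.
  have -> : bil (acc_cov G n) (Q *m v) (P *m v) = bil (acc_cov G n) (P *m v) (Q *m v).
    by rewrite -[in LHS](acc_cov_tr n hG) bil_tr.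
  by rewrite -/g; ring.
rewrite bil_conj -/g.
set L := n%:R * ln n%:R in h1 *.
set y := bil _ (P *m v) (Q *m v) in h2 *; set z := bil _ (Q *m v) (Q *m v) in h3 *.
have -> : crit_resp R n * g + 2 * y + z - L * g = (crit_resp R n - L) * g + 2 * y + z.
  by ring.
apply: le_trans (ler_normD _ _) _.
apply: le_trans (lerD (ler_normD _ _) (lexx _)) _.
rewrite !normrM (@ger0_norm _ 2)//.
have L0 : 0 <= L.
  apply: mulr_ge0 => //; apply: ln_ge0; rewrite ler1n.
  by near: n; exact: nbhs_infty_gt.
have k1 : `|crit_resp R n - L| * `|g| <= e / 2 * L.
  apply: le_trans (ler_wpM2r (normr_ge0 g) h1) _.
  have -> : e / (2 * (`|g| + 1)) * L * `|g| = (e / 2 * L) * (`|g| / (`|g| + 1)).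
    by field; have := normr_ge0 g; lra.
  rewrite ler_piMr//; first by rewrite mulr_ge0//; lra.
  by rewrite ler_pdivrMr ?mul1r ?lerDl//; have := normr_ge0 g; lra.
have k2 : W * n%:R <= e / 2 * L.
  rewrite ler_pdivrMr// in hl; have := ler_wpM2r (ler0n R n) hl; rewrite /L; lra.
rewrite /W in k2; lra.
Unshelve. all: by end_near. Qed.

End Critical.
End CovarianceRecursion.

(** * Approximation by trigonometric polynomials *)

Section TrigPolynomials.
Variables (R : realType) (k : nat).
Implicit Types (x : 'rV[R]_k) (u : 'cV[R]_k) (f g : 'rV[R]_k -> R).

Inductive trigpoly : ('rV[R]_k -> R) -> Prop :=
| trigpoly_cos u b : trigpoly (fun x => cos (dot x u + b))
| trigpolyD f g of trigpoly f & trigpoly g : trigpoly (fun x => f x + g x)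
| trigpolyZ t f of trigpoly f : trigpoly (fun x => t * f x).

Lemma eq_trigpoly f g : f =1 g -> trigpoly f -> trigpoly g.
Proof. by move=> /funext ->. Qed.

Lemma trigpoly_cst t : trigpoly (fun=> t).
Proof.
apply: (@eq_trigpoly (fun x => t * cos (dot x 0 + 0))).
  by move=> x; rewrite /dot mulmx0 mxE addr0 cos0 mulr1.
exact/trigpolyZ/trigpoly_cos.
Qed.

Lemma trigpolyM f g : trigpoly f -> trigpoly g -> trigpoly (fun x => f x * g x).
Proof.
move=> hf hg; elim: hf => [u b|f1 f2 _ h1 _ h2|t f1 _ h1].
- elim: hg => [v b'|g1 g2 _ h1 _ h2|t g1 _ h1].
  + apply: (@eq_trigpoly (fun x => 2^-1 * cos (dot x (u + v) + (b + b')) +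
        2^-1 * cos (dot x (u - v) + (b - b')))).
      move=> x; rewrite dotDr -scaleN1r dotDr dotZr mulN1r.
      have -> : dot x u + dot x v + (b + b') = (dot x u + b) + (dot x v + b') by ring.
      have -> : dot x u - dot x v + (b - b') = (dot x u + b) - (dot x v + b') by ring.
      by rewrite cosD cosB; field.
    by apply: trigpolyD; apply/trigpolyZ/trigpoly_cos.
  + apply: eq_trigpoly (trigpolyD h1 h2) => x; by rewrite mulrDr.
  + apply: eq_trigpoly (trigpolyZ t h1) => x; by rewrite mulrCA.
- by apply: eq_trigpoly (trigpolyD h1 h2) => x; rewrite mulrDl.
- by apply: eq_trigpoly (trigpolyZ t h1) => x; rewrite mulrA.
Qed.

Lemma trigpoly_sum (I : Type) (r : seq I) (F : I -> 'rV[R]_k -> R) :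
  (forall i, trigpoly (F i)) -> trigpoly (fun x => \sum_(i <- r) F i x).
Proof.
move=> h; elim: r => [|i r ih].
  by apply: eq_trigpoly (trigpoly_cst 0) => x; rewrite big_nil.
by apply: eq_trigpoly (trigpolyD (h i) ih) => x; rewrite big_cons.
Qed.

Lemma trigpoly_prod (I : Type) (r : seq I) (F : I -> 'rV[R]_k -> R) :
  (forall i, trigpoly (F i)) -> trigpoly (fun x => \prod_(i <- r) F i x).
Proof.
move=> h; elim: r => [|i r ih].
  by apply: eq_trigpoly (trigpoly_cst 1) => x; rewrite big_nil.
by apply: eq_trigpoly (trigpolyM (h i) ih) => x; rewrite big_cons.
Qed.

Lemma trigpoly_sin_coord (t : R) i : trigpoly (fun x => sin (t * x 0 i)).
Proof.
apply: eq_trigpoly (trigpoly_cos (t *: delta_mx i 0) (- (pi / 2))) => x.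
by rewrite dotZr dot_delta cosB cos_pihalf sin_pihalf mulr0 add0r mulr1.
Qed.

End TrigPolynomials.

Section Bernstein.
Variable R : realType.
Implicit Types (s a : R) (f : nat -> R).

(** Binomial probabilities, by conditioning on the first trial. The recursion
    replaces the closed formula and makes it clear that the weights are
    polynomials in s. *)
Fixpoint bweight n s m : R :=
  if n is n'.+1 then
    s * (if m is m'.+1 then bweight n' s m' else 0) + (1 - s) * bweight n' s m
  else (m == 0%N)%:R.

Lemma bweight_ge0 n s m : 0 <= s <= 1 -> 0 <= bweight n s m.
Proof.
move=> /andP[s0 s1]; elim: n m => [m|n ih [|m]] /=; first exact: ler0n.
  by rewrite mulr0 add0r mulr_ge0// subr_ge0.
by rewrite addr_ge0// mulr_ge0// subr_ge0.
Qed.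

Lemma bweight_out n s m : (n < m)%N -> bweight n s m = 0.
Proof.
elim: n m => [|n ih] [|m]//= h.
by rewrite !ih ?mulr0 ?addr0// ltnW.
Qed.

Definition bmean n s f := \sum_(m < n.+1) bweight n s m * f m.

Lemma bmeanS n s f :
  bmean n.+1 s f = s * bmean n s (fun m => f m.+1) + (1 - s) * bmean n s f.
Proof.
rewrite /bmean /=.
under eq_bigr => m _ do rewrite mulrDl.
rewrite big_split/=; congr (_ + _).
  rewrite big_ord_recl/= mulr0 mul0r add0r mulr_sumr.
  by apply: eq_bigr => m _; rewrite mulrA.
rewrite big_ord_recr/= bweight_out// mulr0 mul0r addr0 mulr_sumr.
by apply: eq_bigr => m _; rewrite mulrA.
Qed.

Lemma bmean1 n s : bmean n s (fun=> 1) = 1.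
Proof.
elim: n => [|n ih]; first by rewrite /bmean big_ord1 /= mulr1.
by rewrite bmeanS ih !mulr1 addrC subrK.
Qed.

(** Stated with a shift a for the sake of the induction; the case a = 0 is the
    variance of the binomial law. *)
Lemma bmean_sqr n s a :
  bmean n s (fun m => (a + m%:R - n%:R * s) ^+ 2) = a ^+ 2 + n%:R * (s * (1 - s)).
Proof.
elim: n a => [|n ih] a.
  by rewrite /bmean big_ord1 /= !mul0r subr0 !addr0 mul1r.
rewrite bmeanS.
have nE i : i.+1%:R = i%:R + 1 :> R by rewrite -[i.+1]addn1 natrD.
have -> : (fun m : nat => (a + m.+1%:R - n.+1%:R * s) ^+ 2) =
   (fun m => ((a + 1 - s) + m%:R - n%:R * s) ^+ 2).
  by apply/funext => m; rewrite !nE; congr (_ ^+ 2); ring.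
have -> : (fun m : nat => (a + m%:R - n.+1%:R * s) ^+ 2) =
   (fun m => ((a - s) + m%:R - n%:R * s) ^+ 2).
  by apply/funext => m; rewrite !nE; congr (_ ^+ 2); ring.
by rewrite !ih !nE; ring.
Qed.

Section Multivariate.
Variables (k n : nat) (s : 'I_k -> R).
Hypothesis s01 : forall i, 0 <= s i <= 1.

Definition mweight (m : {ffun 'I_k -> 'I_n.+1}) := \prod_i bweight n (s i) (m i).

Lemma mweight_ge0 m : 0 <= mweight m.
Proof. by apply: prodr_ge0 => i _; exact: bweight_ge0. Qed.

Lemma mweight_sum : \sum_m mweight m = 1.
Proof.
rewrite /mweight -(bigA_distr_bigA (fun i (m : 'I_n.+1) => bweight n (s i) m)).
rewrite big1// => i _; rewrite -[RHS](bmean1 n (s i)).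
by apply: eq_bigr => m _; rewrite mulr1.
Qed.

Lemma mweight_marginal i f : \sum_m mweight m * f (m i) = bmean n (s i) f.
Proof.
transitivity (\sum_(m : {ffun 'I_k -> 'I_n.+1}) \prod_j
    (bweight n (s j) (m j) * (if j == i then f (m j) else 1))).
  apply: eq_bigr => m _; rewrite big_split/=; congr (_ * _).
  by rewrite (bigD1 i)//= eqxx big1 ?mulr1// => j /negbTE ->.
rewrite -(bigA_distr_bigA (fun j (m : 'I_n.+1) =>
   bweight n (s j) m * (if j == i then f m else 1))).
rewrite (bigD1 i)//= eqxx [X in _ * X]big1 ?mulr1// => j /negbTE ->.
under eq_bigr do rewrite mulr1.
rewrite -[RHS](bmean1 n (s j)); apply: eq_bigr => m _; by rewrite mulr1.
Qed.

(** Chebyshev's argument of Bernstein: the mean square distance of the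
    counts to their expectation is at most n in each coordinate. *)
Lemma mweight_approx (F : {ffun 'I_k -> 'I_n.+1} -> R) (v e B : R) : 0 <= B ->
  (forall m, `|F m - v| <= e + B * \sum_i ((m i)%:R - n%:R * s i) ^+ 2) ->
  `|\sum_m mweight m * F m - v| <= e + B * (k%:R * n%:R).
Proof.
move=> B0 hF.
have -> : \sum_m mweight m * F m - v = \sum_m mweight m * (F m - v).
  under [RHS]eq_bigr do rewrite mulrBr.
  by rewrite sumrB -mulr_suml mweight_sum mul1r.
apply: le_trans (ler_norm_sum _ _ _) _.
apply: (@le_trans _ _ (\sum_m mweight m *
    (e + B * \sum_i ((m i)%:R - n%:R * s i) ^+ 2))).
  by apply: ler_sum => m _; rewrite normrM ger0_norm ?mweight_ge0// ler_wpM2l ?mweight_ge0.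
under eq_bigr do rewrite mulrDr mulrCA mulr_sumr.
rewrite big_split/= -mulr_suml mweight_sum mul1r lerD2l -mulr_sumr ler_wpM2l//.
rewrite exchange_big/=.
have -> : k%:R * n%:R = \sum_(i < k) n%:R :> R.
  by rewrite sumr_const card_ord -[RHS]mulr_natl.
apply: ler_sum => i _.
rewrite (mweight_marginal i (fun m => (m%:R - n%:R * s i) ^+ 2)).
have := bmean_sqr n (s i) 0.
have -> : (fun m : nat => (0 + m%:R - n%:R * s i) ^+ 2) =
  (fun m => (m%:R - n%:R * s i) ^+ 2) by apply/funext => m; rewrite add0r.
move=> ->; rewrite expr0n/= add0r ler_piMr//.
have := s01 i; nra.
Qed.

End Multivariate.
End Bernstein.

Section SinInverse.
Variable R : realType.

(** Since a stays in a smaller interval than b, both (a - b)/2 and (a + b)/2 stay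
    away from pi/2, which bounds below each factor of
    sin a - sin b = 2 sin((a - b)/2) cos((a + b)/2). *)
Lemma sin_separates : exists2 c : R, 0 < c & forall a b : R,
  `|a| <= 2^-1 -> `|b| <= pi / 2 -> c * `|a - b| <= `|sin a - sin b|.
Proof.
pose t0 : R := (2^-1 + pi / 2) / 2.
have p2 : 2 <= pi :> R by exact: pi_ge2.
have half : (2^-1 : R) = 1 / 2 by rewrite div1r.
have t0_gt0 : 0 < t0 by rewrite /t0 half; lra.
have t0_lt : t0 < pi / 2 by rewrite /t0 half; lra.
pose c0 := cos t0.
have c0_gt0 : 0 < c0 by apply: cos_gt0_pihalf; apply/andP; split; lra.
have cos_ge (t : R) : `|t| <= t0 -> c0 <= cos t.
  move=> ht; have -> : cos t = cos `|t|.
    by have [_|_] := ger0P t; rewrite ?cosN.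
  rewrite /c0 leNgt; apply/negP => h.
  have t1 : `|t| \in `[0, pi] by rewrite in_itv/= normr_ge0/=; lra.
  have t2 : t0 \in `[0, pi] by rewrite in_itv/=; apply/andP; split; lra.
  by move: h; rewrite ltr_cos// ltNge ht.
have sin_ge (t : R) : `|t| <= t0 -> c0 * `|t| <= `|sin t|.
  wlog tp : t / 0 <= t.
    move=> h ht; have [/h/(_ ht)//|/ltW tn] := leP 0 t.
    have := h (- t); rewrite sinN !normrN; apply => //.
    by rewrite oppr_ge0.
  move=> ht.
  have [x] := @MVT_segment R sin cos 0 t tp
    (fun x _ => is_derive_sin x) (continuous_subspaceT (@continuous_sin R)).
  rewrite in_itv/= => /andP[x0 xt]; rewrite sin0 !subr0 => ->.
  rewrite normrM ler_wpM2r//; apply: le_trans (ler_norm _); apply: cos_ge.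
  by rewrite ger0_norm//; apply: le_trans xt _; rewrite -[leLHS]ger0_norm.
exists (c0 ^+ 2); first by rewrite exprn_gt0.
move=> a b ha hb.
have -> : sin a - sin b = 2 * (sin ((a - b) / 2) * cos ((a + b) / 2)).
  set h := (a - b) / 2; set m := (a + b) / 2.
  have -> : a = m + h by rewrite /m /h; field.
  have -> : b = m - h by rewrite /m /h; field.
  by rewrite sinD sinB; ring.
have h1 : `|(a - b) / 2| <= t0.
  rewrite normrM (@ger0_norm _ 2^-1) ?invr_ge0// /t0 ler_wpM2r ?invr_ge0//.
  by apply: le_trans (ler_normB _ _) _; exact: lerD.
have h2 : `|(a + b) / 2| <= t0.
  rewrite normrM (@ger0_norm _ 2^-1) ?invr_ge0// /t0 ler_wpM2r ?invr_ge0//.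
  by apply: le_trans (ler_normD _ _) _; exact: lerD.
rewrite !normrM (@ger0_norm _ 2)//.
have k1 := sin_ge _ h1.
have k2 : c0 <= `|cos ((a + b) / 2)| by apply: le_trans (cos_ge _ h2) (ler_norm _).
have k3 : 0 <= c0 * `|(a - b) / 2| by rewrite mulr_ge0// ltW.
have := ler_pM k3 (ltW c0_gt0) k1 k2.
rewrite [`|(a - b) / 2|]normrM (@ger0_norm _ 2^-1) ?invr_ge0// half.
lra.
Qed.

End SinInverse.

Section TrigApproximation.
Variables (R : realType) (k : nat).
Implicit Types (f : 'rV[R]_k -> R).

Lemma heine_box f (L e : R) : continuous f -> 0 < e ->
  exists2 d : R, 0 < d & forall x y : 'rV[R]_k,
  (forall i, `|x 0 i| <= L) -> (forall i, `|x 0 i - y 0 i| < d) -> `|f x - f y| < e.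
Proof.
move=> cf e0.
pose K := [set x : 'rV[R]_k | forall i, (x 0 i) \in `[(- L), L]].
have cK : compact K.
  apply: (@rV_compact R k (fun=> `[(- L), L]%classic)) => i; exact: segment_compact.
have nc := (iffLR (compact_near_coveringP K)) cK.
have := nc R (0^'+) (fun d x => forall y : 'rV[R]_k, ball x d y -> `|f x - f y| < e) _ _.
move=> /(_ _) H.
have {}H : \forall d \near 0^'+, K `<=` (fun x => forall y : 'rV[R]_k, ball x d y -> `|f x - f y| < e).
  apply: H => x Kx.
  have := cf x => /cvgrPdist_lt /(_ (e / 2)).
  have e2 : 0 < e / 2 by lra.
  move=> /(_ e2) /nbhs_ballP[r /= r0 hr].
  exists (ball x (r / 2), [set d : R | d < r / 2]).
    split; first by apply: nbhsx_ballx; lra.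
    by apply: nbhs_right_lt; lra.
  move=> [x' d] [/= hx' hd] y hy.
  have h1 := hr x' (@le_ball _ _ x (r / 2) r _ x' hx').
  have h2 : `|f x - f y| < e / 2.
    apply: hr; have -> : r = r / 2 + r / 2 by field.
    apply: ball_triangle hx' _; apply: le_ball hy; exact: ltW.
  have {}h1 : `|f x - f x'| < e / 2 by apply: h1; lra.
  have -> : f x' - f y = (f x - f y) - (f x - f x') by ring.
  by apply: le_lt_trans (ler_normB _ _) _; lra.
have [d [d0 hd]] : exists d : R, 0 < d /\ K `<=` (fun x => forall y : 'rV[R]_k, ball x d y -> `|f x - f y| < e).
  have h0 : \forall d \near (0 : R)^'+, 0 < d by exact: nbhs_right_gt.
  have [d [d0 hd]] := filter_ex (filterI h0 H).
  by exists d.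
exists d => // x y hx hxy; apply: hd.
  by move=> i; rewrite in_itv/= -ler_norml.
by split=> // i j; rewrite ord1; exact: hxy.
Qed.

(** Bernstein approximation in the parameters s_i = (1 + sin(x_i / M)) / 2, with
    nodes the points whose parameters are multiples of 1/n. The weights are
    nonnegative and sum to 1 for every x, which gives the global bound B. With
    M = 2 L the angles x_i / M of the box lie in [-1/2, 1/2], so that
    [sin_separates] makes nodes far from x also far in parameter. *)
Theorem trigpoly_approx f (B L e : R) : continuous f ->
  (forall x, `|f x| <= B) -> 0 < L -> 0 < e -> exists2 h, trigpoly h &
  (forall x : 'rV[R]_k, `|h x| <= B) /\
  (forall x : 'rV[R]_k, (forall i, `|x 0 i| <= L) -> `|h x - f x| <= e).
Proof.
move=> cf fB L0 e0.
have half : (2^-1 : R) = 1 / 2 by rewrite div1r.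
have B0 : 0 <= B by apply: le_trans (fB 0).
have e2 : 0 < e / 2 by lra.
have [d d0 hd] := heine_box L cf e2.
have [c c0 hc] := sin_separates R.
pose M := 2 * L.
have M0 : 0 < M by rewrite /M; lra.
pose s (x : 'rV[R]_k) i := (1 + sin (M^-1 * x 0 i)) / 2.
have s01 x i : 0 <= s x i <= 1.
  have := sin_geN1 (M^-1 * x 0 i); have := sin_le1 (M^-1 * x 0 i).
  by rewrite /s => h1 h2; apply/andP; split; lra.
(* two points at distance d have parameters at distance at least g *)
pose g := c * (d / M) / 2.
have g0 : 0 < g by rewrite /g divr_gt0// mulr_gt0// divr_gt0.
pose C := 2 * B / g ^+ 2.
have C0 : 0 <= C by rewrite /C divr_ge0 ?sqr_ge0// mulr_ge0.
have [n hn] : exists n, 2 * C * k%:R / e + 1 <= n%:R :> R.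
  exact: filter_ex (nbhs_infty_ger _).
have n0 : 0 < n%:R :> R.
  apply: lt_le_trans hn; apply: ltr_wpDl => //.
  apply: divr_ge0 (ltW e0); apply: mulr_ge0 => //; exact: (mulr_ge0 _ C0).
pose pt (m : {ffun 'I_k -> 'I_n.+1}) : 'rV[R]_k :=
  \row_i (M * asin (2 * ((m i)%:R / n%:R) - 1)).
have frac (m : 'I_n.+1) : -1 <= 2 * (m%:R / (n%:R : R)) - 1 <= 1.
  have h1 : 0 <= m%:R / n%:R :> R by rewrite divr_ge0.
  have h2 : m%:R / n%:R <= 1 :> R by rewrite ler_pdivrMr// mul1r ler_nat -ltnS.
  by apply/andP; split; lra.
pose h x := \sum_m mweight (s x) m * f (pt m).
exists h.
  apply: trigpoly_sum => m.
  apply: trigpolyM; last exact: trigpoly_cst.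
  apply: trigpoly_prod => i.
  have ts : trigpoly (fun x => s x i).
    apply: eq_trigpoly (trigpolyZ 2^-1 (trigpolyD (trigpoly_cst _ 1)
       (trigpoly_sin_coord M^-1 i))) => x.
    by rewrite /s mulrC.
  have ts' : trigpoly (fun x => 1 - s x i).
    by apply: eq_trigpoly (trigpolyD (trigpoly_cst _ 1) (trigpolyZ (-1) ts)) => x; rewrite mulN1r.
  elim: (n) (nat_of_ord (m i)) => [j|n' ih [|j]] /=; first exact: trigpoly_cst.
    exact: trigpolyD (trigpolyM ts (trigpoly_cst _ _)) (trigpolyM ts' (ih _)).
  exact: trigpolyD (trigpolyM ts (ih _)) (trigpolyM ts' (ih _)).
split=> x.
  apply: le_trans (ler_norm_sum _ _ _) _.
  rewrite -[leRHS]mul1r -(mweight_sum n (s x)) mulr_suml.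
  apply: ler_sum => m _; rewrite normrM ger0_norm ?(mweight_ge0 (s01 x))//.
  by rewrite ler_wpM2l// (mweight_ge0 (s01 x)).
move=> hx.
have := @mweight_approx R k n (s x) (s01 x) (fun m => f (pt m)) (f x) (e / 2) (C / n%:R ^+ 2).
have Cn : 0 <= C / n%:R ^+ 2 by rewrite divr_ge0// sqr_ge0.
move=> /(_ Cn) H; apply: le_trans (H _) _; last first.
  have -> : C / n%:R ^+ 2 * (k%:R * n%:R) = C * k%:R / n%:R by field; rewrite gt_eqF.
  have : C * k%:R / n%:R <= e / 2.
    rewrite ler_pdivrMr//.
    have h1 : 2 * C * k%:R / e <= n%:R by lra.
    by rewrite ler_pdivrMr// in h1; lra.
  lra.
move=> m {H}.
have [near_x|] := boolP [forall i, `|x 0 i - pt m 0 i| < d].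
  apply: ltW; rewrite distrC.
  apply: lt_le_trans (hd _ _ hx (fun i => forallP near_x i)) _.
  rewrite lerDl mulr_ge0//; apply: sumr_ge0 => i _; exact: sqr_ge0.
rewrite negb_forall => /existsP[i]; rewrite -leNgt => far.
apply: (@le_trans _ _ (2 * B)).
  by apply: le_trans (ler_normB _ _) _; have := fB (pt m); have := fB x; lra.
have key : g <= `|(m i)%:R / n%:R - s x i|.
  have a1 : `|M^-1 * x 0 i| <= 2^-1.
    rewrite normrM ger0_norm ?invr_ge0 ?(ltW M0)// ler_pdivrMl//.
    by have := hx i; rewrite /M half; lra.
  pose bb := asin (2 * ((m i)%:R / n%:R) - 1 : R).
  have b1 : `|bb| <= pi / 2.
    by rewrite ler_norml asin_geNpi2 ?asin_lepi2.
  have sb : sin bb = 2 * ((m i)%:R / n%:R) - 1.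
    by apply: asinK; rewrite in_itv/=.
  have := hc _ _ a1 b1; rewrite sb.
  have -> : sin (M^-1 * x 0 i) - (2 * ((m i)%:R / n%:R) - 1) =
    - (2 * ((m i)%:R / n%:R - s x i)) by rewrite /s; field; rewrite gt_eqF.
  rewrite normrN normrM (@ger0_norm _ 2)//.
  have ptE : pt m 0 i = M * bb by rewrite mxE.
  have -> : M^-1 * x 0 i - bb = M^-1 * (x 0 i - pt m 0 i).
    by rewrite ptE; field; rewrite gt_eqF.
  rewrite normrM (@ger0_norm _ M^-1) ?invr_ge0 ?(ltW M0)//.
  have dM : d / M <= M^-1 * `|x 0 i - pt m 0 i|.
    by rewrite mulrC ler_wpM2l// invr_ge0 ltW.
  have := ler_wpM2l (ltW c0) dM; rewrite /g; lra.
have key2 : (n%:R * g) ^+ 2 <= ((m i)%:R - n%:R * s x i) ^+ 2.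
  rewrite -[leRHS]real_normK ?num_real// lerXn2r ?nnegrE//; first exact: mulr_ge0 (ltW g0).
  have -> : (m i)%:R - n%:R * s x i = n%:R * ((m i)%:R / n%:R - s x i).
    by field; rewrite gt_eqF.
  by rewrite normrM (@ger0_norm _ n%:R)// ler_wpM2l.
have : C / n%:R ^+ 2 * (n%:R * g) ^+ 2 <=
   C / n%:R ^+ 2 * \sum_j ((m j)%:R - n%:R * s x j) ^+ 2.
  rewrite ler_wpM2l//; apply: le_trans key2 _.
  by rewrite (bigD1 i)//= lerDl; apply: sumr_ge0 => j _; exact: sqr_ge0.
have -> : C / n%:R ^+ 2 * (n%:R * g) ^+ 2 = 2 * B.
  by rewrite /C; field; rewrite !gt_eqF.
by move/le_trans; apply; rewrite lerDr ltW.
Qed.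

End TrigApproximation.

(** * Weak convergence from characteristic functions *)

Section WeakConvergence.
Variables (R : realType) (k : nat).
Implicit Types (f g : 'rV[R]_k -> R).

Definition bounded_continuous f := continuous f /\ exists B, forall x, `|f x| <= B.

(** Expectations with respect to probability laws, reduced to the properties used
    to pass from trigonometric polynomials to bounded continuous functions. *)
Record mean_functional (E : ('rV[R]_k -> R) -> R) : Prop := MeanFunctional {
  meanD : forall f g, bounded_continuous f -> bounded_continuous g ->
    E (fun x => f x + g x) = E f + E g ;
  meanZ : forall t f, bounded_continuous f -> E (fun x => t * f x) = t * E f ;
  mean_le : forall f g, bounded_continuous f -> bounded_continuous g ->
    (forall x, f x <= g x) -> E f <= E g ;
  mean1 : E (fun=> 1) = 1 }.

(** A continuous bound for the indicator of |x_i| > L. *)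
Definition tail (L : R) i (x : 'rV[R]_k) : R := Num.min 1 ((x 0 i / L) ^+ 2).

Lemma bounded_continuous_cst t : bounded_continuous (fun=> t).
Proof. by split; [exact: cst_continuous | exists `|t|]. Qed.

Lemma bounded_continuousD f g : bounded_continuous f -> bounded_continuous g ->
  bounded_continuous (fun x => f x + g x).
Proof.
move=> [cf [B hB]] [cg [C hC]]; split; first by move=> x; apply: continuousD; [exact: cf|exact: cg].
by exists (B + C) => x; apply: le_trans (ler_normD _ _) _; exact: lerD.
Qed.

Lemma bounded_continuousZ t f : bounded_continuous f ->
  bounded_continuous (fun x => t * f x).
Proof.
move=> [cf [B hB]]; split; first by move=> x; apply: continuousM; [exact: cst_continuous|exact: cf].
by exists (`|t| * B) => x; rewrite normrM ler_wpM2l.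
Qed.

Lemma continuous_dot (u : 'cV[R]_k) : continuous (fun x : 'rV[R]_k => dot x u).
Proof.
have -> : (fun x : 'rV[R]_k => dot x u) = (fun x => \sum_j x 0 j * u j 0).
  by apply/funext => x; rewrite dotE.
elim: (index_enum _) => [|j r ih].
  rewrite (_ : (fun _ => _) = fun=> 0); first exact: cst_continuous.
  by apply/funext => x; rewrite big_nil.
rewrite (_ : (fun _ => _) = fun x : 'rV[R]_k => x 0 j * u j 0 + \sum_(i <- r) x 0 i * u i 0).
  have h1 : continuous (fun x : 'rV[R]_k => x 0 j * u j 0).
    by move=> x; apply: continuousM; [exact: coord_continuous | exact: cst_continuous].
  by move=> x; exact: (continuousD (h1 x) (ih x)).
by apply/funext => x; rewrite big_cons.
Qed.

Lemma bounded_continuous_cos u b :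
  bounded_continuous (fun x : 'rV[R]_k => cos (dot x u + b)).
Proof.
split; last by exists 1 => x; rewrite ler_norml cos_geN1 cos_le1.
move=> x; apply: (@continuous_comp _ _ _ (fun x : 'rV[R]_k => dot x u + b) cos).
  by apply: continuousD; [exact: continuous_dot | exact: cst_continuous].
exact: continuous_cos.
Qed.

Lemma bounded_continuous_norm f : bounded_continuous f ->
  bounded_continuous (fun x => `|f x|).
Proof.
move=> [cf [B hB]]; split; last by exists B => x; rewrite normr_id.
by move=> x; exact: (cvg_norm (cf x)).
Qed.

Lemma bounded_continuous_tail L i : bounded_continuous (tail L i).
Proof.
split; last first.
  exists 1 => x; rewrite /tail ger0_norm; first by rewrite ge_min lexx.
  by rewrite le_min ler01 sqr_ge0.
move=> x; rewrite /tail.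
have -> : (fun x : 'rV[R]_k => Num.min 1 ((x 0 i / L) ^+ 2)) =
   (fun=> 1) \min (fun x : 'rV[R]_k => (x 0 i / L) ^+ 2) by apply/funext.
apply: continuous_min; first exact: cst_continuous.
apply: (@continuous_comp _ _ _ (fun x : 'rV[R]_k => x 0 i / L) (fun y => y ^+ 2)).
  by apply: continuousM; [exact: coord_continuous | exact: cst_continuous].
exact: sqr_continuous.
Qed.

Lemma trigpoly_bounded_continuous h : trigpoly h -> bounded_continuous h.
Proof.
elim=> [u b|f g _ hf _ hg|t f _ hf]; first exact: bounded_continuous_cos.
  exact: bounded_continuousD.
exact: bounded_continuousZ.
Qed.

Lemma bounded_continuous_sum (I : Type) (r : seq I) (F : I -> 'rV[R]_k -> R) :
  (forall i, bounded_continuous (F i)) ->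
  bounded_continuous (fun x => \sum_(i <- r) F i x).
Proof.
move=> h; elim: r => [|i r ih].
  rewrite (_ : (fun _ => _) = (fun=> 0)); first exact: bounded_continuous_cst.
  by apply/funext => x; rewrite big_nil.
rewrite (_ : (fun _ => _) = (fun x => F i x + \sum_(j <- r) F j x)).
  exact: bounded_continuousD.
by apply/funext => x; rewrite big_cons.
Qed.

Section MeanFunctional.
Variable E : ('rV[R]_k -> R) -> R.
Hypothesis hE : mean_functional E.

Lemma mean_cst t : E (fun=> t) = t.
Proof.
have := meanZ hE t (bounded_continuous_cst 1); rewrite (mean1 hE) mulr1 => {2}<-.
by congr E; apply/funext => x; rewrite mulr1.
Qed.

Lemma meanB f g : bounded_continuous f -> bounded_continuous g ->
  E (fun x => f x - g x) = E f - E g.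
Proof.
move=> hf hg; rewrite -mulN1r -(meanZ hE)// -(meanD hE)//; last first.
  exact: bounded_continuousZ.
by congr E; apply/funext => x; rewrite mulN1r.
Qed.

Lemma mean_sum (I : Type) (r : seq I) (F : I -> 'rV[R]_k -> R) :
  (forall i, bounded_continuous (F i)) ->
  E (fun x => \sum_(i <- r) F i x) = \sum_(i <- r) E (F i).
Proof.
move=> h; elim: r => [|i r ih].
  rewrite big_nil -[RHS](mean_cst 0); congr E; apply/funext => x; exact: big_nil.
rewrite big_cons -ih -(meanD hE)//; last exact: bounded_continuous_sum.
by congr E; apply/funext => x; exact: big_cons.
Qed.

Lemma mean_norm f : bounded_continuous f -> `|E f| <= E (fun x => `|f x|).
Proof.
move=> hf; have hn := bounded_continuous_norm hf.
rewrite ler_norml; apply/andP; split; last first.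
  by apply: (mean_le hE) => // x; exact: ler_norm.
rewrite lerNl -mulN1r -(meanZ hE)//; apply: (mean_le hE) => // [|x].
  exact: bounded_continuousZ.
by rewrite mulN1r -normrN ler_norm.
Qed.

(** Inside the box f and h are e-close; outside, their difference is at most 2 B
    and some tail function is equal to 1. *)
Lemma mean_approx f h (B L e d : R) : bounded_continuous f -> trigpoly h ->
  0 < L -> 0 <= e -> (forall x, `|f x| <= B) -> (forall x, `|h x| <= B) ->
  (forall x : 'rV[R]_k, (forall i, `|x 0 i| <= L) -> `|h x - f x| <= e) ->
  (forall i, E (tail L i) <= d) ->
  `|E h - E f| <= e + 2 * B * (k%:R * d).
Proof.
move=> hf /trigpoly_bounded_continuous hh L0 e0 fB hB hL ht.
have B0 : 0 <= B by apply: le_trans (fB 0).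
rewrite -meanB//.
have hBN : bounded_continuous (fun x => h x - f x).
  rewrite (_ : (fun _ => _) = (fun x => h x + (-1) * f x)).
    by apply: bounded_continuousD => //; exact: bounded_continuousZ.
  by apply/funext => x; rewrite mulN1r.
apply: le_trans (mean_norm hBN) _.
have hts := bounded_continuous_sum (index_enum 'I_k) (fun i => bounded_continuous_tail L i).
have hR : bounded_continuous (fun x => e + 2 * B * \sum_i tail L i x).
  apply: bounded_continuousD; first exact: bounded_continuous_cst.
  exact: bounded_continuousZ.
apply: (@le_trans _ _ (E (fun x => e + 2 * B * \sum_i tail L i x))).
  apply: (mean_le hE) => // [|x]; first exact: bounded_continuous_norm.
  have tail_ge0 i : 0 <= tail L i x by rewrite le_min ler01 sqr_ge0.
  have [box|] := boolP [forall i, `|x 0 i| <= L].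
    apply: le_trans (hL x (fun i => forallP box i)) _.
    by rewrite lerDl !mulr_ge0//; exact: sumr_ge0.
  rewrite negb_forall => /existsP[i]; rewrite -ltNge => xi.
  have t1 : tail L i x = 1.
    rewrite /tail; apply/min_idPl; rewrite -real_normK ?num_real// normrM.
    rewrite -[leLHS](expr1n _ 2) lerXn2r ?nnegrE ?mulr_ge0//.
    by rewrite (@ger0_norm _ L^-1) ?invr_ge0 ?(ltW L0)// ler_pdivlMr// mul1r ltW.
  apply: (@le_trans _ _ (2 * B)).
    by apply: le_trans (ler_normB _ _) _; have := fB x; have := hB x; lra.
  have : 1 <= \sum_j tail L j x by rewrite (bigD1 i)//= t1 lerDl sumr_ge0.
  nra.
rewrite (meanD hE)//; [|exact: bounded_continuous_cst|exact: bounded_continuousZ].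
rewrite mean_cst (meanZ hE)// mean_sum//; last by move=> i; exact: bounded_continuous_tail.
rewrite lerD2l ler_wpM2l ?mulr_ge0//.
have -> : k%:R * d = \sum_(i < k) d by rewrite sumr_const card_ord mulr_natl.
exact: ler_sum.
Qed.

End MeanFunctional.

Theorem weak_convergence (En : nat -> ('rV[R]_k -> R) -> R) E :
  (forall n, mean_functional (En n)) -> mean_functional E ->
  (forall u b d, 0 < d -> \forall n \near \oo,
    `|En n (fun x => cos (dot x u + b)) - E (fun x => cos (dot x u + b))| <= d) ->
  (forall i d, 0 < d -> exists2 L0, 0 < L0 & forall L, L0 <= L ->
     E (tail L i) <= d /\ \forall n \near \oo, En n (tail L i) <= d) ->
  forall f, bounded_continuous f -> forall d, 0 < d ->
  \forall n \near \oo, `|En n f - E f| <= d.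
Proof.
move=> hEn hE hcos htail f hf d d0.
have [cf [B hB]] := hf.
have B0 : 0 <= B by apply: le_trans (hB 0).
have htrig h : trigpoly h -> forall d, 0 < d ->
    \forall n \near \oo, `|En n h - E h| <= d.
  elim=> {d d0} [u b|f1 f2 t1 h1 t2 h2|t f1 t1 h1] d d0; first exact: hcos.
    have b1 := trigpoly_bounded_continuous t1; have b2 := trigpoly_bounded_continuous t2.
    have d2 : 0 < d / 2 by lra.
    near=> n; rewrite (meanD (hEn n))// (meanD hE)// opprD addrACA.
    have k1 : `|En n f1 - E f1| <= d / 2 by near: n; exact: h1.
    have k2 : `|En n f2 - E f2| <= d / 2 by near: n; exact: h2.
    by apply: le_trans (ler_normD _ _) _; lra.
  have b1 := trigpoly_bounded_continuous t1.
  have d2 : 0 < d / (`|t| + 1) by rewrite divr_gt0// ltr_wpDl.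
  near=> n; rewrite (meanZ (hEn n))// (meanZ hE)// -mulrBr normrM.
  have k1 : `|En n f1 - E f1| <= d / (`|t| + 1) by near: n; exact: h1.
  apply: le_trans (ler_wpM2l (normr_ge0 t) k1) _.
  rewrite mulrCA ler_piMr ?(ltW d0)// ler_pdivrMr ?mul1r ?lerDl// ltr_wpDl//.
pose e := d / 5; have e0 : 0 < e by rewrite /e; lra.
pose dt := e / (2 * B * k%:R + 1).
have W0 : 0 < 2 * B * k%:R + 1 by rewrite ltr_wpDl// !mulr_ge0.
have dt0 : 0 < dt by exact: divr_gt0.
have hdt : 2 * B * (k%:R * dt) <= e.
  have -> : 2 * B * (k%:R * dt) = e * (2 * B * k%:R / (2 * B * k%:R + 1)).
    by rewrite /dt; field; rewrite gt_eqF.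
  by rewrite ler_piMr ?(ltW e0)// ler_pdivrMr// mul1r lerDl.
have [L L0 hL] : exists2 L, 0 < L & forall i, E (tail L i) <= dt /\
    \forall n \near \oo, En n (tail L i) <= dt.
  have [F hF] := choice (fun i => let: ex_intro2 L h1 h2 := htail i dt dt0 in
    ex_intro (fun L => 0 < L /\ forall L', L <= L' -> E (tail L' i) <= dt /\
      \forall n \near \oo, En n (tail L' i) <= dt) L (conj h1 h2)).
  exists (1 + \sum_i F i).
    by rewrite ltr_wpDr// sumr_ge0// => i _; apply/ltW; case: (hF i).
  move=> i; have [_ h] := hF i; apply: h.
  rewrite (bigD1 i)//= addrCA lerDl addr_ge0// sumr_ge0// => j _.
  by apply/ltW; case: (hF j).
have [h th [hB' happ]] := trigpoly_approx cf hB L0 e0.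
have hEf := mean_approx hE hf th L0 (ltW e0) hB hB' happ (fun i => (hL i).1).
have tl : \forall n \near \oo, forall i, En n (tail L i) <= dt.
  by apply: filter_forall => i; case: (hL i).
near=> n.
have k1 : `|En n h - E h| <= e by near: n; exact: htrig.
have k2 : `|En n h - En n f| <= e + 2 * B * (k%:R * dt).
  apply: (mean_approx (hEn n) hf th L0 (ltW e0) hB hB' happ).
  by near: n.
have -> : En n f - E f = - (En n h - En n f) + (En n h - E h) + (E h - E f) by ring.
apply: le_trans (ler_normD _ _) _.
apply: le_trans (lerD (ler_normD _ _) (lexx _)) _; rewrite normrN.
rewrite /e in k1 k2 hEf hdt *; lra.
Unshelve. all: by end_near. Qed.

End WeakConvergence.

(** * The law of the urn process *)

Lemma integral_finite_range (d : measure_display) (T : measurableType d)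
    (R : realType) (P : probability T R) (V : eqType) (s : seq V) (X : T -> V)
    (g : V -> R) :
  uniq s -> (forall w, X w \in s) -> (forall x, measurable (X @^-1` [set x])) ->
  (\int[P]_w (g (X w))%:E)%E =
    (\sum_(x <- s) g x * fine (P (X @^-1` [set x])))%:E.
Proof.
move=> us hX mX.
have gE w : g (X w) = \sum_(x <- s) g x * \1_(X @^-1` [set x]) w.
  rewrite (bigD1_seq (X w))//= indicE mem_set// mulr1.
  rewrite big1 ?addr0// => x xX; rewrite indicE memNset ?mulr0//.
  by move=> /= /esym/eqP; apply/negP.
transitivity (\int[P]_w (\sum_(x <- s) (g x * \1_(X @^-1` [set x]) w)%:E))%E.
  by apply: eq_integral => w _; rewrite gE sumEFin.
rewrite integral_sum//=; last first.
  move=> x; apply: measurable_bounded_integrable => //.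
  - exact: le_lt_trans (probability_le1 _ _) (ltry 1).
  - by apply: measurable_funM => //; exact: measurable_indic.
  - exists `|g x|; split => // M hM w _ /=.
    rewrite normrM indicE; case: (_ \in _); rewrite ?normr0 ?normr1 ?mulr0 ?mulr1.
      exact: ltW.
    by apply: le_trans (ltW hM).
rewrite -sumEFin; apply: eq_bigr => x _.
rewrite (eq_integral (fun w => (g x)%:E * (\1_(X @^-1` [set x]) w)%:E)%E)//.
rewrite integralZl//=; last exact: integrable_indic.
by rewrite integral_indic// setIT EFinM fineK// fin_num_measure.
Qed.

Section UrnLaw.
Variables (d : measure_display) (T : measurableType d) (R : realType).
Variables (P : probability T R) (k : nat) (theta : R) (Rep : 'M[R]_k).
Variables (U0 : 'rV[R]_k) (U : nat -> T -> 'rV[R]_k) (Z : nat -> T -> 'I_k).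
Hypothesis hU : negative_urn P theta Rep U0 U Z.

Fixpoint urn_range n : seq 'rV[R]_k :=
  if n is n'.+1 then [seq x + row j Rep | x <- urn_range n', j <- enum 'I_k]
  else [:: U0].

Let U_succ n w : U n.+1 w = U n w + row (Z n w) Rep.
Proof.
rewrite (urn_step hU) rowE; congr (_ + _ *m _).
by apply/rowP => j; rewrite !mxE eqxx eq_sym.
Qed.

Let U_range n w : U n w \in urn_range n.
Proof.
elim: n => [|n ih]; first by rewrite (urn_init hU) inE.
by rewrite U_succ; apply/allpairsP; exists (U n w, Z n w); rewrite /= ih mem_enum.
Qed.

Let measurable_preU n (A : set 'rV[R]_k) : measurable (U n @^-1` A).
Proof.
elim: n A => [|n ih] A.
  have [AU|AU] := pselect (A U0).
    rewrite (_ : _ @^-1` _ = setT)//; apply/seteqP; split=> w //= _.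
    by rewrite (urn_init hU).
  rewrite (_ : _ @^-1` _ = set0)//; apply/seteqP; split=> w //=.
  by rewrite (urn_init hU).
rewrite (_ : _ @^-1` _ = \big[setU/set0]_(j < k)
   ((Z n @^-1` [set j]) `&` (U n @^-1` [set x | A (x + row j Rep)]))).
  apply: bigsetU_measurable => j _; apply: measurableI; last exact: ih.
  exact: (urn_measurable_draw hU).
apply/seteqP; split=> w /=.
  rewrite U_succ => Aw; rewrite -bigcup_seq/=.
  by exists (Z n w) => //; rewrite /= mem_index_enum.
rewrite -bigcup_seq => -[j _ [/= <-]]; by rewrite U_succ.
Qed.

Let filtration_atom n x : natural_filtration U n (U n @^-1` [set x]).
Proof.
apply: sub_sigma_algebra; exists n => //=.
exists [set x]; last by rewrite setTI.
rewrite -[X in <<s _ >> X]setCK -setTD.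
apply: sigma_algebraCD; apply: sub_sigma_algebra.
apply: closed_openC; apply: accessible_closed_set1; apply: hausdorff_accessible; exact: norm_hausdorff.
Qed.

(* The conditional probability of a draw is a function of U_n, hence constant on
   the event U_n = x, which belongs to the past. *)
Let draw_atom n x j : fine (P (U n @^-1` [set x] `&` Z n @^-1` [set j])) =
  draw_prob theta n x j * fine (P (U n @^-1` [set x])).
Proof.
have [_ _ /(_ _ (@filtration_atom n x)) <-] := urn_draw hU n j.
rewrite (eq_integral (fun=> (draw_prob theta n x j)%:E)); last first.
  by move=> w; rewrite inE/= => ->.
by rewrite integral_cst// fineM// fin_num_measure.
Qed.

(** One draw multiplies the probability of each value of U_n by the draw
    probabilities ([draw_atom]), as in the recursion that defines [urn_mean]. *)
Lemma urn_law n f :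
  (\int[P]_w (f (U n w))%:E)%E = (urn_mean theta Rep U0 n f)%:E.
Proof.
elim: n f => [|n ih] f.
  rewrite /= (eq_integral (fun=> (f U0)%:E)); last by move=> w _; rewrite (urn_init hU).
  rewrite -[RHS]mule1 integral_cst//; congr (_ * _)%E; exact: probability_setT.
rewrite /= -ih.
rewrite (@integral_finite_range _ _ _ _ _ (undup (urn_range n)) (U n)
  (fun x => \sum_j draw_prob theta n x j * f (x + row j Rep)))//; last 2 first.
  by rewrite undup_uniq.
  by move=> w; rewrite mem_undup.
pose F (xj : 'rV[R]_k * 'I_k) := f (xj.1 + row xj.2 Rep).
rewrite (eq_integral (fun w => (F (U n w, Z n w))%:E)); last first.
  by move=> w _; rewrite U_succ.
rewrite (@integral_finite_range _ _ _ _ _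
   [seq (x, j) | x <- undup (urn_range n), j <- enum 'I_k]
   (fun w => (U n w, Z n w)) F); last 3 first.
- by apply: allpairs_uniq => [| |[? ?] [? ?]//]; rewrite ?undup_uniq ?enum_uniq.
- move=> w; apply/allpairsP; exists (U n w, Z n w).
  by rewrite /= mem_undup U_range mem_enum.
- move=> [x j].
  rewrite (_ : _ @^-1` _ = (U n @^-1` [set x]) `&` (Z n @^-1` [set j])).
    by apply: measurableI => //; exact: (urn_measurable_draw hU).
  by apply/seteqP; split=> w /= => [[-> ->]|[-> ->]].
congr EFin; rewrite big_allpairs_dep/=; apply: eq_bigr => x _.
rewrite mulr_suml big_enum/=; apply: eq_bigr => j _.
rewrite mulrAC -draw_atom mulrC; congr (fine (P _) * _).
by apply/seteqP; split=> w /= => [[-> ->]|[-> ->]].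
Qed.

End UrnLaw.

(** * Measurability of vector valued maps *)

Section BorelRV.
Variables (R : realType) (k : nat).

Lemma continuous_measurable_rV (f : 'rV[R]_k -> R) : continuous f ->
  measurable_fun [set: borel_rV R k] (f : borel_rV R k -> R).
Proof.
move=> /continuousP cf.
apply: (measurability _ (RGenOpens.measurableE R)) => _ [_ [a [b ->]] <-].
rewrite setTI; apply: sub_sigma_algebra; apply: cf; exact: interval_open.
Qed.

(** Every open set is a countable union of boxes with rational centres. *)
Lemma measurable_fun_rV (d : measure_display) (T : measurableType d)
    (phi : T -> 'rV[R]_k) :
  (forall i, measurable_fun [set: T] (fun w => phi w 0 i)) ->
  measurable_fun [set: T] (phi : T -> borel_rV R k).
Proof.
move=> mphi; apply: (@measurability _ _ T (borel_rV R k) setT phi (@open 'rV[R]_k)) => //.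
move=> _ [V oV <-]; rewrite setTI.
pose box (q : {ffun 'I_k -> rat}) (r : R) : set 'rV[R]_k :=
  [set x | forall i, `|x 0 i - ratr (q i)| < r].
have mbox q r : measurable (phi @^-1` box q r).
  rewrite (_ : _ @^-1` _ = \bigcap_(i in [set: 'I_k])
      ((fun w => phi w 0 i) @^-1` [set y | `|y - ratr (q i)| < r])); last first.
    by apply/seteqP; split=> w h i; [move=> _; exact: h | exact: h i I].
  apply: fin_bigcap_measurable => // i _.
  rewrite -[X in measurable X]setTI; apply: mphi => //.
  rewrite (_ : [set y | _] = `](ratr (q i) - r), (ratr (q i) + r)[%classic)//.
  by apply/seteqP; split=> y /=; rewrite in_itv/= ltr_distl.
pose J := ({ffun 'I_k -> rat} * nat)%type.
pose part (p : nat) : set T := if (unpickle p : option J) is Some qn then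
   (if `[< box qn.1 qn.2.+1%:R^-1 `<=` V >] then phi @^-1` box qn.1 qn.2.+1%:R^-1 else set0)
   else set0.
rewrite (_ : phi @^-1` V = \bigcup_p part p).
  apply: bigcup_measurable => p _; rewrite /part.
  case: (unpickle p) => [[q n]|]; last exact: measurable0.
  by case: ifP => _; [exact: mbox | exact: measurable0].
apply/seteqP; split=> w.
  move=> /= Vw.
  have := open_nbhs_nbhs (conj oV Vw) => /nbhs_ballP[e /= e0 he].
  have [n hn] : exists n, 2 / e <= n%:R :> R by exact: filter_ex (nbhs_infty_ger _).
  pose r : R := n.+1%:R^-1.
  have r0 : 0 < r by rewrite invr_gt0.
  have r2 : 2 * r < e.
    rewrite /r ltr_pdivrMr// mulrC -ltr_pdivrMr//.
    by apply: le_lt_trans hn _; rewrite ltr_nat.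
  have hq (i : 'I_k) : exists q : rat, `|phi w 0 i - ratr q| < r.
    have h : phi w 0 i - r < phi w 0 i + r by lra.
    have [q] := rat_in_itvoo h; rewrite in_itv/= => hq; exists q.
    by rewrite distrC ltr_distl.
  have [q qP] := choice hq.
  pose qf : {ffun 'I_k -> rat} := [ffun i => q i].
  exists (pickle ((qf, n) : J)) => //; rewrite /part pickleK.
  have inbox : box qf r (phi w) by move=> i; rewrite ffunE.
  rewrite ifT//; apply/asboolP => y hy; apply: he.
  split=> // i j; rewrite ord1 /ball/=.
  have h1 := hy j; have h2 := inbox j; rewrite distrC in h1.
  have -> : phi w 0 j - y 0 j = (phi w 0 j - ratr (qf j)) + (ratr (qf j) - y 0 j) by ring.
  by apply: le_lt_trans (ler_normD _ _) _; rewrite -/r in h1; lra.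
move=> [p _]; rewrite /part; case: (unpickle p) => [[q n]|]//.
by case: ifP => // /asboolP h /h.
Qed.

End BorelRV.

(** * The characteristic function of a normal variable *)

Lemma is_derive_chain (R : realType) (f g : R -> R) (x a b : R) :
  is_derive x 1 g b -> is_derive (g x) 1 f a -> is_derive x 1 (fun z => f (g z)) (a * b).
Proof. by move=> hg hf; exact: is_derive1_comp. Qed.

Section NormalTransform.
Variable R : realType.
Local Notation leb := (@lebesgue_measure R).

(** The density is almost everywhere the Radon-Nikodym derivative, by uniqueness
    of the latter. *)
Lemma integral_normal_prob (m s : R) (f : R -> R) :
  measurable_fun setT f -> (exists B, forall x, `|f x| <= B) ->
  (\int[normal_prob m s]_x (f x)%:E =
   \int[leb]_x (f x * normal_pdf m s x)%:E)%E.
Proof.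
move=> mf [B hB].
have intf : (normal_prob m s).-integrable setT (EFin \o f).
  apply: measurable_bounded_integrable => //.
    exact: le_lt_trans (probability_le1 _ _) (ltry 1).
  by exists B; split; [exact: num_real | move=> M hM x _; apply: le_trans (hB x) (ltW hM)].
have dom := normal_prob_dominates m s.
rewrite -(Radon_Nikodym_change_of_variables dom)//=.
apply: ae_eq_integral => //=.
- apply: emeasurable_funM; first exact/measurable_EFinP.
  apply: (measurable_int leb); apply: Radon_Nikodym_integrable => //.
- apply/measurable_EFinP; apply: measurable_funM => //; exact: measurable_normal_pdf.
- have h : ae_eq leb setT
    (Radon_Nikodym (charge_of_finite_measure (normal_prob m s)) leb)
    (EFin \o normal_pdf m s).
    rewrite Radon_NikodymE//=.
    case: cid => /= h [h1 h2 h3].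
    apply: integral_ae_eq => //=.
    + by apply/measurable_EFinP; exact: measurable_normal_pdf.
    + by move=> E _ mE; rewrite -h3.
  by apply: filterS h => x hx _; rewrite hx//= EFinM.
Qed.

Variable s : R.
Hypothesis s0 : s != 0.

Let pdfE : normal_pdf 0 s =
  (fun x => normal_peak s * expR (- x ^+ 2 / (s ^+ 2 *+ 2))).
Proof.
by rewrite normal_pdfE//; apply/funext => x; rewrite /normal_fun subr0.
Qed.

Let p := normal_pdf 0 s.

Let is_derive_pdf (x : R) : is_derive x 1 p (- x / s ^+ 2 * p x).
Proof.
rewrite /p pdfE.
have h1 : is_derive x 1 (fun y : R => - y ^+ 2 / (s ^+ 2 *+ 2)) (- x / s ^+ 2).
  have -> : (fun y : R => - y ^+ 2 / (s ^+ 2 *+ 2)) =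
      (- (s ^+ 2 *+ 2)^-1) \*: (@id R ^+ 2).
    by apply/funext => y; rewrite /= /GRing.scale/= exprfctE mulrC mulrN mulNr.
  apply: is_derive_eq.
  rewrite /GRing.scale/= -mulr_natl; field.
  by rewrite s0.
have h2 := is_derive_chain h1 (is_derive_expR (- x ^+ 2 / (s ^+ 2 *+ 2))).
have h3 := @is_deriveZ _ _ _ _ (normal_peak s) _ _ _ h2.
by apply: is_derive_eq; rewrite /GRing.scale/=; ring.
Qed.

Let cp : continuous p. Proof. exact: continuous_normal_pdf. Qed.
Let mp : measurable_fun setT p. Proof. exact: measurable_normal_pdf. Qed.
Let p_ge0 x : 0 <= p x. Proof. exact: normal_pdf_ge0. Qed.
Let int_p : leb.-integrable setT (EFin \o p). Proof. exact: integrable_normal_pdf. Qed.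

(* |x| times the density is at most a multiple of the density with twice the
   deviation, which is integrable. *)
Let moment_dom : exists2 C : R, 0 <= C &
  forall x, `|x| * p x <= C * normal_pdf 0 (2 * s) x.
Proof.
have s2 : 2 * s != 0 by rewrite mulf_neq0.
have P0 := normal_peak_gt0 s0; have P2 := normal_peak_gt0 s2.
exists (`|s| * normal_peak s / normal_peak (2 * s)).
  by rewrite divr_ge0 ?mulr_ge0// ltW.
move=> x; rewrite /p normal_pdfE// normal_pdfE// /normal_fun !subr0.
set z := x / s.
have xE : x = z * s by rewrite /z divfK.
have e1 : - x ^+ 2 / (s ^+ 2 *+ 2) = - z ^+ 2 / 2.
  by rewrite xE -mulr_natl; field.
have e2 : - x ^+ 2 / ((2 * s) ^+ 2 *+ 2) = - z ^+ 2 / 8.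
  by rewrite xE -mulr_natl; field.
rewrite e1 e2.
have -> : `|s| * normal_peak s / normal_peak (2 * s) *
   (normal_peak (2 * s) * expR (- z ^+ 2 / 8)) =
   `|s| * normal_peak s * expR (- z ^+ 2 / 8) by field; rewrite gt_eqF.
have -> : `|x| * (normal_peak s * expR (- z ^+ 2 / 2)) =
  `|s| * normal_peak s * (`|z| * expR (- z ^+ 2 / 2)).
  by rewrite xE normrM; ring.
apply: ler_wpM2l; first by rewrite mulr_ge0// ltW.
have -> : - z ^+ 2 / 8 = - z ^+ 2 / 2 + z ^+ 2 * 3 / 8 by field.
rewrite expRD [leLHS]mulrC; apply: ler_wpM2l; first exact: expR_ge0.
have h := expR_ge1Dx (z ^+ 2 * 3 / 8); apply: le_trans h.
have := real_normK (num_real z); set y := `|z| => <-.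
have := sqr_ge0 (y - 4 / 3); lra.
Qed.

Let int_dom (f : R -> R) (C : R) : measurable_fun setT f ->
  (forall x, `|f x| <= C * p x) -> leb.-integrable setT (EFin \o f).
Proof.
move=> mf hf; apply: (@le_integrable _ _ _ leb setT _ _ (fun x => (C * p x)%:E)) => //.
- exact/measurable_EFinP.
- move=> x _ /=; rewrite lee_fin; apply: le_trans (hf x) _; exact: ler_norm.
- rewrite (_ : (fun x => (C * p x)%:E) = (fun x => C%:E * (EFin \o p) x)%E)//.
  exact: integrableZl.
Qed.

Let int_dom1 (f : R -> R) : measurable_fun setT f ->
  (forall x, `|f x| <= `|x| * p x) -> leb.-integrable setT (EFin \o f).
Proof.
move=> mf hf; have [C C0 hC] := moment_dom.
apply: (@le_integrable _ _ _ leb setT _ _ (fun x => (C * normal_pdf 0 (2 * s) x)%:E)) => //.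
- exact/measurable_EFinP.
- move=> x _ /=; rewrite lee_fin; apply: le_trans (hf x) _.
  by apply: le_trans (hC x) _; exact: ler_norm.
- rewrite (_ : (fun x => _%:E) = (fun x => C%:E * (EFin \o normal_pdf 0 (2 * s)) x)%E)//.
  by apply: integrableZl => //; exact: integrable_normal_pdf.
Qed.

Lemma integral_derivative_vanishing (H h : R -> R) :
  (forall x : R, is_derive x 1 H (h x)) -> continuous h ->
  leb.-integrable setT (EFin \o h) ->
  (fun n : nat => H n%:R - H (- n%:R)) @ \oo --> 0 ->
  \int[leb]_x h x = 0.
Proof.
move=> dH ch ih lim0.
have cH : continuous H.
  by move=> x; apply/differentiable_continuous/derivable1_diffP; case: (dH x).
have mh : measurable_fun setT h by exact: continuous_measurable_fun.
pose I n : set R := `[(- n.+1%:R), n.+1%:R]%classic.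
pose hn n : R -> \bar R := (fun x => ((EFin \o h) \_ (I n)) x).
have dc := @dominated_convergence _ _ _ leb setT measurableT hn (EFin \o h)
  (fun x => `|(h x)%:E|%E).
have lim1 : (\int[leb]_x hn n x)%E @[n --> \oo] --> (\int[leb]_x (EFin \o h) x)%E.
  have [||||| _ _] // := dc.
  - move=> n; apply/measurable_restrict => //.
      exact: measurable_itv.
    by apply: measurable_funTS; exact/measurable_EFinP.
  - exact/measurable_EFinP.
  - apply: aeW => x _; apply: cvg_near_cst.
    have := nbhs_infty_ger `|x|; apply: filterS => n hx.
    rewrite /hn patchE mem_set//= /I/= in_itv/= -ler_norml.
    by apply: le_trans hx _; rewrite ler_nat.
  - exact: integrable_abse.
  - apply: aeW => x n _; rewrite /hn patchE; case: ifP => //= _.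
    by rewrite lee_fin normr0.
have hnE n : (\int[leb]_x hn n x)%E = (H n.+1%:R - H (- n.+1%:R))%:E.
  rewrite /hn -integral_mkcond EFinB; apply: continuous_FTC2.
  - by apply: lt_trans (ltr0Sn R n); rewrite oppr_lt0.
  - exact: continuous_subspaceT.
  - split=> [x _||]; first by case: (dH x).
      by apply: cvg_at_right_filter; exact: cH.
    by apply: cvg_at_left_filter; exact: cH.
  - by move=> x _; rewrite derive1E; case: (dH x).
have lim2 : (\int[leb]_x hn n x)%E @[n --> \oo] --> (0 : R)%:E.
  rewrite (_ : (fun n => _) = EFin \o (fun n => H n.+1%:R - H (- n.+1%:R))).
    apply: cvg_EFin; first by near=> n.
    by move: lim0; rewrite -(@cvg_shiftS _ (fun n => H n%:R - H (- n%:R))).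
  by apply/funext => n; rewrite hnE.
by rewrite /Rintegral -(cvg_unique _ lim2 lim1).
Unshelve. all: by end_near. Qed.

Section Cosine.
Variable b : R.
Let F (t : R) : R := \int[leb]_y (cos (t * y + b) * p y).

Let is_derive_arg (t y : R) : is_derive t 1 (fun t : R => t * y + b) y.
Proof. by apply: is_derive_eq; rewrite /GRing.scale/=; ring. Qed.

Let is_derive_arg2 (t y : R) : is_derive y 1 (fun y : R => t * y + b) t.
Proof. by apply: is_derive_eq; rewrite /GRing.scale/=; ring. Qed.

Let is_derive_integrand (t y : R) :
  is_derive t 1 (fun t : R => cos (t * y + b) * p y) (- y * sin (t * y + b) * p y).
Proof.
have h := is_derive_chain (is_derive_arg t y) (is_derive_cos (t * y + b)).
have -> : (fun t => cos (t * y + b) * p y) = (p y) \*: (fun t : R => cos (t * y + b)).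
  by apply/funext => x; rewrite /= /GRing.scale/= mulrC.
by apply: is_derive_eq; rewrite /GRing.scale/=; ring.
Qed.

Let continuous_arg (t : R) : continuous (fun y : R => t * y + b).
Proof.
move=> y; apply/differentiable_continuous/derivable1_diffP; by case: (is_derive_arg2 t y).
Qed.

Let continuous_cosp (t : R) : continuous (fun y : R => cos (t * y + b) * p y).
Proof.
move=> y; apply: continuousM; last exact: cp.
apply: (@continuous_comp _ _ _ (fun y : R => t * y + b) cos); first exact: continuous_arg.
exact: continuous_cos.
Qed.

Let continuous_sinp (t : R) : continuous (fun y : R => sin (t * y + b) * p y).
Proof.
move=> y; apply: continuousM; last exact: cp.
apply: (@continuous_comp _ _ _ (fun y : R => t * y + b) sin); first exact: continuous_arg.
exact: continuous_sin.
Qed.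

Let int_cosp (t : R) : leb.-integrable setT (EFin \o (fun y : R => cos (t * y + b) * p y)).
Proof.
apply: (@int_dom _ 1); first exact: continuous_measurable_fun.
by move=> x; rewrite mul1r normrM (ger0_norm (p_ge0 x)) ler_piMl// ler_norml cos_geN1 cos_le1.
Qed.

Let continuous_ysinp (t : R) : continuous (fun y : R => - y * sin (t * y + b) * p y).
Proof.
have -> : (fun y : R => - y * sin (t * y + b) * p y) =
   (fun y : R => - y * (sin (t * y + b) * p y)) by apply/funext => y; rewrite mulrA.
move=> y; apply: continuousM; last exact: continuous_sinp.
by apply: continuousN; exact: cvg_id.
Qed.

Let ysinp_le (t y : R) : `|- y * sin (t * y + b) * p y| <= `|y| * p y.
Proof.
rewrite !normrM normrN (ger0_norm (p_ge0 y)) ler_wpM2r// ler_piMr//.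
by rewrite ler_norml sin_geN1 sin_le1.
Qed.

Let int_ysinp (t : R) : leb.-integrable setT (EFin \o (fun y : R => - y * sin (t * y + b) * p y)).
Proof. by apply: int_dom1 => [|y]; [exact: continuous_measurable_fun|exact: ysinp_le]. Qed.

Let int_moment : leb.-integrable setT (EFin \o (fun y : R => `|y| * p y)).
Proof.
apply: int_dom1 => [|y]; last by rewrite normrM normr_id (ger0_norm (p_ge0 y)).
by apply: measurable_funM => //; exact: measurableT_comp.
Qed.

Let is_derive_F (t : R) :
  is_derive t 1 F (\int[leb]_y (- y * sin (t * y + b) * p y)).
Proof.
have tI : `](t - 1), (t + 1)[%classic t by rewrite /= in_itv/=; apply/andP; split; lra.
pose f (t y : R) := cos (t * y + b) * p y.
have h1 : forall x : R, `](t - 1), (t + 1)[%classic x -> leb.-integrable setT (EFin \o f x).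
  by move=> x _; exact: int_cosp.
have h2 : forall x y : R, `](t - 1), (t + 1)[%classic x -> setT y -> derivable (f^~ y) x 1.
  by move=> x y _ _; case: (is_derive_integrand x y).
have pE x y : partial1of2 f x y = - y * sin (x * y + b) * p y.
  by rewrite partial1of2E; case: (is_derive_integrand x y).
have h3 : forall y, 0 <= `|y| * p y by move=> y; rewrite mulr_ge0.
have h4 : forall x y : R, `](t - 1), (t + 1)[%classic x -> setT y ->
    `|partial1of2 f x y| <= `|y| * p y.
  by move=> x y _ _; rewrite pE.
have dF := @derivable_under_integral _ _ _ leb f setT measurableT t (t - 1) (t + 1)
  tI h1 h2 _ h3 int_moment h4.
have dFE := @differentiation_under_integral _ _ _ leb f setT measurableT t (t - 1) (t + 1)
  tI h1 h2 _ h3 int_moment h4.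
apply: DeriveDef => //.
by rewrite -derive1E dFE; apply: eq_Rintegral => y _; rewrite pE.
Qed.

(* The derivative of s^2 sin(t y + b) p(y), which vanishes at infinity, is
   - y sin(t y + b) p(y) + s^2 t cos(t y + b) p(y). *)
Let by_parts (t : R) : \int[leb]_y (- y * sin (t * y + b) * p y) = - s ^+ 2 * t * F t.
Proof.
pose H (y : R) : R := s ^+ 2 * (sin (t * y + b) * p y).
pose h (y : R) : R := - y * sin (t * y + b) * p y + s ^+ 2 * t * (cos (t * y + b) * p y).
have dH (y : R) : is_derive y 1 H (h y).
  have h1 := is_derive_chain (is_derive_arg2 t y) (is_derive_sin (t * y + b)).
  have h2 := is_deriveM h1 (is_derive_pdf y).
  have h3 := @is_deriveZ _ _ _ _ (s ^+ 2) _ _ _ h2.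
  apply: is_derive_eq; rewrite /h /GRing.scale/=; field; exact: s0.
have icos : leb.-integrable setT
    (EFin \o (fun y : R => s ^+ 2 * t * (cos (t * y + b) * p y))).
  rewrite (_ : EFin \o _ = (fun y => (s ^+ 2 * t)%:E *
     (EFin \o (fun y : R => (cos (t * y + b) * p y)%R)) y)%E)//.
  by apply: integrableZl => //; exact: int_cosp.
have ch : continuous h.
  rewrite /h => y.
  apply: (@continuousD _ _ _ (fun y : R => - y * sin (t * y + b) * p y)); first exact: continuous_ysinp.
  by apply: continuousM; [exact: cst_continuous | exact: continuous_cosp].
have ih : leb.-integrable setT (EFin \o h).
  rewrite (_ : EFin \o h = ((EFin \o (fun y : R => (- y * sin (t * y + b) * p y)%R)) \+
    (EFin \o (fun y : R => (s ^+ 2 * t * (cos (t * y + b) * p y))%R)))%E)//.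
  by apply: integrableD => //; exact: int_ysinp.
have lim : (fun n : nat => H n%:R - H (- n%:R)) @ \oo --> 0.
  have [C C0 hC] := moment_dom.
  have s2 : 2 * s != 0 by rewrite mulf_neq0.
  pose K := s ^+ 2 * (C * normal_peak (2 * s)).
  have K0 : 0 <= K by apply: mulr_ge0; [exact: sqr_ge0 | apply: mulr_ge0 => //; exact: normal_peak_ge0].
  have hH y : `|y| * `|H y| <= K.
    rewrite /H /K normrM (ger0_norm (sqr_ge0 s)) mulrCA ler_wpM2l ?sqr_ge0//.
    apply: (@le_trans _ _ (`|y| * p y)).
      rewrite ler_wpM2l// normrM (ger0_norm (p_ge0 y)) ler_piMl//.
      by rewrite ler_norml sin_geN1 sin_le1.
    by apply: le_trans (hC y) _; rewrite ler_wpM2l// normal_pdf_ub.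
  apply/cvgrPdist_le => e e0; near=> n.
  have n0 : 0 < n%:R :> R by rewrite ltr0n; near: n; exact: nbhs_infty_gt.
  have nK : 2 * K / e <= n%:R by near: n; exact: nbhs_infty_ger.
  have h1 := hH n%:R; have h2 := hH (- n%:R).
  rewrite normrN !(@ger0_norm _ n%:R)// in h1 h2.
  rewrite sub0r normrN; apply: le_trans (ler_normB _ _) _.
  rewrite ler_pdivrMr// in nK.
  rewrite -(ler_pM2l n0); lra.
have := integral_derivative_vanishing dH ch ih lim.
rewrite /h (RintegralD measurableT (int_ysinp t) icos).
rewrite (RintegralZl _ measurableT (int_cosp t)).
rewrite -/(F t); lra.
Unshelve. all: by end_near. Qed.

(** By [by_parts] the transform F satisfies F' = - s^2 t F, so that
    F exp(s^2 t^2 / 2) is constant. *)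
Lemma normal_pdf_cos t :
  \int[leb]_y (cos (t * y + b) * p y) = expR (- (s ^+ 2 * t ^+ 2 / 2)) * cos b.
Proof.
pose G (t : R) := F t * expR (s ^+ 2 * t ^+ 2 / 2).
have dE (x : R) : is_derive x 1 (fun t : R => s ^+ 2 * t ^+ 2 / 2) (s ^+ 2 * x).
  have -> : (fun t : R => s ^+ 2 * t ^+ 2 / 2) = (s ^+ 2 / 2) \*: (@id R ^+ 2).
    by apply/funext => y; rewrite /= /GRing.scale/= exprfctE mulrAC.
  by apply: is_derive_eq; rewrite /GRing.scale/=; field.
have dG (x : R) : is_derive x 1 G 0.
  have h1 := is_derive_chain (dE x) (is_derive_expR (s ^+ 2 * x ^+ 2 / 2)).
  have h2 := is_deriveM (is_derive_F x) h1.
  by apply: is_derive_eq; rewrite /GRing.scale/= by_parts; ring.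
have := @is_derive_0_is_cst R G t 0 dG; rewrite /G.
rewrite expr0n/= mulr0 mul0r expR0 mulr1.
have -> : F 0 = cos b.
  have -> : F 0 = \int[leb]_y (cos b * p y).
    by apply: eq_Rintegral => y _; rewrite mul0r add0r.
  by rewrite RintegralZl// /Rintegral integral_normal_pdf mulr1.
by move=> <-; rewrite -/(F t) mulrCA -expRD addNr expR0 mulr1.
Qed.

End Cosine.
End NormalTransform.

(** * Laws are determined by their characteristic functions *)

Section BoundedIntegral.
Context (d : measure_display) (T : measurableType d) (R : realType).
Variable P : probability T R.

Lemma bounded_integrable (f : T -> R) : measurable_fun setT f ->
  (exists B, forall x, `|f x| <= B) -> P.-integrable setT (EFin \o f).
Proof.
move=> mf [B hB]; apply: measurable_bounded_integrable => //.
  exact: le_lt_trans (probability_le1 _ _) (ltry 1).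
by exists B; split; [exact: num_real | move=> M hM x _; apply: le_trans (hB x) (ltW hM)].
Qed.

Lemma integral_bounded (f : T -> R) : measurable_fun setT f ->
  (exists B, forall x, `|f x| <= B) ->
  (\int[P]_x (f x)%:E)%E = (\int[P]_x f x)%:E.
Proof.
move=> mf hf; rewrite /Rintegral fineK//.
by apply: integrable_fin_num => //; exact: bounded_integrable.
Qed.

Lemma Rintegral_probability_cst (t : R) : \int[P]_x t = t.
Proof.
by rewrite /Rintegral integral_cst//= probability_setT mule1.
Qed.

End BoundedIntegral.

Section LawMean.
Context (d : measure_display) (T : measurableType d) (R : realType) (k : nat).
Variables (P : probability T R) (phi : T -> 'rV[R]_k).
Hypothesis mphi : measurable_fun [set: T] (phi : T -> borel_rV R k).

Definition law_mean (f : 'rV[R]_k -> R) : R := \int[P]_w f (phi w).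

Lemma bounded_continuous_comp f : bounded_continuous f ->
  measurable_fun setT (fun w => f (phi w)) /\ exists B, forall w, `|f (phi w)| <= B.
Proof.
move=> [cf [B hB]]; split; last by exists B.
exact: (measurableT_comp (continuous_measurable_rV cf) mphi).
Qed.

Lemma law_mean_functional : mean_functional law_mean.
Proof.
split=> [f g hf hg|t f hf|f g hf hg fg|].
- have [mf bf] := bounded_continuous_comp hf; have [mg bg] := bounded_continuous_comp hg.
  by rewrite /law_mean RintegralD//; exact: bounded_integrable.
- have [mf bf] := bounded_continuous_comp hf.
  by rewrite /law_mean RintegralZl//; exact: bounded_integrable.
- have [mf bf] := bounded_continuous_comp hf; have [mg bg] := bounded_continuous_comp hg.
  by apply: le_Rintegral => //; exact: bounded_integrable.
- exact: Rintegral_probability_cst.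
Qed.

Lemma law_mean_tail i (e : R) : 0 < e ->
  exists2 L0, 0 < L0 & forall L, L0 <= L -> law_mean (tail L i) <= e.
Proof.
move=> e0.
have tail01 (L : R) x : 0 <= tail L i x <= 1.
  by rewrite /tail le_min ler01 sqr_ge0 ge_min lexx.
pose fn (n : nat) (w : T) : \bar R := (tail n.+1%:R i (phi w))%:E.
have cv : (\int[P]_w fn n w)%E @[n --> \oo] --> (\int[P]_w (cst 0%E w))%E.
  have dc := @dominated_convergence _ _ _ P setT measurableT fn (cst 0%E) (cst 1%E).
  have [||||| _ _] // := dc.
  - move=> n; apply/measurable_EFinP.
    by have [] := bounded_continuous_comp (bounded_continuous_tail n.+1%:R i).
  - apply: aeW => w _; apply: cvg_EFin; first by near=> n.
    apply/cvgrPdist_le => eps eps0; near=> n.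
    rewrite /= sub0r normrN ger0_norm; last by have /andP[] := tail01 n.+1%:R (phi w).
    rewrite /tail ge_min; apply/orP; right.
    have n0 : 0 < n.+1%:R :> R by rewrite ltr0n.
    have n1 : 1 <= n.+1%:R :> R by rewrite ler1n.
    have h : (phi w 0 i) ^+ 2 / eps <= n.+1%:R.
      apply: (@le_trans _ _ n%:R); last by rewrite ler_nat.
      by near: n; exact: nbhs_infty_ger.
    rewrite expr_div_n ler_pdivrMr ?exprn_gt0//.
    rewrite ler_pdivrMr// mulrC in h; apply: le_trans h _.
    by apply: ler_wpM2l; [exact: ltW | rewrite expr2 ler_peMl// ltW].
  - apply: (@eq_integrable _ _ _ P setT measurableT (EFin \o cst 1)) => //.
    by apply: bounded_integrable => //; exists 1 => x; rewrite normr1.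
  - by apply: aeW => w n _; rewrite /fn /= lee_fin ger0_norm; have /andP[] := tail01 n.+1%:R (phi w).
rewrite integral0 in cv.
have fE n : (\int[P]_w fn n w)%E = (law_mean (tail n.+1%:R i))%:E.
  have [m1 b1] := bounded_continuous_comp (bounded_continuous_tail n.+1%:R i).
  by rewrite /fn integral_bounded.
have : \forall n \near \oo, law_mean (tail n.+1%:R i) <= e.
  have : (fun n => law_mean (tail n.+1%:R i)) @ \oo --> 0.
    move: cv; rewrite (_ : (fun n => _) = (fun n => (law_mean (tail n.+1%:R i))%:E)).
      by move=> h; exact: (fine_cvg (h : _ --> (0 : R)%:E)).
    by apply/funext => n; rewrite fE.
  move=> /cvgrPdist_le/(_ _ e0); apply: filterS => n; rewrite sub0r normrN.
  exact/le_trans/ler_norm.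
move=> /filter_ex[n hn]; exists n.+1%:R => [|L nL]; first by rewrite ltr0n.
apply: le_trans hn; apply: (mean_le law_mean_functional).
- exact: bounded_continuous_tail.
- exact: bounded_continuous_tail.
move=> x; rewrite /tail le_min !ge_min lexx/=; apply/orP; right.
have n0 : 0 < n.+1%:R :> R by rewrite ltr0n.
rewrite !expr_div_n ler_wpM2l ?sqr_ge0// lef_pV2 ?posrE ?exprn_gt0//; last exact: lt_le_trans nL.
by apply: lerXn2r; rewrite ?nnegrE; lra.
Unshelve. all: by end_near. Qed.

End LawMean.

Section TrigDetermines.
Variable R : realType.
Implicit Types P : probability R R.

Let row1 (y : R) : 'rV[R]_1 := const_mx y.

Let mrow1 : measurable_fun [set: R] (row1 : R -> borel_rV R 1).
Proof.
apply: measurable_fun_rV => i; rewrite (_ : (fun w => _) = id)//.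
by apply/funext => w; rewrite /row1 mxE.
Qed.

Let bump (a b : R) n (y : R) : R :=
  Num.min 1 (n.+1%:R * Num.max 0 (Num.min (y - a) (b - y))).

Let bump01 a b n y : 0 <= bump a b n y <= 1.
Proof.
by rewrite /bump le_min ler01 ge_min lexx/= mulr_ge0// le_max lexx.
Qed.

Let cbump a b n : bounded_continuous (fun x : 'rV[R]_1 => bump a b n (x 0 0)).
Proof.
split; last by exists 1 => x; rewrite ger0_norm; have /andP[] := bump01 a b n (x 0 0).
have c1 : continuous (fun x : 'rV[R]_1 => x 0 0) by exact: coord_continuous.
have c2 : continuous (fun x : 'rV[R]_1 => x 0 0 - a).
  by move=> x; apply: continuousB; [exact: c1 | exact: cst_continuous].
have c3 : continuous (fun x : 'rV[R]_1 => b - x 0 0).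
  by move=> x; apply: continuousB; [exact: cst_continuous | exact: c1].
move=> x; apply: (@continuous_min _ _ (fun=> 1)
  (fun x : 'rV[R]_1 => n.+1%:R * Num.max 0 (Num.min (x 0 0 - a) (b - x 0 0)))).
  exact: cst_continuous.
apply: continuousM; first exact: cst_continuous.
apply: (@continuous_max _ _ (fun=> 0)
  (fun x : 'rV[R]_1 => Num.min (x 0 0 - a) (b - x 0 0))); first exact: cst_continuous.
by apply: (@continuous_min _ _ (fun x : 'rV[R]_1 => x 0 0 - a) (fun x : 'rV[R]_1 => b - x 0 0)); [exact: c2 | exact: c3].
Qed.

Let bump_cvg P a b : (law_mean P row1 (fun x => bump a b n (x 0 0)))%:E
  @[n --> \oo] --> P `]a, b[%classic.
Proof.
pose fn (n : nat) (y : R) : \bar R := (bump a b n y)%:E.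
have mb n : measurable_fun setT (bump a b n).
  have [h _] := bounded_continuous_comp mrow1 (cbump a b n).
  by move: h; rewrite (_ : (fun w => _) = bump a b n)//; apply/funext => w; rewrite mxE.
have -> : P `]a, b[%classic = (\int[P]_y (EFin \o \1_(`]a, b[%classic)) y)%E.
  by rewrite integral_indic// setIT.
rewrite (_ : (fun n => _) = fun n => (\int[P]_y fn n y)%E).
  have dc := @dominated_convergence _ _ _ P setT measurableT fn (EFin \o \1_(`]a, b[%classic)) (cst 1%E).
  have [||||| _ _] // := dc.
  - by move=> n; apply/measurable_EFinP.
  - by apply/measurable_EFinP; exact: measurable_indic.
  - apply: aeW => y _; apply: cvg_near_cst.
    rewrite /fn/= indicE; case: (boolP (y \in _)) => [|/negP].
      rewrite inE/= in_itv/= => /andP[ay yb].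
      pose m : R := Num.min (y - a) (b - y).
      have m0 : 0 < m by rewrite lt_min; apply/andP; split; lra.
      near=> n; congr EFin; rewrite /bump -/m (max_idPr (ltW m0)).
      apply/min_idPl; rewrite -ler_pdivrMr//.
      apply: (@le_trans _ _ n%:R); last by rewrite ler_nat.
      by near: n; exact: nbhs_infty_ger.
    move=> hy; near=> n; congr EFin; rewrite /bump.
    have -> : Num.max 0 (Num.min (y - a) (b - y)) = 0.
      apply/max_idPl; rewrite ge_min !subr_le0; case: (leP y a) => //= ay.
      by case: (leP b y) => // yb; case: hy; rewrite inE/= in_itv/= ay yb.
    by rewrite mulr0; apply/min_idPr.
  - apply: (@eq_integrable _ _ _ P setT measurableT (EFin \o cst 1)) => //.
    by apply: bounded_integrable => //; exists 1 => x; rewrite normr1.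
  - by apply: aeW => y n _; rewrite /fn /= lee_fin ger0_norm; have /andP[] := bump01 a b n y.
apply/funext => n; rewrite /fn integral_bounded//.
  by congr EFin; apply: eq_Rintegral => y _; rewrite mxE.
by exists 1 => y; rewrite ger0_norm; have /andP[] := bump01 a b n y.
Unshelve. all: by end_near. Qed.

(** For constant sequences [weak_convergence] says that the two laws agree on
    bounded continuous functions, hence on open intervals, which are limits of
    the functions [bump] and form a generating family stable by intersection. *)
Lemma trig_determines P1 P2 :
  (forall t b, \int[P1]_y cos (t * y + b) = \int[P2]_y cos (t * y + b)) ->
  forall A, measurable A -> P1 A = P2 A.
Proof.
move=> h.
have eqm f : bounded_continuous f -> law_mean P1 row1 f = law_mean P2 row1 f.
  move=> hf; apply/eqP; rewrite -subr_eq0 -normr_le0; apply/ler_addgt0Pl => e e0.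
  rewrite addr0.
  have mf P := law_mean_functional P mrow1.
  have := @weak_convergence R 1 (fun=> law_mean P1 row1) (law_mean P2 row1)
    (fun=> mf P1) (mf P2) _ _ f hf e e0.
  move=> hw; have : \forall n \near \oo, `|law_mean P1 row1 f - law_mean P2 row1 f| <= e.
    apply: hw => [u b d d0|i d d0].
      near=> n; rewrite (_ : law_mean P1 _ _ = law_mean P2 row1 (fun x => cos (dot x u + b))).
        by rewrite subrr normr0 ltW.
      have rE P : law_mean P row1 (fun x => cos (dot x u + b)) = \int[P]_y cos (u 0 0 * y + b).
        by apply: eq_Rintegral => y _; rewrite dotE big_ord1 mxE mulrC.
      by rewrite !rE h.
    have [L1 L10 h1] := law_mean_tail P1 mrow1 i d0.
    have [L2 L20 h2] := law_mean_tail P2 mrow1 i d0.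
    exists (Num.max L1 L2) => [|L]; first by rewrite lt_max L10.
    rewrite ge_max => /andP[hL1 hL2]; split; first exact: h2.
    by near=> n; exact: h1.
  by move=> /filter_ex[_].
have eqI a b : P1 `]a, b[%classic = P2 `]a, b[%classic.
  have h1 := @bump_cvg P1 a b; have h2 := @bump_cvg P2 a b.
  have hE : (fun n => (law_mean P1 row1 (fun x => bump a b n (x 0 0)))%:E) =
    (fun n => (law_mean P2 row1 (fun x => bump a b n (x 0 0)))%:E).
    by apply/funext => n; rewrite eqm.
  rewrite hE in h1; exact: (cvg_unique _ h1 h2).
move=> A mA; apply: (measure_unique (@RGenOpens.G R) (fun n => `](- n%:R), n%:R[%classic)) => //.
- exact: RGenOpens.measurableE.
- move=> _ _ [a [b ->]] [a' [b' ->]].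
  exists (Num.max a a'), (Num.min b b').
  apply/seteqP; split=> x /=; rewrite !in_itv/= gt_max lt_min.
    by move=> [/andP[-> ->] /andP[-> ->]].
  by move=> /andP[/andP[-> ->] /andP[-> ->]].
- by move=> n; exists (- n%:R), n%:R.
- apply/seteqP; split=> // x _.
  have := nbhs_infty_gtr `|x| => /filter_ex[n hn].
  by exists n => //=; rewrite in_itv/= -ltr_norml.
- by move=> B [a [b ->]]; exact: eqI.
- by move=> n; apply: le_lt_trans (probability_le1 _ _) (ltry 1) => //; exact: measurable_itv.
Unshelve. all: by end_near. Qed.

End TrigDetermines.

(** * Multivariate normal laws *)

Section Gaussian.
Variable R : realType.

Lemma measurable_cos_affine (t b : R) : measurable_fun setT (fun y : R => cos (t * y + b)).
Proof.
apply: (measurableT_comp (continuous_measurable_fun (@continuous_cos R))).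
by apply: measurable_funD => //; exact: measurable_funM.
Qed.

Lemma normal_law_cos (v : R) : 0 <= v -> exists P : probability (R) R,
  (forall A, P A = normal_law 0 v A) /\
  forall t b, \int[P]_y cos (t * y + b) = expR (- (v * t ^+ 2 / 2)) * cos b.
Proof.
move=> v0; rewrite /normal_law; have [->|vn0] := eqVneq v 0.
  exists (\d_(0 : R)); split => // t b.
  rewrite /Rintegral integral_dirac//=.
    by rewrite indicE in_setT mul1r mulr0 add0r !mul0r oppr0 expR0 mul1r.
  by apply/measurable_EFinP; exact: measurable_cos_affine.
have s0 : Num.sqrt v != 0 by rewrite sqrtr_eq0 -ltNge lt_def vn0.
(* [normal_prob] lives on a copy of R with the same measurable sets. *)
have mid : measurable_fun [set: measurableTypeR R] (id : measurableTypeR R -> R).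
  by move=> _ Y mY; rewrite setTI.
pose X : {mfun measurableTypeR R >-> R} :=
  MeasurableFun.Pack (MeasurableFun.Class (isMeasurableFun.Build _ _ _ _ _ mid)).
exists (distribution (normal_prob 0 (Num.sqrt v)) X); split => // t b.
have bc : exists B, forall y, `|cos (t * y + b)| <= B.
  by exists 1 => x; rewrite ler_norml cos_geN1 cos_le1.
have mc : measurable_fun [set: measurableTypeR R] (fun y => cos (t * y + b)).
  exact: measurable_cos_affine.
have -> : v * t ^+ 2 / 2 = Num.sqrt v ^+ 2 * t ^+ 2 / 2 by rewrite sqr_sqrtr.
rewrite -(normal_pdf_cos s0 b t) /Rintegral.
rewrite integral_distribution; last 2 first.
- by apply/measurable_EFinP; exact: measurable_cos_affine.
- exact: (bounded_integrable (normal_prob 0 (Num.sqrt v)) mc bc).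
by rewrite -(integral_normal_prob 0 (Num.sqrt v) mc bc).
Qed.

Variable k : nat.

Lemma pushforward_rV (d : measure_display) (T : measurableType d)
    (P : probability T R) (phi : T -> 'rV[R]_k) :
  measurable_fun [set: T] (phi : T -> borel_rV R k) ->
  exists nu : probability (borel_rV R k) R, forall f, bounded_continuous f ->
    (\int[nu]_x (f x)%:E = \int[P]_w (f (phi w))%:E)%E.
Proof.
move=> mphi.
pose X : {mfun T >-> borel_rV R k} :=
  MeasurableFun.Pack (MeasurableFun.Class (isMeasurableFun.Build _ _ _ _ _ mphi)).
exists (distribution P X) => f hf.
have [mf bf] := bounded_continuous_comp mphi hf.
rewrite integral_distribution//; last exact: bounded_integrable.
by apply/measurable_EFinP; apply: continuous_measurable_rV; case: hf.
Qed.

Definition has_gaussian_transform (nu : probability (borel_rV R k) R) (X : 'M[R]_k) :=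
  forall u b, \int[nu]_x cos (dot x u + b) = expR (- (quad X u / 2)) * cos b.

Lemma quad_bil (X : 'M[R]_k) u : quad X u = bil X u u.
Proof. by []. Qed.

(** By induction on the number of nonzero diagonal entries. If X_ii > 0, let r be
    the i-th row of X divided by sqrt(X_ii). Subtracting r^T r (a Schur
    complement) keeps the matrix positive semi-definite and cancels the i-th
    diagonal entry; adding to the corresponding variable an independent standard
    normal multiple of r restores X. *)
Lemma gaussian_exists (X : 'M[R]_k) : X^T = X -> (forall u, 0 <= quad X u) ->
  exists nu, has_gaussian_transform nu X.
Proof.
have [n] := ubnP #|[pred i | X i i != 0]|.
elim: n X => // n ih X hn symX psdX.
have diag_ge0 i : 0 <= X i i by have := psdX (delta_mx i 0); rewrite quad_bil bil_delta.
(* A positive semi-definite matrix with zero diagonal is zero. *)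
have [i|none] := pickP (fun i => X i i != 0); last first.
  have X0 : X = 0.
    apply/matrixP => i j; rewrite mxE.
    have d0 l : X l l = 0 by apply/eqP; rewrite -[_ == _]negbK none.
    have q t := psdX (delta_mx i 0 + t *: delta_mx j 0).
    have := q 1; have := q (-1).
    rewrite !quad_bil !bilDl !bilDr !bilZl !bilZr !bil_delta !d0.
    have -> : X j i = X i j by rewrite -{1}symX mxE.
    by lra.
  have [|nu hnu] := @pushforward_rV _ _ (\d_(0 : R)) (fun=> 0).
    exact: measurable_cst.
  exists nu => u b; rewrite /Rintegral hnu; last exact: bounded_continuous_cos.
  rewrite -/(Rintegral _ _ (fun=> _)) Rintegral_probability_cst X0 /dot mul0mx mxE add0r.
  by rewrite quad_bil bil0 mul0r oppr0 expR0 mul1r.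
move=> Xi; pose dd := X i i; have d0 : 0 < dd by rewrite lt_def Xi diag_ge0.
pose r : 'rV[R]_k := (Num.sqrt dd)^-1 *: row i X.
pose X' := X - r^T *m r.
have sqd : (Num.sqrt dd)^-1 ^+ 2 = dd^-1 by rewrite exprVn sqr_sqrtr// ltW.
have rE u : dot r u = (Num.sqrt dd)^-1 * bil X (delta_mx i 0) u.
  by rewrite /r dotZl /dot /bil trmx_delta -rowE.
have quadX' u : quad X' u = quad X u - dot r u ^+ 2.
  by rewrite !quad_bil bilB bil_outer.
have bE u : bil X u (delta_mx i 0) = bil X (delta_mx i 0) u.
  have h : (u^T *m X *m (delta_mx i 0 : 'cV[R]_k))^T = (delta_mx i 0)^T *m X *m u.
    by rewrite !trmx_mul trmxK symX mulmxA.
  by rewrite /bil -h [RHS]mxE.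
have psd' u : 0 <= quad X' u.
  rewrite quadX'; have := psdX (u - (bil X (delta_mx i 0) u / dd) *: delta_mx i 0).
  set c := bil X (delta_mx i 0) u / dd.
  rewrite -scaleNr !quad_bil bilDl !bilDr !bilZl !bilZr bil_delta -/dd bE.
  have -> : bil X (delta_mx i 0) u = c * dd by rewrite /c divfK ?gt_eqF.
  rewrite rE exprMn sqd.
  have -> : bil X (delta_mx i 0) u = c * dd by rewrite /c divfK ?gt_eqF.
  have -> : dd^-1 * (c * dd) ^+ 2 = c ^+ 2 * dd by field; rewrite gt_eqF.
  by move=> h; apply: le_trans h _; lra.
have X'E j : X' j j = X j j - r 0 j ^+ 2.
  by have := quadX' (delta_mx j 0); rewrite !quad_bil !bil_delta dot_delta.
have hn' : (#|[pred j | X' j j != 0%R]| < n)%N.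
  rewrite ltnS in hn; apply: (leq_trans _ hn).
  apply: proper_card; apply/properP; split.
    apply/fintype.subsetP => j; rewrite !inE; apply: contraNN => /eqP Xj.
    have := psd' (delta_mx j 0); rewrite quad_bil bil_delta X'E Xj sub0r.
    by rewrite oppr_ge0 => h; rewrite oppr_eq0 eq_le h sqr_ge0.
  exists i; rewrite !inE ?Xi// negbK X'E /r !mxE exprMn sqd -/dd.
  by apply/eqP; field; rewrite gt_eqF.
have sym' : X'^T = X' by rewrite /X' linearB/= trmx_mul trmxK symX.
have [nu hnu] := ih X' hn' sym' psd'.
have [g [_ hg]] := normal_law_cos ler01.
pose phi (z : borel_rV R k * R) : 'rV[R]_k := (z.1 : 'rV[R]_k) + z.2 *: r.
have mphi : measurable_fun [set: borel_rV R k * R] (phi : _ -> borel_rV R k).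
  apply: measurable_fun_rV => j.
  rewrite (_ : (fun w => _) = (fun w => (w.1 : 'rV[R]_k) 0 j + w.2 * r 0 j)).
    apply: measurable_funD; last by apply: measurable_funM => //; exact: measurable_snd.
    have cj : continuous (fun x : 'rV[R]_k => x 0 j) by exact: coord_continuous.
    exact: (measurableT_comp (continuous_measurable_rV cj) measurable_fst).
  by apply/funext => w; rewrite /phi !mxE.
have [nu' hnu'] := pushforward_rV (nu \x g)%E mphi.
exists nu' => u b.
have bcos := bounded_continuous_cos u b.
have [mc bc] := bounded_continuous_comp mphi bcos.
rewrite /Rintegral hnu'// -(integral12_prod_meas1 (bounded_integrable _ mc bc))/=.
transitivity (fine (\int[nu]_x (expR (- (dot r u ^+ 2 / 2)) * cos (dot x u + b))%:E)).
  congr fine; apply: eq_integral => x _.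
  have := hg (dot r u) (dot x u + b); rewrite mul1r => <-.
  rewrite -integral_bounded.
  - apply: eq_integral => t _; congr (cos _)%:E.
    by rewrite /phi dotDl dotZl/=; ring.
  - exact: measurable_cos_affine.
  - by exists 1 => t; rewrite ler_norml cos_geN1 cos_le1.
rewrite -/(Rintegral nu setT (fun x => expR (- (dot r u ^+ 2 / 2)) * cos (dot x u + b))).
have [mc' bc'] := @bounded_continuous_comp _ _ _ _ (fun x : borel_rV R k => (x : 'rV[R]_k)) (@measurable_id _ _ _) _ bcos.
rewrite RintegralZl//; last exact: bounded_integrable.
by rewrite hnu mulrA -expRD quadX'; congr (expR _ * _); field.
Qed.

Lemma gaussian_is_mvnormal nu (X : 'M[R]_k) : X^T = X -> (forall u, 0 <= quad X u) ->
  has_gaussian_transform nu X -> is_mvnormal nu 0 X.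
Proof.
move=> symX psdX hnu; split; first by split=> // u; exact: psdX.
move=> u A mA; rewrite mul0mx mxE -/(quad X u).
have [g [gE hg]] := normal_law_cos (psdX u).
rewrite -gE.
have mu : measurable_fun [set: borel_rV R k] ((fun x : 'rV[R]_k => dot x u) : borel_rV R k -> R).
  by apply: continuous_measurable_rV; exact: continuous_dot.
pose Y : {mfun borel_rV R k >-> R} :=
  MeasurableFun.Pack (MeasurableFun.Class (isMeasurableFun.Build _ _ _ _ _ mu)).
apply: (@trig_determines R (distribution nu Y) g) => // t b.
rewrite hg.
have m1 : measurable_fun setT (fun y : R => cos (t * y + b)).
  exact: measurable_cos_affine.
have bcos := bounded_continuous_cos (t *: u) b.
have mid := @measurable_id _ (borel_rV R k) setT.
have [mc bc] := @bounded_continuous_comp _ _ _ _ (fun x : borel_rV R k => (x : 'rV[R]_k)) mid _ bcos.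
rewrite [quad X u * _]mulrC -quadZ -hnu /Rintegral integral_distribution//.
- by congr fine; apply: eq_integral => x _; rewrite dotZr.
- exact/measurable_EFinP.
- have := bounded_integrable nu mc bc; apply: eq_integrable => // x _ /=.
  by rewrite dotZr.
Qed.

End Gaussian.

(** * The central limit theorem at a given scale *)

Section UrnLimit.
Variables (R : realType) (k : nat) (theta : R) (Rep : 'M[R]_k) (mu : 'rV[R]_k).
Hypotheses (hk : (2 <= k)%N) (htheta : 1 <= theta) (hRep : stochastic Rep).
Local Notation c := (draw_norm k theta).
Hypothesis hmu : (const_mx theta - mu) *m Rep = c *: mu.

Definition noise_cov : 'M[R]_k := Rep^T *m
  (diag_mx (stat theta mu) - (stat theta mu)^T *m stat theta mu) *m Rep.

Lemma noise_cov_tr : noise_cov^T = noise_cov.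
Proof.
by rewrite /noise_cov !trmx_mul trmxK linearB/= tr_diag_mx trmx_mul trmxK mulmxA.
Qed.

Lemma noise_varE v : noise_var theta Rep mu v = bil noise_cov v v.
Proof.
rewrite /noise_cov bil_conj bilB /noise_var; congr (_ - _).
  rewrite /bil mul_mx_diag mxE; apply: eq_bigr => j _; rewrite !mxE; ring.
by rewrite -dotE bil_outer.
Qed.

Lemma acc_varE A n v : acc_var theta Rep mu A n v = bil (acc_cov A noise_cov n) v v.
Proof.
elim: n v => [|n ih] v /=; first by rewrite bil0.
by rewrite ih noise_varE bilD bil_conj back_mxE.
Qed.

Variables (A : 'M[R]_k) (a : R) (N : 'cV[R]_k -> R) (s : nat -> R) (Sigma : 'M[R]_k).
Hypothesis hA : forall y : 'rV[R]_k, \sum_j y 0 j = 0 ->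
  y *m A = - c^-1 *: (y *m Rep).
Hypotheses (a0 : 0 <= a) (hN : growth_norm A a N) (hs : clt_scale a s).
Hypothesis symSigma : Sigma^T = Sigma.
Hypothesis hSigma : forall v e, 0 < e -> \forall n \near \oo,
  `|bil (acc_cov A noise_cov n) v v - s n * bil Sigma v v| <= e * s n.

Let hSigma' v e : 0 < e -> \forall n \near \oo,
  `|acc_var theta Rep mu A n v - s n * quad Sigma v| <= e * s n.
Proof.
by move=> e0; apply: filterS (hSigma v e0) => n; rewrite -acc_varE.
Qed.

(** A limit of accumulated variances, for the urn started from a row of Rep. *)
Lemma limit_cov_psd v : 0 <= quad Sigma v.
Proof.
rewrite leNgt; apply/negP => q0.
have i0 : 'I_k by exact: (Ordinal (ltnW hk)).
have e0 : 0 < - quad Sigma v / 2 by lra.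
have [n [n1 n2]] := filter_ex (filterI (hSigma' v e0) (near_scale_gt0 hs)).
have := acc_var_ge0 hk htheta hRep hmu hA a0 hN hs (hRep i0) n v.
move: n1; rewrite ler_norml => /andP[_]; nra.
Qed.

Section FixedStart.
Variable U0 : 'rV[R]_k.
Hypothesis hU0 : prob_vector U0.

Definition scaled_mean n (f : 'rV[R]_k -> R) :=
  urn_mean theta Rep U0 n (fun x => f ((Num.sqrt (s n))^-1 *: (x - n%:R *: mu))).

Lemma scaled_mean_functional n : mean_functional (scaled_mean n).
Proof.
split=> [f g _ _|t f _|f g _ _ fg|].
- by rewrite /scaled_mean urn_meanD.
- by rewrite /scaled_mean urn_meanZ.
- exact: urn_mean_le.
- exact: urn_mean_cst.
Qed.

Let scaled_dot n x u : dot ((Num.sqrt (s n))^-1 *: (x - n%:R *: mu)) u =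
  (Num.sqrt (s n))^-1 * dot (deviation mu n x) u + (Num.sqrt (s n))^-1 * dot mu u.
Proof.
rewrite dotZl -mulrDr -dotDl; congr (_ * dot _ _).
by rewrite /deviation -[n.+1]addn1 natrD scalerDl scale1r opprD addrA subrK.
Qed.

Let near_n_le : \forall n \near \oo, n%:R <= s n. Proof. by case: hs. Qed.

(** Centring at n mu rather than (n+1) mu shifts the cosine by an angle of order
    1 / sqrt(s_n). *)
Lemma scaled_mean_cos u b d : 0 < d -> \forall n \near \oo,
  `|scaled_mean n (fun x => cos (dot x u + b)) - expR (- (quad Sigma u / 2)) * cos b| <= d.
Proof.
move=> d0.
have d2 : 0 < d / 2 by lra.
have h := urn_clt_fourier hk htheta hRep hmu hA a0 hN hs hU0 b hSigma' (limit_cov_psd u) d2.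
near=> n.
have n0 : 0 < n%:R :> R by rewrite ltr0n; near: n; exact: nbhs_infty_gt.
have sn : n%:R <= s n by near: n; exact: near_n_le.
have hn : 4 * dot mu u ^+ 2 / d ^+ 2 <= n%:R by near: n; exact: nbhs_infty_ger.
pose z := (Num.sqrt (s n))^-1 * dot mu u.
have s0 : 0 < s n by exact: lt_le_trans sn.
have z2 : `|z| <= d / 2.
  rewrite -(@ler_pXn2r _ 2)// ?nnegrE//; last exact: ltW.
  rewrite real_normK ?num_real// /z exprMn exprVn sqr_sqrtr; last exact: ltW.
  rewrite ler_pdivrMl//.
  rewrite ler_pdivrMr ?exprn_gt0// in hn.
  have : n%:R * d ^+ 2 <= s n * d ^+ 2 by rewrite ler_wpM2r// sqr_ge0.
  lra.
have h1 : `|urn_mean theta Rep U0 n (fun x => cos ((Num.sqrt (s n))^-1 * dot (deviation mu n x) u + b))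
    - expR (- (quad Sigma u / 2)) * cos b| <= d / 2 by near: n.
have h2 : `|scaled_mean n (fun x => cos (dot x u + b)) -
    urn_mean theta Rep U0 n (fun x => cos ((Num.sqrt (s n))^-1 * dot (deviation mu n x) u + b))| <= d / 2.
  rewrite /scaled_mean -urn_meanB//; apply: le_trans (urn_mean_norm _ _ _ _ _ _) _ => //.
  rewrite -[leRHS](urn_mean_cst hk htheta hRep hU0 n); apply: urn_mean_le => // x _.
  rewrite scaled_dot addrAC; apply: le_trans (cos_lipschitz _ _) _; exact: z2.
have := ler_distD (urn_mean theta Rep U0 n (fun x => cos ((Num.sqrt (s n))^-1 * dot (deviation mu n x) u + b)))
  (scaled_mean n (fun x => cos (dot x u + b))) (expR (- (quad Sigma u / 2)) * cos b).
lra.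
Unshelve. all: by end_near. Qed.

(** Tightness, by Chebyshev's inequality. *)
Lemma scaled_mean_tail i : exists2 K, 0 <= K & forall L, 0 < L ->
  \forall n \near \oo, scaled_mean n (tail L i) <= K / L ^+ 2.
Proof.
pose D0 := \sum_j `|deviation mu 0 U0 0 j|.
have [C C0 hC] := response_bounded hs (sqr_ge0 D0) ler01.
pose e : 'cV[R]_k := delta_mx i 0.
exists (2 * (C * N e ^+ 2) + 2 * mu 0 i ^+ 2).
  have := mulr_ge0 C0 (sqr_ge0 (N e)); have := sqr_ge0 (mu 0 i); lra.
move=> L L0; near=> n.
have n1 : 1 <= n%:R :> R by rewrite ler1n; near: n; exact: nbhs_infty_gt.
have sn : n%:R <= s n by near: n; exact: near_n_le.
have s0 : 0 < s n by apply: lt_le_trans sn; lra.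
have hr : response a (D0 ^+ 2) (fun=> 1) n <= C * s n by near: n.
have m2 := urn_second_moment hk htheta hRep hmu hA a0 hN hU0 n e.
rewrite -/D0 in m2.
have L2 : 0 < L ^+ 2 by rewrite exprn_gt0.
pose q := (s n * L ^+ 2)^-1.
have q0 : 0 <= q by rewrite invr_ge0 mulr_ge0// ltW.
have h1 : scaled_mean n (tail L i) <=
  urn_mean theta Rep U0 n (fun x => 2 * q * dot (deviation mu n x) e ^+ 2 + 2 * q * mu 0 i ^+ 2).
  apply: urn_mean_le => // x _; rewrite /tail ge_min; apply/orP; right.
  rewrite -dot_delta scaled_dot (dot_delta mu) -/e -mulrDr.
  rewrite 2!exprMn !exprVn sqr_sqrtr; last exact: ltW.
  move: (dot _ _) => y.
  have -> : (s n)^-1 * (y + mu 0 i) ^+ 2 / L ^+ 2 = q * (y + mu 0 i) ^+ 2.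
    by rewrite /q; field; rewrite !gt_eqF.
  have -> : 2 * q * y ^+ 2 + 2 * q * mu 0 i ^+ 2 = q * (2 * y ^+ 2 + 2 * mu 0 i ^+ 2) by ring.
  by apply: ler_wpM2l => //; have := sqr_ge0 (y - mu 0 i); lra.
apply: le_trans h1 _; rewrite urn_meanD// urn_meanZ// urn_mean_cst//.
have h2 : q * urn_mean theta Rep U0 n (fun x => dot (deviation mu n x) e ^+ 2) <= C * N e ^+ 2 / L ^+ 2.
  apply: (@le_trans _ _ (q * (C * s n * N e ^+ 2))).
    apply: ler_wpM2l => //; apply: le_trans m2 _.
    by apply: ler_wpM2r => //; exact: sqr_ge0.
  rewrite le_eqVlt; apply/orP; left; apply/eqP; rewrite /q; field.
  by rewrite !gt_eqF.
have h3 : q * mu 0 i ^+ 2 <= mu 0 i ^+ 2 / L ^+ 2.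
  rewrite mulrC; apply: ler_wpM2l; first exact: sqr_ge0.
  rewrite /q lef_pV2 ?posrE ?mulr_gt0//.
  by rewrite ler_peMl//; [exact: ltW | lra].
rewrite mulrDl; lra.
Unshelve. all: by end_near. Qed.

End FixedStart.

Lemma urn_clt : exists (Sigma : 'M[R]_k) (nu : probability (borel_rV R k) R),
  is_mvnormal nu 0 Sigma /\
  forall (U0 : 'rV[R]_k), prob_vector U0 ->
  forall (d : measure_display) (T : measurableType d) (P : probability T R)
    (U : nat -> T -> 'rV[R]_k) (Z : nat -> T -> 'I_k),
    negative_urn P theta Rep U0 U Z ->
    cvg_in_law P (fun n w => (Num.sqrt (s n))^-1 *: (U n w - n%:R *: mu)) nu.
Proof.
have [nu hnu] := gaussian_exists symSigma limit_cov_psd.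
exists Sigma, nu; split; first exact: (gaussian_is_mvnormal symSigma limit_cov_psd hnu).
move=> U0 hU0 d T P U Z hU f cf bf.
have hf : bounded_continuous f.
  split=> //; have [B [_ hB]] := bf; exists (B + 1) => x.
  by apply: hB => //; rewrite ltrDl.
have mid := @measurable_id _ (borel_rV R k) setT.
have [mf bf'] := bounded_continuous_comp mid hf.
pose E := law_mean nu (fun x : borel_rV R k => (x : 'rV[R]_k)).
have hE : mean_functional E := law_mean_functional nu mid.
rewrite (integral_bounded nu mf bf').
rewrite (_ : (fun n => _) = fun n => (scaled_mean U0 n f)%:E); last first.
  apply/funext => n.
  exact: (urn_law hU n (fun x => f ((Num.sqrt (s n))^-1 *: (x - n%:R *: mu)))).
apply: cvg_EFin; first by near=> n.
apply/cvgrPdist_le => e e0.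
have tE : forall u b, E (fun x => cos (dot x u + b)) = expR (- (quad Sigma u / 2)) * cos b.
  by move=> u b; exact: hnu.
have hcos u b e1 : 0 < e1 -> \forall n \near \oo,
   `|scaled_mean U0 n (fun x => cos (dot x u + b)) - E (fun x => cos (dot x u + b))| <= e1.
  by rewrite tE; exact: scaled_mean_cos.
have htail i e1 : 0 < e1 -> exists2 L0, 0 < L0 & forall L, L0 <= L ->
     E (tail L i) <= e1 /\ \forall n \near \oo, scaled_mean U0 n (tail L i) <= e1.
  move=> e10; have [L1 L10 hL1] := law_mean_tail nu mid i e10.
  have [K K0 hK] := scaled_mean_tail hU0 i.
  have Ke : 0 <= K / e1 by rewrite divr_ge0// ltW.
  exists (L1 + 1 + K / e1) => [|L hL]; first lra.
  split; first by apply: hL1; lra.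
  have L0 : 0 < L by lra.
  apply: filterS (hK L L0) => n hn; apply: le_trans hn _.
  rewrite ler_pdivrMr ?exprn_gt0//.
  have : K <= e1 * L by rewrite mulrC -ler_pdivrMr//; lra.
  move=> /le_trans; apply; apply: ler_wpM2l; first exact: ltW.
  by rewrite expr2 ler_peMl//; [exact: ltW | lra].
have := weak_convergence (scaled_mean_functional hU0) hE hcos htail hf e0.
by apply: filterS => n; rewrite distrC.
Unshelve. all: by end_near. Qed.

End UrnLimit.

(** * The growth regimes of the urn *)

Section Cases.
Variables (R : realType).

Lemma eigenvalueN1_unit k (Rep : 'M[R]_k) : ~~ eigenvalue Rep (-1) ->
  (1%:M - - Rep) \in unitmx.
Proof.
rewrite /eigenvalue /eigenspace negbK kermx_eq0 row_free_unit.
by rewrite opprK addrC raddfN/= opprK.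
Qed.

(** The second eigenvalue is read off the trace, and rows of sum zero are its
    eigenvectors. *)
Lemma stochastic2_eigen (Rep : 'M[R]_2) lambda : stochastic Rep ->
  char_poly Rep = ('X - 1%:P) * ('X - lambda%:P) ->
  lambda <= 1 /\ forall y : 'rV[R]_2, \sum_j y 0 j = 0 -> y *m Rep = lambda *: y.
Proof.
move=> hRep hchar.
have := char_poly_trace Rep (isT : (0 < 2)%N); rewrite hchar /=.
have -> : (('X - 1%:P) * ('X - lambda%:P) : {poly R})`_1 = - (1 + lambda).
  by rewrite coefM !big_ord_recl big_ord0 !coefB !coefX !coefC /=; ring.
move=> /oppr_inj; rewrite /mxtrace !big_ord_recl big_ord0/= addr0.
set i0 := ord0; set i1 := lift _ _ => tr.
have sum2 i : Rep i i0 + Rep i i1 = 1.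
  by have := stochastic_row_sum i hRep; rewrite !big_ord_recl big_ord0 addr0.
have s0 := sum2 i0; have s1 := sum2 i1.
have g10 := stochastic_ge0 i1 i0 hRep; have g01 := stochastic_ge0 i0 i1 hRep.
split; first lra.
move=> y; rewrite !big_ord_recl big_ord0 addr0 -/i0 -/i1 => y0.
have y1 : y 0 i1 = - y 0 i0 by lra.
apply/rowP => j; rewrite !mxE !big_ord_recl big_ord0 addr0 -/i0 -/i1 y1.
have [->|->] : j = i0 \/ j = i1.
- by case: j => [[|[|//]] hj]; [left | right]; apply: val_inj.
- have -> : lambda = Rep i0 i0 - Rep i1 i0 by lra.
  by ring.
- have -> : lambda = Rep i1 i1 - Rep i0 i1 by lra.
  by rewrite y1; ring.
Qed.

End Cases.

Section Regimes.
Variables (R : realType) (k : nat) (theta : R) (Rep : 'M[R]_k) (mu : 'rV[R]_k).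
Hypotheses (hk : (2 <= k)%N) (htheta : 1 <= theta) (hRep : stochastic Rep).
Local Notation c := (draw_norm k theta).
Hypothesis hmu : (const_mx theta - mu) *m Rep = c *: mu.

Definition normal_limit (sigma : nat -> R) : Prop :=
  exists (Sigma : 'M[R]_k) (nu : probability (borel_rV R k) R),
    is_mvnormal nu 0 Sigma /\
    forall (U0 : 'rV[R]_k), prob_vector U0 ->
    forall (d : measure_display) (T : measurableType d) (P : probability T R)
      (U : nat -> T -> 'rV[R]_k) (Z : nat -> T -> 'I_k),
      negative_urn P theta Rep U0 U Z ->
      cvg_in_law P (fun n w => (sigma n)^-1 *: (U n w - n%:R *: mu)) nu.

Lemma normal_limit_noncritical A a N :
  (forall y : 'rV[R]_k, \sum_j y 0 j = 0 -> y *m A = - c^-1 *: (y *m Rep)) ->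
  0 <= a < 2^-1 -> growth_norm A a N -> normal_limit (fun n => Num.sqrt n%:R).
Proof.
move=> hA ha hN; have /andP[a0 _] := ha.
have [Sigma symS hS] := noncritical_covariance ha hN (noise_cov_tr theta Rep mu).
exact: (urn_clt hk htheta hRep hmu hA a0 hN (clt_scale_linear ha) symS hS).
Qed.

Lemma normal_limit_critical A Q a N :
  (forall y : 'rV[R]_k, \sum_j y 0 j = 0 -> y *m A = - c^-1 *: (y *m Rep)) ->
  0 <= a < 2^-1 -> growth_norm A 2^-1 N ->
  Q *m A = A *m Q -> A *m (1%:M - Q) = 2^-1 *: (1%:M - Q) ->
  (forall (h : R) v, 0 <= h <= 1 ->
    N (Q *m v + h *: (A *m (Q *m v))) <= (1 + a * h) * N (Q *m v)) ->
  normal_limit (fun n => Num.sqrt (n%:R * ln n%:R)).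
Proof.
move=> hA ha hN QA AQ NQ.
have half0 : 0 <= (2^-1 : R) by rewrite invr_ge0.
have [Sigma symS hS] := critical_covariance ha hN QA AQ NQ (noise_cov_tr theta Rep mu).
exact: (urn_clt hk htheta hRep hmu hA half0 hN (@clt_scale_nlogn R) symS hS).
Qed.

(** For c > 2 the sup norm grows at rate 1/c < 1/2. Otherwise k theta <= 3 forces
    k = 3 and theta = 1, and - Rep is a contraction: the projection Q is the
    identity unless -1 is an eigenvalue. *)
Lemma normal_limit_many : (3 <= k)%N -> normal_limit (sigma_many theta Rep).
Proof.
move=> k3; have [c2|c2] := ltP 2 c.
  have -> : sigma_many theta Rep = fun n => Num.sqrt n%:R.
    apply/funext => n; rewrite /sigma_many; case: ifP => // /and3P[/eqP e1 /eqP e2 _].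
    by move: c2; rewrite /draw_norm e1 e2 mulr1; lra.
  apply: (@normal_limit_noncritical (- c^-1 *: Rep) c^-1 (fun v => `|v|)).
  - by move=> y _; rewrite -scalemxAr.
  - rewrite invr_ge0 ltf_pV2 ?posrE//; last lra.
    by rewrite c2 andbT; lra.
  - by apply: growth_norm_stochastic => //; lra.
have k3R : 3 <= k%:R :> R by rewrite (ler_nat _ 3).
have e1 : theta = 1 by move: c2; rewrite /draw_norm; have := htheta; nra.
have e2 : k = 3%N.
  apply/eqP; rewrite eqn_leq k3 andbT -(ler_nat R).
  by move: c2; rewrite /draw_norm e1 mulr1; lra.
have ec : c = 2 by rewrite /draw_norm e1 e2; lra.
have T_contr (v : 'cV[R]_k) : `|- Rep *m v| <= `|v|.
  by rewrite mulNmx normrN; exact: stochastic_norm_le.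
have [Q [N [a [ha hN [QT TQ] NQ hQ]]]] := half_contraction_norm T_contr.
have hA (y : 'rV[R]_k) : \sum_j y 0 j = 0 -> y *m (2^-1 *: - Rep) = - c^-1 *: (y *m Rep).
  by move=> _; rewrite ec scalerN mulmxN -scalemxAr scaleNr.
case: (boolP (eigenvalue Rep (-1))) => ev.
  have -> : sigma_many theta Rep = fun n => Num.sqrt (n%:R * ln n%:R).
    by apply/funext => n; rewrite /sigma_many (introT eqP e2) e1 eqxx ev.
  apply: (@normal_limit_critical (2^-1 *: - Rep) Q a N) => //.
    by rewrite -scalemxAl -scalemxAr QT.
  by rewrite -scalemxAl TQ.
have -> : sigma_many theta Rep = fun n => Num.sqrt n%:R.
  by apply/funext => n; rewrite /sigma_many (negbTE ev) !andbF.
apply: (@normal_limit_noncritical (2^-1 *: - Rep) a N) => //.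
case: hN => N1 N2 _; split=> // h v hh; move: (NQ h v hh).
by rewrite (hQ (eigenvalueN1_unit ev)) !mul1mx.
Qed.

End Regimes.

(** On rows of sum zero Rep is the scalar lambda, so A can be taken scalar; in the
    critical case Q = 0. *)
Lemma normal_limit_two (R : realType) (theta lambda : R) (Rep : 'M[R]_2) (mu : 'rV[R]_2) :
  1 <= theta -> stochastic Rep ->
  (const_mx theta - mu) *m Rep = draw_norm 2 theta *: mu ->
  char_poly Rep = ('X - 1%:P) * ('X - lambda%:P) -> (1 - 2 * theta) / 2 <= lambda ->
  normal_limit theta Rep mu (sigma_two theta lambda).
Proof.
move=> htheta hRep hmu hchar hlam.
have [lam1 hy] := stochastic2_eigen hRep hchar.
pose c := draw_norm 2 theta.
have cE : c = 2 * theta - 1 by [].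
have c1 : 1 <= c by lra.
pose al := - lambda / c.
have alc : al * c = - lambda by rewrite /al divfK// gt_eqF//; lra.
have hA (y : 'rV[R]_2) : \sum_j y 0 j = 0 -> y *m (al *: 1%:M) = - c^-1 *: (y *m Rep).
  by move=> y0; rewrite -scalemxAr mulmx1 hy// scalerA /al mulNr mulrC -mulNr.
have half : (2^-1 : R) = 1 / 2 by rewrite div1r.
have al1 : -1 <= al by nra.
have gN := growth_norm_scalar 2 al1.
have [elam|nlam] := eqVneq lambda ((1 - 2 * theta) / 2).
  have al2 : al = 2^-1 by rewrite half; nra.
  have -> : sigma_two theta lambda = fun n => Num.sqrt (n%:R * ln n%:R).
    by apply/funext => n; rewrite /sigma_two elam eqxx.
  have mx : Num.max al 0 = 2^-1 by rewrite al2; apply/max_idPl; rewrite invr_ge0.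
  rewrite mx in gN.
  apply: (@normal_limit_critical _ _ _ _ _ _ _ _ hmu (al *: 1%:M) 0 0 (fun v => `|v|)) => //.
  - by rewrite lexx half; lra.
  - by rewrite mul0mx mulmx0.
  - by rewrite subr0 mulmx1 al2.
  - by move=> h v _; rewrite !mul0mx mulmx0 scaler0 addr0 normr0 mulr0.
have al2 : al < 1 / 2.
  have : (1 - 2 * theta) / 2 < lambda by rewrite lt_def nlam.
  by nra.
have -> : sigma_two theta lambda = fun n => Num.sqrt n%:R.
  by apply/funext => n; rewrite /sigma_two (negbTE nlam).
apply: (@normal_limit_noncritical _ _ _ _ _ _ _ _ hmu (al *: 1%:M) (Num.max al 0) (fun v => `|v|)) => //.
by rewrite le_max lexx orbT gt_max half al2; lra.
Qed.

Theorem theorem2 (R : realType) (k : nat) (theta : R) (Rep : 'M[R]_k)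
    (mu : 'rV[R]_k) (sigma : nat -> R)
    (hk : (2 <= k)%N) (htheta : 1 <= theta) (hRep : stochastic Rep)
    (hirr : irreducible_mx (Rhat theta Rep))
    (hmu : (const_mx theta - mu) *m Rep = (k%:R * theta - 1) *: mu)
    (hsigma :
      ((3 <= k)%N /\ forall n, sigma n = sigma_many theta Rep n) \/
      (exists lambda : R,
        [/\ k = 2%N, 1 <= theta <= 3 / 2,
            char_poly Rep = ('X - 1%:P) * ('X - lambda%:P),
            (1 - 2 * theta) / 2 <= lambda &
            forall n, sigma n = sigma_two theta lambda n])) :
  exists (Sigma : 'M[R]_k) (nu : probability (borel_rV R k) R),
    is_mvnormal nu 0 Sigma /\
    forall (U0 : 'rV[R]_k), prob_vector U0 ->
    forall (d : measure_display) (T : measurableType d) (P : probability T R)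
      (U : nat -> T -> 'rV[R]_k) (Z : nat -> T -> 'I_k),
      negative_urn P theta Rep U0 U Z ->
      cvg_in_law P (fun n w => (sigma n)^-1 *: (U n w - n%:R *: mu)) nu.
Proof.
change (normal_limit theta Rep mu sigma).
case: hsigma => [[k3 /funext ->]|[lambda [k2 _ hchar hlam /funext ->]]].
  exact: normal_limit_many.
subst k; exact: normal_limit_two.
Qed.
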